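(* Let $\Omega$ be a thick open subset of $\mathbb{R}^n$, and suppose that the shape function $h\in L^1(\mathbb{R}^n)$ satisfies: $h(x)\ge 0$ for all $x\in\mathbb{R}^n$; $h(Ox)=h(x)$ for all $x\in\mathbb{R}^n$ and all orthogonal matrices $O\in\mathbb{R}^{n\times n}$; $\|h\|_{L^1(\mathbb{R}^n)}=1$; and $h$ is radially decreasing, i.e. $h(y)\le h(x)$ whenever $\|x\|\le\|y\|$. Then there exists $\epsilon_0>0$ such that for every $p\in[1,\infty]$, $\{\tilde P_\epsilon\}_{0<\epsilon<\epsilon_0}$ is a (well-defined) uniformly bounded family of operators from $L^p(\Omega)$ to itself. In addition, if $\Omega$ is bounded and $h$ satisfies the decay bound $|h(x)|\le C(1+\|x\|)^{-(n+\delta)}$ for all $x\in\mathbb{R}^n$ and some $C,\delta>0$, then the following hold. 1. For every $p\in(1,\infty)$ and $f\in L^p(\Omega)$, $\tilde P_\epsilon f$ converges to $f$ in $L^p(\Omega)$ norm as $\epsilon\to0^+$. 2. For every $p\in(1,\infty]$ with conjugate exponent $q$, $\frac1p+\frac1q=1$: if $h\in L^1(\mathbb{R}^n)\cap L^q(\mathbb{R}^n)$, then for every $f\in L^p(\Omega)$ and $\epsilon\in(0,\epsilon_0)$, $\tilde P_\epsilon f$ lies in $C_b(\Omega)$. 3. If $h\in L^1(\mathbb{R}^n)\cap H^r(\mathbb{R}^n)$ with $r\in\mathbb{N}_0$, then for every $f\in L^2(\Omega)$ and $\epsilon\in(0,\epsilon_0)$, $\tilde P_\epsilon f$ lies in 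$C^r(\Omega)$.
   Context: $\|\cdot\|$ is the Euclidean norm, $|\cdot|$ of a set is Lebesgue measure, and $B_\epsilon(x)$ is the open Euclidean ball of radius $\epsilon$ centered at $x$. All functions are real-valued. A Lebesgue-measurable set $\Omega\subseteq\mathbb{R}^n$ is thick if there exist $c,\epsilon_0>0$ such that $|B_\epsilon(x)\cap\Omega|>c\,|B_\epsilon(x)|$ for all $\epsilon\in(0,\epsilon_0)$ and all $x\in\Omega$. For $\epsilon>0$ set $h_\epsilon(x)=\epsilon^{-n}h(x/\epsilon)$, $k_\epsilon(x,y)=h_\epsilon(y-x)$, $d_\epsilon(x)=\int_\Omega k_\epsilon(x,y)\,dy$, and $$q_\epsilon(x)=\int_\Omega\frac{k_\epsilon(x,y)}{d_\epsilon(y)}\,dy .$$ Whenever $d_\epsilon$ and $q_\epsilon$ are positive on $\Omega$, the bistochastic kernel is $$\tilde p_\epsilon(x,y)=\int_\Omega\frac{k_\epsilon(x,z)\,k_\epsilon(z,y)}{d_\epsilon(x)\,q_\epsilon(z)\,d_\epsilon(y)}\,dz,\qquad x,y\in\Omega,$$ and $\tilde P_\epsilon f(x)=\int_\Omega\tilde p_\epsilon(x,y)f(y)\,dy$ for $x\in\Omega$. $C_b(\Omega)$ is the space of bounded continuous functions on $\Omega$; $C^r(\Omega)$ is the space of $r$-times continuously differentiable functions on $\Omega$; $H^r(\mathbb{R}^n)$ is the set of $h\in L^2(\mathbb{R}^n)$ whose Fourier transform $\hat h$ satisfies $\int_{\mathbb{R}^n}|\hat h(\omega)|^2(1+\|\omega\|^2)^r\,d\omega<\infty$.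 *)

(* Defs.v *)
From HB Require Import structures.
From mathcomp Require Import all_boot all_order all_algebra.
From mathcomp Require Import all_classical all_reals all_analysis.

Set Implicit Arguments.
Unset Strict Implicit.
Unset Printing Implicit Defensive.

Import Order.TTheory GRing.Theory Num.Def Num.Theory.
Import numFieldNormedType.Exports.

Local Open Scope classical_set_scope.
Local Open Scope ring_scope.

Section rV_measurable.
Context (R : realType) (n : nat).

Definition rV_coord (i : 'I_n) (x : 'rV[R]_n) : R := x 0 i.

(* The product sigma-algebra: by [rV_measurableE], the Borel sets of R^n. *)
Let rV_set0 : g_sigma_preimage rV_coord set0.
Proof. exact: sigma_algebra0. Qed.

Let rV_setC A : g_sigma_preimage rV_coord A -> g_sigma_preimage rV_coord (~` A).
Proof. exact: sigma_algebraC. Qed.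

Let rV_bigcup (F : (set 'rV[R]_n)^nat) :
  (forall i, g_sigma_preimage rV_coord (F i)) ->
  g_sigma_preimage rV_coord (\bigcup_i (F i)).
Proof. exact: sigma_algebra_bigcup. Qed.

HB.instance Definition _ := @isMeasurable.Build default_measure_display
  'rV[R]_n (g_sigma_preimage rV_coord) rV_set0 rV_setC rV_bigcup.

Lemma measurable_rV_coord (i : 'I_n) :
  measurable_fun [set: 'rV[R]_n] (rV_coord i).
Proof.
move=> _ Y mY; rewrite setTI; apply: sub_sigma_algebra => /=.
rewrite -bigcup_seq/=; exists i => /=; first by rewrite mem_index_enum.
by exists Y => //; rewrite setTI.
Qed.

Lemma measurable_fun_rVP d (T : measurableType d) (f : T -> 'rV[R]_n) :
  measurable_fun [set: T] f <->
  forall i, measurable_fun [set: T] (fun t => f t 0 i).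
Proof.
split=> [mf i|mf].
  exact: (measurableT_comp (measurable_rV_coord i) mf).
apply: (@measurability _ _ _ _ _ _
  (\big[setU/set0]_(i < n) preimage_set_system setT (rV_coord i) measurable)).
  by [].
move=> _ [A + <-]; rewrite -bigcup_seq => -[i _ [B mB <-]].
by rewrite !setTI -[X in measurable X]setTI; exact: mf.
Qed.

Lemma measurable_rV_box (B : 'I_n -> set R) : (forall i, measurable (B i)) ->
  measurable [set x : 'rV[R]_n | forall i, B i (x 0 i)].
Proof.
move=> mB; rewrite (_ : mkset _ =
    \bigcap_(i in [set: 'I_n]) (rV_coord i @^-1` B i)); last first.
  by apply/seteqP; split => x /= H i; [move=> _; exact: H|exact: (H i I)].
apply: fin_bigcap_measurable => [|i _]; first exact: finite_finset.
by rewrite -[X in measurable X]setTI; exact: measurable_rV_coord.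
Qed.

Lemma open_rV_measurable (U : set 'rV[R]_n) : open U -> measurable U.
Proof.
move=> oU.
pose box (q : {ffun 'I_n -> rat * rat}) : set 'rV[R]_n :=
  [set x | forall i, `]ratr (q i).1, ratr (q i).2[%classic (x 0 i)].
pose F q := if `[< box q `<=` U >] then box q else set0.
rewrite (_ : U = \bigcup_q F q).
  apply: countable_bigcupT_measurable => [|q].
    exact: countableP.
  by rewrite /F; case: ifPn => // _; apply: (@measurable_rV_box
    (fun i => `]ratr (q i).1, ratr (q i).2[%classic)).
apply/seteqP; split => [x Ux|x [q _]]; last first.
  by rewrite /F; case: ifPn => // /asboolP qU; exact: qU.
have [P nP PU] : nbhs x U by exact: open_nbhs_nbhs.
have {}nP i : exists ab : rat * rat, (x 0 i \in `]ratr ab.1, ratr ab.2[) /\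
    (`]ratr ab.1, ratr ab.2[%classic `<=` P 0 i).
  have /nbhs_ballP[e/= e0 eP] := nP 0 i.
  have [a] : exists a, ratr a \in `]x 0 i - e, x 0 i[.
    by apply: rat_in_itvoo; rewrite ltrBlDr ltrDl.
  rewrite in_itv/= => /andP[ea ax].
  have [b] : exists b, ratr b \in `]x 0 i, x 0 i + e[.
    by apply: rat_in_itvoo; rewrite ltrDl.
  rewrite in_itv/= => /andP[xb be].
  exists (a, b); split => /=; first by rewrite in_itv/= ax xb.
  move=> y /=; rewrite in_itv/= => /andP[ay yb]; apply: eP.
  rewrite /ball/= ltr_distlC; apply/andP; split.
    exact: lt_trans ea ay.
  exact: lt_trans yb be.
have [f fP] := choice nP.
exists [ffun i => f i] => //; rewrite /F ifT; last first.
  apply/asboolP => y yf; apply: PU => i j; rewrite (ord1 i).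
  by have [_] := fP j; apply; have := yf j; rewrite ffunE.
by move=> i; rewrite ffunE; exact: (fP i).1.
Qed.

Lemma rV_measurableE :
  @measurable _ 'rV[R]_n = <<s [set U : set 'rV[R]_n | open U] >>.
Proof.
apply/seteqP; split; last first.
  apply: smallest_sub; first exact: sigma_algebra_measurable.
  exact: open_rV_measurable.
apply: smallest_sub; first exact: smallest_sigma_algebra.
move=> A; rewrite -bigcup_seq => -[i _ [B mB <-]]; rewrite setTI.
pose T := g_sigma_algebraType [set U : set 'rV[R]_n | open U].
suff : measurable_fun [set: T] (rV_coord i : T -> R).
  by move=> /(_ measurableT B mB); rewrite setTI.
apply: (measurability _ (measurable_realfun.RGenOpens.measurableE R)).
move=> _ [_ [a [b ->] <-]]; rewrite setTI; apply: sub_sigma_algebra => /=.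
apply: open_comp; last exact: interval_open.
by move=> x _; exact: coord_continuous.
Qed.

End rV_measurable.

Section lebesgue.
Context (R : realType).

Definition cons_rV n (p : measurableTypeR R * 'rV[R]_n) : 'rV[R]_n.+1 :=
  \row_i (if unlift ord0 i is Some j then p.2 0 j else p.1).

Lemma measurable_cons_rV n : measurable_fun setT (@cons_rV n).
Proof.
apply/measurable_fun_rVP => i.
have [j ->|->] := unliftP ord0 i.
  rewrite (_ : (fun _ => _) = @rV_coord R n j \o snd).
    exact: (measurableT_comp (@measurable_rV_coord R n j) measurable_snd).
  by apply/funext => p; rewrite mxE liftK.
rewrite (_ : (fun _ => _) = fst); first exact: measurable_fst.
by apply/funext => p; rewrite mxE unlift_none.
Qed.

Definition uncons_rV n (x : 'rV[R]_n.+1) : measurableTypeR R * 'rV[R]_n :=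
  (x 0 ord0, \row_j x 0 (lift ord0 j)).

Lemma cons_rVK n : cancel (@cons_rV n) (@uncons_rV n).
Proof.
move=> [t x]; congr (_, _); first by rewrite mxE unlift_none.
by apply/rowP => j; rewrite !mxE liftK.
Qed.

Lemma measurable_uncons_rV n : measurable_fun setT (@uncons_rV n).
Proof.
apply: measurable_fun_pair; first exact: (measurable_rV_coord ord0).
apply/measurable_fun_rVP => j.
rewrite (_ : (fun _ => _) = @rV_coord R n.+1 (lift ord0 j)).
  exact: measurable_rV_coord.
by apply/funext => x /=; rewrite mxE.
Qed.

Section step.
Context (n : nat) (m : {sigma_finite_measure set 'rV[R]_n -> \bar R}).

Definition leb_step : set 'rV[R]_n.+1 -> \bar R :=
  pushforward (lebesgue_measure \x m)%E (@cons_rV n).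

Let leb_step0 : leb_step set0 = 0%E.
Proof. by rewrite /leb_step /pushforward preimage_set0 measure0. Qed.

Let leb_step_ge0 A : (0 <= leb_step A)%E.
Proof. by rewrite /leb_step /pushforward; exact: measure_ge0. Qed.

Let leb_step_sigma_additive : semi_sigma_additive leb_step.
Proof.
move=> F mF tF mUF; rewrite /leb_step /pushforward preimage_bigcup.
apply: measure_semi_sigma_additive.
- by move=> k; rewrite -[X in measurable X]setTI; exact: measurable_cons_rV.
- apply/trivIsetP => /= i j _ _ ij; rewrite -preimage_setI.
  by move/trivIsetP : tF => /(_ _ _ _ _ ij) ->//; rewrite preimage_set0.
- rewrite -preimage_bigcup -[X in measurable X]setTI.
  exact: measurable_cons_rV.
Qed.

HB.instance Definition _ := isMeasure.Build _ _ _ leb_step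
  leb_step0 leb_step_ge0 leb_step_sigma_additive.

Let leb_step_sigma_finite : sigma_finite setT leb_step.
Proof.
have /sigma_finiteP[F [TF ndF Foo]] := sigma_finiteT (@lebesgue_measure R).
have /sigma_finiteP[G [TG ndG Goo]] := sigma_finiteT m.
exists (fun k => @uncons_rV n @^-1` (F k `*` G k)).
  rewrite -preimage_bigcup (_ : \bigcup_k _ = setT) ?preimage_setT//.
  rewrite -setXTT TF TG predeqE => -[x y]; split.
    by move=> [k _ []/= ? ?]; split; exists k.
  move=> [/= [k _ Fkx] [l _ Gly]]; exists (maxn k l) => //; split.
  - by move: x Fkx; exact/subsetPset/ndF/leq_maxl.
  - by move: y Gly; exact/subsetPset/ndG/leq_maxr.
move=> k; have [mF Fk] := Foo k; have [mG Gk] := Goo k; split.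
  rewrite -[X in measurable X]setTI.
  by apply: measurable_uncons_rV => //; exact: measurableX.
rewrite /leb_step /pushforward -comp_preimage (_ : _ \o _ = id); last first.
  by apply/funext => p; exact: cons_rVK.
by rewrite preimage_id product_measure1E// lte_mul_pinfty// ge0_fin_numE.
Qed.

HB.instance Definition _ := Measure_isSigmaFinite.Build _ _ _ leb_step
  leb_step_sigma_finite.

End step.

(* Lebesgue measure, built one coordinate at a time; see [leb_box]. *)
Fixpoint leb (n : nat) : {sigma_finite_measure set 'rV[R]_n -> \bar R} :=
  if n is k.+1 then leb_step (leb k) else \d_(0 : 'rV[R]_0).

Lemma leb_box n (a b : 'rV[R]_n) : (forall i, a 0 i <= b 0 i) ->
  leb n [set x : 'rV[R]_n | forall i, x 0 i \in `[a 0 i, b 0 i]] =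
  (\prod_i (b 0 i - a 0 i))%R%:E.
Proof.
elim: n a b => [|n IHn] a b ab.
  rewrite big_ord0 /= diracE mem_set//= => -[].
  by [].
rewrite -[LHS]/((lebesgue_measure \x leb n)%E (@cons_rV n @^-1` _)).
pose ua := (uncons_rV a).2; pose ub := (uncons_rV b).2.
transitivity ((lebesgue_measure \x leb n)%E
    ((`[a 0 0, b 0 0]%classic : set (measurableTypeR R)) `*`
     [set x : 'rV[R]_n | forall i, x 0 i \in `[ua 0 i, ub 0 i]])).
  congr (_ _).
  apply/seteqP; split => [[t x]/= H|[t x]/= [H1 H2] i].
    split; first by have := H 0; rewrite !mxE unlift_none.
    move=> i; have := H (lift ord0 i).
    by rewrite !mxE liftK.
  have [j ->|->] := unliftP ord0 i; rewrite !mxE.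
    by rewrite liftK; have := H2 j; rewrite !mxE.
  by rewrite unlift_none.
rewrite product_measure1E//=; last first.
  exact: (@measurable_rV_box R n (fun i => `[ua 0 i, ub 0 i]%classic)).
rewrite IHn; last by move=> i; rewrite !mxE.
rewrite lebesgue_measure_itv/= lte_fin big_ord_recl EFinM.
under eq_bigr do rewrite !mxE.
congr (_ * _)%E; case: ltP => //.
by rewrite le_eqVlt ltNge ab orbF => /eqP ->; rewrite subrr.
Qed.

End lebesgue.

Section euclidean.
Context (R : realType) (n : nat).
Implicit Types x y w : 'rV[R]_n.

Definition edot x y : R := \sum_i x 0 i * y 0 i.

(* The norm [`|x|] that the library puts on ['rV[R]_n] is the sup norm. *)
Definition enorm x : R := Num.sqrt (\sum_i x 0 i ^+ 2).

Definition eball x (e : R) : set 'rV[R]_n := [set y | enorm (y - x) < e].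

Definition thick (Om : set 'rV[R]_n) : Prop :=
  measurable Om /\
  exists c e0 : R, [/\ 0 < c, 0 < e0 &
    forall e x, 0 < e < e0 -> Om x ->
      (c%:E * leb R n (eball x e) < leb R n (eball x e `&` Om))%E].

End euclidean.

Section function_spaces.
Context (R : realType) (n : nat).
Implicit Types (Om : set 'rV[R]_n) (f g : 'rV[R]_n -> R) (p : \bar R).

(* L^p(Om) is handled through extension by zero outside Om. *)
Definition LpOn Om p : set ('rV[R]_n -> R) :=
  [set f | f \_ Om \in Lfun (leb R n) p].

Definition LpnormOn Om p f : \bar R := ('N[leb R n]_p[EFin \o (f \_ Om)])%E.

(* T, given on representatives, induces a linear map from L^p(Om) to itself. *)
Definition Lp_operator Om p (T : ('rV[R]_n -> R) -> 'rV[R]_n -> R) : Prop :=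
  [/\ forall f, LpOn Om p f -> LpOn Om p (T f),
      forall f g, LpOn Om p f -> LpOn Om p g ->
        ae_eq (leb R n) Om f g -> ae_eq (leb R n) Om (T f) (T g) &
      forall (a : R) f g, LpOn Om p f -> LpOn Om p g ->
        ae_eq (leb R n) Om (T (fun x => a * f x + g x))
                           (fun x => a * T f x + T g x)].

Definition Cb Om : set ('rV[R]_n -> R) :=
  [set f | {within Om, continuous f} /\
           exists M : R, forall x, Om x -> `|f x| <= M].

(* For open Om: all partial derivatives of order at most r exist and are
   continuous on Om. *)
Fixpoint Cr (r : nat) Om : set ('rV[R]_n -> R) :=
  if r is s.+1 then
    [set f | {within Om, continuous f} /\
       forall i : 'I_n,
         (forall x, Om x -> derivable f x (delta_mx 0 i)) /\
         Cr s Om (fun x => 'D_(delta_mx 0 i) f x)]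
  else [set f | {within Om, continuous f}].

(* Real and imaginary parts of \int_A f(x) e^{-i w.x} dx. *)
Definition fourier_re (A : set 'rV[R]_n) f (w : 'rV[R]_n) : R :=
  (\int[leb R n]_(x in A) (f x * cos (edot w x)))%R.
Definition fourier_im (A : set 'rV[R]_n) f (w : 'rV[R]_n) : R :=
  (- \int[leb R n]_(x in A) (f x * sin (edot w x)))%R.

(* gr + i gi is the Fourier-Plancherel transform of f : the L^2 limit of the
   Fourier integrals of f truncated to the balls of radius N. *)
Definition is_fourier f gr gi : Prop :=
  [/\ gr \in Lfun (leb R n) 2%:E, gi \in Lfun (leb R n) 2%:E,
      'N[leb R n]_2%:E[EFin \o (fourier_re (eball 0 N%:R) f \- gr)%R]%E
        @[N --> \oo] --> 0%E &
      'N[leb R n]_2%:E[EFin \o (fourier_im (eball 0 N%:R) f \- gi)%R]%E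
        @[N --> \oo] --> 0%E].

Definition Hr (r : nat) : set ('rV[R]_n -> R) :=
  [set f | f \in Lfun (leb R n) 2%:E /\
    exists gr gi, is_fourier f gr gi /\
      (\int[leb R n]_w
         ((gr w ^+ 2 + gi w ^+ 2) * (1 + enorm w ^+ 2) ^+ r)%:E < +oo)%E].

End function_spaces.

Section bistochastic.
Context (R : realType) (n : nat).
Variables (Om : set 'rV[R]_n) (h : 'rV[R]_n -> R) (eps : R).
Implicit Types x y z : 'rV[R]_n.

Definition h_eps x : R := eps ^- n * h (eps^-1 *: x).
Definition k_eps x y : R := h_eps (y - x).
Definition d_eps x : R := (\int[leb R n]_(y in Om) k_eps x y)%R.
Definition q_eps x : R := (\int[leb R n]_(y in Om) (k_eps x y / d_eps y))%R.
Definition ptilde x y : R :=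
  (\int[leb R n]_(z in Om)
     (k_eps x z * k_eps z y / (d_eps x * q_eps z * d_eps y)))%R.
Definition Ptilde (f : 'rV[R]_n -> R) x : R :=
  (\int[leb R n]_(y in Om) (ptilde x y * f y))%R.

(* [Rintegral] is total, so the convergence of every integral above is asked
   for separately. *)
Definition kernel_well_defined : Prop :=
  (forall x, Om x ->
    [/\ (leb R n).-integrable Om (fun y => (k_eps x y)%:E),
        (leb R n).-integrable Om (fun y => (k_eps x y / d_eps y)%:E),
        0 < d_eps x & 0 < q_eps x]) /\
  (forall x y, Om x -> Om y ->
    (leb R n).-integrable Om
      (fun z => (k_eps x z * k_eps z y / (d_eps x * q_eps z * d_eps y))%:E)).

Definition Ptilde_well_defined (p : \bar R) : Prop :=
  kernel_well_defined /\
  (forall f, LpOn Om p f -> forall x, Om x ->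
    (leb R n).-integrable Om (fun y => (ptilde x y * f y)%:E)).

End bistochastic.

(* Main.v *)
Require Import Defs.
From mathcomp Require Import all_boot all_order all_algebra.
From mathcomp Require Import all_classical all_reals all_analysis.
From mathcomp Require Import measurable_realfun ess_sup_inf.
From mathcomp Require Import ring lra.

Set Implicit Arguments.
Unset Strict Implicit.
Unset Printing Implicit Defensive.

Import Order.TTheory GRing.Theory Num.Def Num.Theory.
Import numFieldNormedType.Exports.

Local Open Scope classical_set_scope.
Local Open Scope ring_scope.

(** The bistochastic kernel is nonnegative and symmetric, and its integral in
    either variable is 1. Jensen's inequality for the probability densities
    that it consists of therefore survives integration without loss, and the
    operator is a contraction of every [L^p] ([markov_op_contract],
    [markov_op_Lnorm_le]). The one estimate behind this is a lower bound on the
    degree [d_eps], uniform over [Om] and over small [eps]: a radially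
    decreasing density of mass 1 is bounded below on some ball
    ([radial_lower_bound]), and by thickness the dilated ball meets [Om] in a
    fixed proportion of its volume ([k_eps_ge]).

    Convergence. As the operators are contractions, the functions [f] with
    [Ptilde f --> f] form a closed subspace of [L^p]. It contains the bounded
    Lipschitz functions, because the kernel moves a point in two steps of mean
    length tending to 0 ([bikernel_deviation], [recovered_lipschitz]). Limits
    of Lipschitz functions give the indicators of open sets, Dynkin's lemma
    those of all Borel sets, and simple functions the rest ([recovered_Lr]).

    Regularity. On [Om], [Ptilde f] is a quotient whose numerator and
    denominator both have the form [x |-> \int_Om k_eps x z * g z dz] with [g]
    bounded ([Ptilde_quotient]), the denominator [d_eps] being bounded below.
    Such an average is continuous because translation is continuous in [L^1];
    for the radially decreasing [h] this follows from comparing [h] with its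
    own dilates ([translation_continuous]). It is of class [C^r] when [h] is in
    [H^r]: up to scaling it is the convolution of [h] with a bounded integrable
    function [G], hence by Fourier inversion ([convolution_inversion]) an
    integral of waves [cos (w . s)] and [sin (w . s)] with amplitudes
    [h^ (w) * G^ (w)]. The transform of [G] is square integrable
    ([transform_L2]), and that of [h] is so even against the weight
    [(1 + |w| ^ 2) ^ r] ([Hr_weighted_transform]); the amplitudes thus have [r]
    integrable moments, and the integral can be differentiated [r] times
    ([Cr_trig_integral]).

    Bessel's inequality and Fourier inversion come from a single identity,
    [weighted_parseval], where the frequencies are cut off by a product of
    tents: its Fourier transform is explicit, nonnegative and integrable, and
    under dilation becomes an approximate identity. *)

(** * Integration of real-valued functions *)

Section integral_utilities.
Context d (T : measurableType d) (R : realType).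
Variable mu : {measure set T -> \bar R}.
Local Open Scope ereal_scope.

Lemma ge0_integrable_EFin (D : set T) (f : T -> R) : measurable D ->
  measurable_fun D f -> (forall x, D x -> (0 <= f x)%R) ->
  \int[mu]_(x in D) (f x)%:E < +oo -> mu.-integrable D (EFin \o f).
Proof.
move=> mD mf f0 foo; apply/integrableP; split; first exact/measurable_EFinP.
rewrite (eq_integral (fun x => (f x)%:E))// => x /[!inE] Dx.
by rewrite gee0_abs ?lee_fin ?f0.
Qed.

Lemma integrable_bounded_by (D : set T) (f g : T -> R) : measurable D ->
  measurable_fun D f -> (forall x, D x -> (`|f x| <= g x)%R) ->
  mu.-integrable D (EFin \o g) -> mu.-integrable D (EFin \o f).
Proof.
move=> mD mf fg ig; apply: le_integrable ig => //; first exact/measurable_EFinP.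
by move=> x Dx /=; rewrite lee_fin (le_trans (fg _ Dx))// ler_norm.
Qed.

Lemma measurable_integrable (D : set T) (f : T -> R) :
  mu.-integrable D (EFin \o f) -> measurable_fun D f.
Proof. by move=> /measurable_int/measurable_EFinP. Qed.

Lemma RintegralE (D : set T) (f : T -> R) : measurable D ->
  mu.-integrable D (EFin \o f) ->
  (\int[mu]_(x in D) f x)%R%:E = \int[mu]_(x in D) (f x)%:E.
Proof. by move=> mD fi; rewrite /Rintegral fineK//; exact: integrable_fin_num. Qed.

Lemma ge0_le_integral_EFin (D : set T) (f g : T -> R) : measurable D ->
  measurable_fun D f -> measurable_fun D g ->
  (forall x, D x -> (0 <= f x)%R) -> (forall x, D x -> (f x <= g x)%R) ->
  \int[mu]_(x in D) (f x)%:E <= \int[mu]_(x in D) (g x)%:E.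
Proof.
move=> mD mf mg f0 fg; apply: ge0_le_integral => //; exact/measurable_EFinP.
Qed.

Lemma integrableZl_EFin (D : set T) (a : R) (f : T -> R) : measurable D ->
  mu.-integrable D (EFin \o f) ->
  mu.-integrable D (EFin \o (fun x => a * f x)%R).
Proof. by move=> mD fi; exact: (integrableZl mD a fi). Qed.

Lemma integrableD_EFin (D : set T) (f g : T -> R) : measurable D ->
  mu.-integrable D (EFin \o f) -> mu.-integrable D (EFin \o g) ->
  mu.-integrable D (EFin \o (fun x => f x + g x)%R).
Proof. by move=> mD fi gi; exact: (integrableD mD fi gi). Qed.

Lemma integrableB_EFin (D : set T) (f g : T -> R) : measurable D ->
  mu.-integrable D (EFin \o f) -> mu.-integrable D (EFin \o g) ->
  mu.-integrable D (EFin \o (fun x => f x - g x)%R).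
Proof. by move=> mD fi gi; exact: (integrableB mD fi gi). Qed.

End integral_utilities.

Lemma measurable_funV d (T : measurableType d) (R : realType) (f : T -> R) :
  measurable_fun setT f -> measurable_fun setT (fun x => (f x)^-1).
Proof.
move=> mf.
rewrite (_ : (fun _ => _) = (fun x => f x * (f x ^+ 2) `^ (- 1))).
  apply: measurable_funM => //.
  apply: (measurableT_comp (@measurable_powR R (- 1))).
  exact: measurable_funX.
apply/funext => x; rewrite powR_inv1 ?sqr_ge0// expr2.
have [->|fx0] := eqVneq (f x) 0; first by rewrite invr0 mul0r.
by rewrite invfM mulrA mulfV// mul1r.
Qed.

Section fubini_on_subsets.
Context d1 d2 (T1 : measurableType d1) (T2 : measurableType d2) (R : realType).
Variables (m1 : {sigma_finite_measure set T1 -> \bar R}).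
Variables (m2 : {sigma_finite_measure set T2 -> \bar R}).
Variables (D : set T1) (E : set T2).
Hypotheses (mD : measurable D) (mE : measurable E).
Local Open Scope ereal_scope.

Lemma measurable_integral_section (f : T1 * T2 -> \bar R) :
  measurable_fun setT f ->
  measurable_fun setT (fun x => \int[m2]_(y in E) f (x, y)).
Proof.
move=> mf.
pose g := f \_ (setT `*` E).
have mg : measurable_fun setT g.
  apply/(measurable_restrictT _ (measurableX measurableT mE)).
  exact: measurable_funTS.
rewrite (_ : (fun _ => _) =
    (fun x => \int[m2]_y g^\+ (x, y)) \- (fun x => \int[m2]_y g^\- (x, y))).
  by apply: emeasurable_funB; apply: measurable_fun_fubini_tonelli_F => //;
    [exact: measurable_funepos|exact: measurable_funeneg].
apply/funext => x; rewrite integral_mkcond.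
rewrite (_ : _ \_ E = fun y => g (x, y)).
  rewrite -[fun y => _]/(g \o pair x) integralE.
  by rewrite funepos_comp funeneg_comp.
by apply/funext => y; rewrite /g /patch in_setX in_setT.
Qed.

Lemma measurable_Rintegral_section (f : T1 * T2 -> R) :
  measurable_fun setT f ->
  measurable_fun setT (fun x => \int[m2]_(y in E) f (x, y))%R.
Proof.
move=> mf; apply: (measurableT_comp (@fine_measurable R setT measurableT)).
by apply: (@measurable_integral_section (EFin \o f)); exact/measurable_EFinP.
Qed.

Let restr (f : T1 * T2 -> \bar R) := f \_ (D `*` E).

Let mrestr f : measurable_fun setT f -> measurable_fun setT (restr f).
Proof.
move=> mf; apply/(measurable_restrictT _ (measurableX mD mE)).
exact: measurable_funTS.
Qed.

Let restr12 (f : T1 * T2 -> \bar R) :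
  \int[m1]_(x in D) \int[m2]_(y in E) f (x, y) =
  \int[m1]_x \int[m2]_y restr f (x, y).
Proof.
rewrite integral_mkcond; apply: eq_integral => x _.
rewrite {1}/patch; case: ifPn => xD.
  rewrite integral_mkcond; apply: eq_integral => y _.
  by rewrite /restr /patch in_setX xD.
by rewrite integral0_eq// => y _; rewrite /restr /patch in_setX (negbTE xD).
Qed.

Let restr21 (f : T1 * T2 -> \bar R) :
  \int[m2]_(y in E) \int[m1]_(x in D) f (x, y) =
  \int[m2]_y \int[m1]_x restr f (x, y).
Proof.
rewrite integral_mkcond; apply: eq_integral => y _.
rewrite {1}/patch; case: ifPn => yE.
  rewrite integral_mkcond; apply: eq_integral => x _.
  by rewrite /restr /patch in_setX yE andbT.
by rewrite integral0_eq// => x _; rewrite /restr /patch in_setX (negbTE yE) andbF.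
Qed.

Lemma tonelli_on (f : T1 * T2 -> \bar R) : measurable_fun setT f ->
  (forall x y, D x -> E y -> 0 <= f (x, y)) ->
  \int[m1]_(x in D) \int[m2]_(y in E) f (x, y) =
  \int[m2]_(y in E) \int[m1]_(x in D) f (x, y).
Proof.
move=> mf f0; rewrite restr12 restr21; apply: fubini_tonelli.
  exact: mrestr.
move=> [x y]; rewrite /restr /patch in_setX/=.
by case: ifPn => // /andP[/set_mem ? /set_mem ?]; exact: f0.
Qed.

Lemma fubini_on (f : T1 * T2 -> R) : measurable_fun setT f ->
  \int[m1]_(x in D) \int[m2]_(y in E) `|f (x, y)|%:E < +oo ->
  [/\ m1.-integrable D (fun x => \int[m2]_(y in E) (f (x, y))%:E) &
  \int[m1]_(x in D) \int[m2]_(y in E) (f (x, y))%:E =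
  \int[m2]_(y in E) \int[m1]_(x in D) (f (x, y))%:E].
Proof.
move=> mf foo.
have mf' : measurable_fun setT (EFin \o f) by exact/measurable_EFinP.
have rE : (fun z => `|restr (EFin \o f) z|) = restr (fun z => `|f z|%:E).
  by apply/funext => z; rewrite /restr /patch; case: ifPn => //; rewrite abse0.
have ir : (m1 \x m2).-integrable setT (restr (EFin \o f)).
  apply/integrable12ltyP; first exact: mrestr.
  move: foo; rewrite (restr12 (fun z => `|f z|%:E)); congr (_ < _).
  by apply: eq_integral => x _; apply: eq_integral => y _; rewrite -rE.
split; last first.
  by rewrite (restr12 (EFin \o f)) (restr21 (EFin \o f)); exact: Fubini.
apply/(integrable_mkcond _ mD).
have := integrable_fubini_F ir; congr (integrable _ _ _).
apply/funext => x; rewrite /fubini_F [RHS]/patch; case: ifPn => xD.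
  rewrite [RHS]integral_mkcond; apply: eq_integral => y _.
  by rewrite /restr /patch in_setX xD.
by rewrite integral0_eq// => y _; rewrite /restr /patch in_setX (negbTE xD).
Qed.

End fubini_on_subsets.

(** * Lebesgue spaces on subsets *)

Lemma ge0_le_poweR (R : realType) (r : R) (x y : \bar R) : 0 <= r ->
  (0 <= x)%E -> (x <= y)%E -> (x `^ r <= y `^ r)%E.
Proof.
move=> r0 x0 xy; apply: (gt0_ler_poweR r0) => //; rewrite in_itv/= leey andbT//.
exact: le_trans x0 xy.
Qed.

Lemma ge0_le_powR (R : realType) (r a b : R) : 0 <= r -> 0 <= a -> a <= b ->
  a `^ r <= b `^ r.
Proof.
move=> r0 a0 ab; apply: ge0_ler_powR => //; rewrite nnegrE//.
exact: le_trans ab.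
Qed.

Section Lp_on_subsets.
Context d (T : measurableType d) (R : realType).
Variables (mu : {measure set T -> \bar R}) (D : set T).
Hypothesis mD : measurable D.
Local Open Scope ereal_scope.

Lemma measurable_powR_norm (E : set T) (f : T -> R) r :
  measurable_fun E f -> measurable_fun E (fun x => `|f x| `^ r)%R.
Proof.
move=> mf; apply: (measurableT_comp (@measurable_powR R r)).
exact: measurableT_comp.
Qed.

Lemma Lnorm_restrict (f : T -> R) r : (0 < r)%R ->
  'N[mu]_r%:E[EFin \o (f \_ D)] = (\int[mu]_(x in D) (`|f x| `^ r)%:E) `^ r^-1.
Proof.
move=> r0; rewrite unlock; congr (_ `^ _).
rewrite [RHS]integral_mkcond; apply: eq_integral => x _ /=.
by rewrite /patch; case: ifPn => // _; rewrite normr0 powR0// gt_eqF.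
Qed.

Lemma measurable_Lfun (g : T -> R) p : g \in Lfun mu p -> measurable_fun setT g.
Proof. by case/andP; rewrite inE. Qed.

Lemma Lfun_restrict_measurable (f : T -> R) p : f \_ D \in Lfun mu p ->
  measurable_fun D f.
Proof. by move=> /measurable_Lfun; move/(measurable_restrictT _ mD). Qed.

Lemma Lfun_restrictP (f : T -> R) p : f \_ D \in Lfun mu p <->
  measurable_fun D f /\ 'N[mu]_p[EFin \o (f \_ D)] < +oo.
Proof.
split=> [fp|[mf foo]].
  split; first exact: Lfun_restrict_measurable fp.
  by move: fp => /andP[_]; rewrite inE.
by apply/andP; rewrite !inE; split => //; exact/(measurable_restrictT _ mD).
Qed.

Lemma Lnorm_restrict_lty (f : T -> R) r : (0 < r)%R ->
  ('N[mu]_r%:E[EFin \o (f \_ D)] < +oo) <->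
  (\int[mu]_(x in D) (`|f x| `^ r)%:E < +oo).
Proof.
move=> r0; rewrite Lnorm_restrict//; split; last exact: poweR_lty.
by apply: lty_poweRy; rewrite gt_eqF// invr_gt0.
Qed.

(** On a null space the sup norm is 0 whatever [f] is, and the bound, vacuous
    there, cannot come from the essential supremum. *)
Lemma Lnorm_restrict_oo_ae (f : T -> R) : f \_ D \in Lfun mu +oo ->
  exists2 M : R, M%:E = 'N[mu]_+oo[EFin \o (f \_ D)] &
    {ae mu, forall x, D x -> (`|f x| <= M)%R}.
Proof.
move=> /Lfun_restrictP[_ foo].
have fin : 'N[mu]_+oo[EFin \o (f \_ D)] \is a fin_num.
  by rewrite ge0_fin_numE// Lnorm_ge0.
exists (fine 'N[mu]_+oo[EFin \o (f \_ D)]); first by rewrite fineK.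
have [mu0|mu0] := ltP 0 (mu setT).
  have : {ae mu, forall x, `|(f \_ D) x|%:E <= 'N[mu]_+oo[EFin \o (f \_ D)]}.
    have -> : 'N[mu]_+oo[EFin \o (f \_ D)] =
        ess_sup mu (abse \o (EFin \o (f \_ D))) by rewrite unlock mu0.
    exact/ess_supP.
  apply: filterS => x; rewrite -{1}(fineK fin) lee_fin /patch => + Dx.
  by rewrite mem_set.
have mu00 : mu setT = 0 by apply/eqP; rewrite -measure_le0.
by exists setT; split.
Qed.

Lemma Lnorm_restrict_oo_le (f : T -> R) (M : R) : (0 <= M)%R ->
  {ae mu, forall x, D x -> (`|f x| <= M)%R} ->
  'N[mu]_+oo[EFin \o (f \_ D)] <= M%:E.
Proof.
move=> M0 fM; rewrite unlock; case: ifPn => _; last by rewrite lee_fin.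
apply/ess_supP; apply: filterS fM => x /= fM; rewrite lee_fin /patch.
by case: ifPn => [/set_mem/fM //|_]; rewrite normr0.
Qed.

End Lp_on_subsets.

Section jensen_powR.
Context (R : realType).

(** The tangent-line inequality for [s |-> s ^ r], from Young's inequality. *)
Lemma powR_tangent (r a s : R) : 1 <= r -> 0 <= a -> 0 <= s ->
  r * a `^ (r - 1) * s <= (r - 1) * a `^ r + s `^ r.
Proof.
rewrite le_eqVlt => /predU1P[<-|r1] a0 s0.
  by rewrite subrr powRr0 powRr1// !mul1r mul0r add0r powRr1.
have r0 : 0 < r by rewrite (lt_trans _ r1).
have rB0 : 0 < r - 1 by rewrite subr_gt0.
have := @conjugate_powR R s (a `^ (r - 1)) r (r / (r - 1)) s0 (powR_ge0 _ _) r0.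
rewrite divr_gt0// => /(_ isT) young.
have {}young : s * a `^ (r - 1) <= s `^ r / r + a `^ r / (r / (r - 1)).
  apply: le_trans (young _) _.
    by rewrite invf_div -{1}(div1r r) -mulrDl addrC subrK divff// gt_eqF.
  by rewrite -powRrM mulrCA divff ?mulr1// gt_eqF.
have := ler_wpM2l (ltW r0) young.
rewrite mulrA (mulrAC r s) => /le_trans; apply.
rewrite mulrDr addrC lerD//.
  rewrite invf_div mulrA [r * _]mulrC -mulrA (mulrCA r) divff ?gt_eqF//.
  by rewrite mulr1 mulrC.
by rewrite mulrCA divff ?gt_eqF// mulr1.
Qed.

End jensen_powR.

(** * Operators with a bounded symmetric Markov kernel *)

Section markov_operator.
Context d (T : measurableType d) (R : realType).
Variables (mu : {sigma_finite_measure set T -> \bar R}) (D : set T).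
Hypothesis mD : measurable D.
Variables (kap : T -> T -> R) (B : R).
Hypothesis mkap : measurable_fun setT (fun xy : T * T => kap xy.1 xy.2).
Hypothesis kap_ge0 : forall x y, 0 <= kap x y.
Hypothesis kap_le : forall x y, D x -> D y -> kap x y <= B.
Hypothesis kapC : forall x y, D x -> D y -> kap x y = kap y x.
Hypothesis kap1 : forall x, D x -> (\int[mu]_(y in D) (kap x y)%:E = 1)%E.

Definition markov_op (f : T -> R) x := (\int[mu]_(y in D) (kap x y * f y))%R.

Lemma measurable_kap x : measurable_fun setT (kap x).
Proof. exact: (measurableT_comp mkap (pair1_measurable x)). Qed.

Lemma integrable_kap x : D x -> mu.-integrable D (EFin \o kap x).
Proof.
move=> Dx; apply: ge0_integrable_EFin => //.
  exact/measurable_funTS/measurable_kap.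
by rewrite kap1// ltry.
Qed.

Lemma measurable_kapM x f : measurable_fun D f ->
  measurable_fun D (fun y => kap x y * f y).
Proof.
by move=> mf; apply: measurable_funM => //; exact/measurable_funTS/measurable_kap.
Qed.

Lemma markov_op_restrict f x : markov_op f x = markov_op (f \_ D) x.
Proof.
apply: eq_Rintegral => y yD; by rewrite /patch yD.
Qed.

Lemma measurable_markov_op f : measurable_fun D f ->
  measurable_fun setT (markov_op f).
Proof.
move=> mf; rewrite (_ : markov_op f = markov_op (f \_ D)); last first.
  by apply/funext => x; rewrite -markov_op_restrict.
apply: (measurable_Rintegral_section mu mD
  (f := fun xy : T * T => kap xy.1 xy.2 * (f \_ D) xy.2)).
apply: measurable_funM => //.
by apply: measurableT_comp => //; exact/(measurable_restrictT _ mD).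
Qed.

Section integrability.
Local Open Scope ereal_scope.

(** [f] is dominated by [1 + |f| ^ r], and [kap] is bounded. *)
Lemma integrable_markov_fin (f : T -> R) (r : R) x : (1 <= r)%R ->
  measurable_fun D f -> \int[mu]_(y in D) (`|f y| `^ r)%:E < +oo -> D x ->
  mu.-integrable D (EFin \o (fun y => kap x y * f y)%R).
Proof.
move=> r1 mf foo Dx.
apply: (@integrable_bounded_by _ _ _ _ _ _
   (fun y => kap x y + B * `|f y| `^ r)%R) => //.
- exact: measurable_kapM.
- move=> y Dy; rewrite normrM ger0_norm//.
  have [f1|f1] := leP `|f y|%R 1%R.
    rewrite (@le_trans _ _ (kap x y))//; first exact: ler_piMr.
    rewrite lerDl mulr_ge0 ?powR_ge0//; exact: le_trans (kap_le Dx Dy).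
  rewrite (@le_trans _ _ (kap x y * `|f y| `^ r)%R)//.
    by rewrite ler_wpM2l// le1r_powR// ltW.
  rewrite (@le_trans _ _ (B * `|f y| `^ r)%R)//.
    by rewrite ler_wpM2r ?powR_ge0// kap_le.
  by rewrite lerDr.
- apply: integrableD_EFin => //; first exact: integrable_kap.
  apply: integrableZl_EFin => //; apply: ge0_integrable_EFin => //.
  exact: measurable_powR_norm.
Qed.

Lemma integrable_markov_oo (f : T -> R) (M : R) x :
  (0 <= M)%R -> measurable_fun D f ->
  {ae mu, forall y, D y -> (`|f y| <= M)%R} -> D x ->
  mu.-integrable D (EFin \o (fun y => kap x y * f y)%R) /\
  \int[mu]_(y in D) (kap x y * `|f y|)%:E <= M%:E.
Proof.
move=> M0 mf fM Dx.
suff le : \int[mu]_(y in D) (kap x y * `|f y|)%:E <= M%:E.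
  split => //; apply/integrableP; split.
    exact/measurable_EFinP/measurable_kapM.
  apply: le_lt_trans (ltry M).
  apply: le_trans le; rewrite le_eqVlt; apply/orP; left; apply/eqP.
  by apply: eq_integral => y _ /=; rewrite normrM ger0_norm.
have -> : M%:E = \int[mu]_(y in D) (M%:E * (kap x y)%:E).
  by rewrite integralZl ?kap1 ?mule1//; exact: integrable_kap.
apply: ae_ge0_le_integral => //.
- by move=> y _; rewrite lee_fin mulr_ge0.
- by apply/measurable_EFinP/measurable_kapM; exact: measurableT_comp.
- by move=> y Dy; rewrite -EFinM lee_fin mulr_ge0.
- apply: measurable_funeM.
  exact/measurable_EFinP/measurable_funTS/measurable_kap.
- apply: filterS fM => y fM Dy; rewrite -EFinM lee_fin mulrC ler_wpM2r//.
  exact: fM.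
Qed.

(** Jensen's inequality for the probability density [kap x]. *)
Lemma markov_op_powR_le (f : T -> R) (r : R) x : (1 <= r)%R ->
  measurable_fun D f -> D x ->
  mu.-integrable D (EFin \o (fun y => kap x y * f y)%R) ->
  (`|markov_op f x| `^ r)%:E <= \int[mu]_(y in D) (kap x y * `|f y| `^ r)%:E.
Proof.
move=> r1 mf Dx fi.
have r0 : (0 < r)%R by rewrite (lt_le_trans _ r1).
have mfr : measurable_fun D (fun y => `|f y| `^ r)%R by exact: measurable_powR_norm.
have afi : mu.-integrable D (EFin \o (fun y => kap x y * `|f y|)%R).
  apply: eq_integrable (integrable_norm fi) => // y _ /=.
  by rewrite normrM ger0_norm.
set a := (\int[mu]_(y in D) (kap x y * `|f y|))%R.
have a0 : (0 <= a)%R by apply: Rintegral_ge0 => y _; rewrite mulr_ge0.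
have fa : (`|markov_op f x| <= a)%R.
  rewrite (le_trans (le_normr_Rintegral mD fi))// le_eqVlt; apply/orP; left.
  by apply/eqP; apply: eq_Rintegral => y _; rewrite normrM ger0_norm.
apply: (@le_trans _ _ (a `^ r)%:E).
  by rewrite lee_fin ge0_ler_powR// ?nnegrE// ltW.
set I := (X in _ <= X).
have I0 : 0 <= I.
  by apply: integral_ge0 => y _; rewrite lee_fin mulr_ge0// powR_ge0.
have [Ioo|Ioo] := ltP I +oo; last by rewrite (le_trans _ Ioo)// leey.
have Ifi : mu.-integrable D (EFin \o (fun y => kap x y * `|f y| `^ r)%R).
  apply: ge0_integrable_EFin => //; first exact: measurable_kapM.
  by move=> y _; rewrite mulr_ge0 ?powR_ge0.
have -> : I = (\int[mu]_(y in D) (kap x y * `|f y| `^ r))%R%:E by rewrite RintegralE.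
have tangent : (\int[mu]_(y in D) (r * a `^ (r - 1) * (kap x y * `|f y|)) <=
    \int[mu]_(y in D) ((r - 1) * a `^ r * kap x y + kap x y * `|f y| `^ r))%R.
  apply: le_Rintegral => //.
  - exact: integrableZl_EFin.
  - apply: integrableD_EFin => //; apply: integrableZl_EFin => //.
    exact: integrable_kap.
  - move=> y Dy.
    have := ler_wpM2l (kap_ge0 x y) (powR_tangent r1 a0 (normr_ge0 (f y))).
    by rewrite mulrDr mulrCA (mulrC (kap x y) (_ * a `^ r)%R).
move: tangent; rewrite RintegralZl// RintegralD//; last first.
  by apply: integrableZl_EFin => //; exact: integrable_kap.
rewrite RintegralZl//; last exact: integrable_kap.
have -> : (\int[mu]_(y in D) kap x y = 1)%R by rewrite /Rintegral kap1.
rewrite -/a mulr1 -mulrA (mulrC _ a) mulr_powRB1//.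
by rewrite lee_fin mulrBl mul1r; lra.
Qed.

(** Both marginals of [kap] have density one, so Jensen's inequality survives
    integration in [x] without loss. *)
Lemma markov_op_contract (f : T -> R) (r : R) : (1 <= r)%R ->
  measurable_fun D f -> \int[mu]_(y in D) (`|f y| `^ r)%:E < +oo ->
  \int[mu]_(x in D) (`|markov_op f x| `^ r)%:E <=
  \int[mu]_(y in D) (`|f y| `^ r)%:E.
Proof.
move=> r1 mf foo.
apply: (@le_trans _ _
    (\int[mu]_(x in D) \int[mu]_(y in D) (kap x y * `|f y| `^ r)%:E)).
  apply: ge0_le_integral => //.
  - by apply/measurable_EFinP/measurable_powR_norm/measurable_funTS/measurable_markov_op.
  - apply: measurable_funTS.
    rewrite (_ : (fun _ => _) =
      (fun x => \int[mu]_(y in D) (kap x y * `|(f \_ D) y| `^ r)%:E)); last first.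
      by apply/funext => x; apply: eq_integral => y yD; rewrite /patch yD.
    apply: (measurable_integral_section mu mD
      (f := fun xy : T * T => (kap xy.1 xy.2 * `|(f \_ D) xy.2| `^ r)%:E)).
    apply/measurable_EFinP/measurable_funM => //.
    apply: (measurable_powR_norm r (f := fun xy : T * T => (f \_ D) xy.2)).
    by apply: measurableT_comp => //; exact/(measurable_restrictT _ mD).
  - move=> x Dx; apply: markov_op_powR_le => //.
    exact: integrable_markov_fin foo Dx.
rewrite (eq_integral (fun x => \int[mu]_(y in D)
   (kap x y * `|(f \_ D) y| `^ r)%:E)); last first.
  by move=> x _; apply: eq_integral => y yD; rewrite /patch yD.
rewrite (@tonelli_on _ _ _ _ _ _ _ _ _ mD mD
   (fun xy : T * T => (kap xy.1 xy.2 * `|(f \_ D) xy.2| `^ r)%:E))/=; last 2 first.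
- apply/measurable_EFinP/measurable_funM => //.
  apply: (measurable_powR_norm r (f := fun xy : T * T => (f \_ D) xy.2)).
  by apply: measurableT_comp => //; exact/(measurable_restrictT _ mD).
- by move=> x y _ _; rewrite lee_fin mulr_ge0 ?powR_ge0.
rewrite le_eqVlt; apply/orP; left; apply/eqP.
apply: eq_integral => y yD; rewrite {1}/patch yD.
move/set_mem: yD => Dy.
under eq_integral do rewrite EFinM muleC.
rewrite integralZl//; last first.
  apply: eq_integrable (integrable_kap Dy) => // x /set_mem Dx /=.
  by rewrite kapC.
rewrite (eq_integral (fun x => (kap y x)%:E)) ?kap1 ?mule1//.
by move=> x /set_mem Dx; rewrite kapC.
Qed.

Lemma markov_op_integrable (p : \bar R) (f : T -> R) x : 1 <= p ->
  f \_ D \in Lfun mu p -> D x ->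
  mu.-integrable D (EFin \o (fun y => kap x y * f y)%R).
Proof.
case: p => [r| |]; last by rewrite leeNy_eq.
- rewrite lee_fin => r1 fL Dx; have r0 : (0 < r)%R by rewrite (lt_le_trans _ r1).
  have [mf] := (Lfun_restrictP mu mD _ _).1 fL.
  by move/(Lnorm_restrict_lty mu D f r0) => foo; exact: integrable_markov_fin foo Dx.
- move=> _ fL Dx; have [M ME fM] := Lnorm_restrict_oo_ae mD fL.
  have M0 : (0 <= M)%R by rewrite -lee_fin ME Lnorm_ge0.
  by apply: (integrable_markov_oo M0 _ fM Dx).1; exact: Lfun_restrict_measurable fL.
Qed.

Lemma markov_op_Lnorm_le (p : \bar R) (f : T -> R) : 1 <= p ->
  f \_ D \in Lfun mu p ->
  'N[mu]_p[EFin \o (markov_op f \_ D)] <= 'N[mu]_p[EFin \o (f \_ D)].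
Proof.
case: p => [r| |]; last by rewrite leeNy_eq.
- rewrite lee_fin => r1 fL; have r0 : (0 < r)%R by rewrite (lt_le_trans _ r1).
  have [mf] := (Lfun_restrictP mu mD _ _).1 fL.
  move/(Lnorm_restrict_lty mu D f r0) => foo.
  rewrite !Lnorm_restrict//; apply: ge0_le_poweR => //.
  + by rewrite invr_ge0 ltW.
  + exact: integral_ge0.
  + exact: markov_op_contract.
- move=> _ fL; have [M ME fM] := Lnorm_restrict_oo_ae mD fL.
  have M0 : (0 <= M)%R by rewrite -lee_fin ME Lnorm_ge0.
  have mf := Lfun_restrict_measurable mD fL.
  rewrite -ME; apply: Lnorm_restrict_oo_le => //; apply: aeW => x Dx.
  have [fi fle] := integrable_markov_oo M0 mf fM Dx.
  rewrite -lee_fin; apply: le_trans fle.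
  rewrite (le_trans _ (_ : (\int[mu]_(y in D) `|kap x y * f y|)%R%:E <= _))//.
    by rewrite lee_fin le_normr_Rintegral.
  rewrite RintegralE//; last exact: integrable_norm.
  rewrite le_eqVlt; apply/orP; left; apply/eqP.
  by apply: eq_integral => y _ /=; rewrite normrM ger0_norm.
Qed.

Lemma markov_op_Lfun (p : \bar R) (f : T -> R) : 1 <= p ->
  f \_ D \in Lfun mu p -> markov_op f \_ D \in Lfun mu p.
Proof.
move=> p1 fL; apply/(Lfun_restrictP mu mD); split.
  exact/measurable_funTS/measurable_markov_op/(Lfun_restrict_measurable mD fL).
apply: le_lt_trans (markov_op_Lnorm_le p1 fL) _.
by have [] := (Lfun_restrictP mu mD _ _).1 fL.
Qed.

Lemma markov_op_linear (p : \bar R) (a : R) (f g : T -> R) x : 1 <= p ->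
  f \_ D \in Lfun mu p -> g \_ D \in Lfun mu p -> D x ->
  markov_op (fun y => a * f y + g y)%R x = (a * markov_op f x + markov_op g x)%R.
Proof.
move=> p1 fL gL Dx.
have fi := markov_op_integrable p1 fL Dx.
have gi := markov_op_integrable p1 gL Dx.
rewrite /markov_op -RintegralZl// -RintegralD//.
  by apply: eq_Rintegral => y _; rewrite mulrDr mulrCA.
exact: integrableZl_EFin.
Qed.

Lemma markov_op_ae_eq (f g : T -> R) x :
  measurable_fun D f -> measurable_fun D g ->
  ae_eq mu D f g -> markov_op f x = markov_op g x.
Proof.
move=> mf mg fg; congr fine; apply: ae_eq_integral => //.
- exact/measurable_EFinP/measurable_kapM.
- exact/measurable_EFinP/measurable_kapM.
- by apply: filterS fg => y fg Dy; rewrite fg.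
Qed.

End integrability.
End markov_operator.

(** * Bistochastic normalization of a kernel *)

Section bistochastic_kernel.
Context d (T : measurableType d) (R : realType).
Variables (mu : {sigma_finite_measure set T -> \bar R}) (D : set T).
Hypothesis mD : measurable D.
Variables (k : T -> T -> R) (B c : R).
Hypothesis mk : measurable_fun setT (fun xy : T * T => k xy.1 xy.2).
Hypothesis k_ge0 : forall x y, 0 <= k x y.
Hypothesis k_le : forall x y, k x y <= B.
Hypothesis kC : forall x y, k x y = k y x.
Hypothesis c_gt0 : 0 < c.
Hypothesis k_le1 : forall x, (\int[mu]_(y in D) (k x y)%:E <= 1)%E.
Hypothesis k_gec : forall x, D x -> (c%:E <= \int[mu]_(y in D) (k x y)%:E)%E.

Definition deg x := (\int[mu]_(y in D) k x y)%R.
Definition bideg x := (\int[mu]_(y in D) (k x y / deg y))%R.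
Definition weight x y z := k x z * k z y / (deg x * bideg z * deg y).
Definition bikernel x y := (\int[mu]_(z in D) weight x y z)%R.

Lemma measurable_k x : measurable_fun setT (k x).
Proof. exact: (measurableT_comp mk (pair1_measurable x)). Qed.

Lemma integrable_k x : mu.-integrable D (EFin \o k x).
Proof.
apply: ge0_integrable_EFin => //; first exact/measurable_funTS/measurable_k.
exact: le_lt_trans (k_le1 x) (ltry 1).
Qed.

Lemma degE x : (deg x)%:E = (\int[mu]_(y in D) (k x y)%:E)%E.
Proof. by rewrite RintegralE//; exact: integrable_k. Qed.

Lemma deg_ge0 x : 0 <= deg x. Proof. exact: Rintegral_ge0. Qed.

Lemma deg_le1 x : deg x <= 1. Proof. by rewrite -lee_fin degE. Qed.

Lemma deg_ge x : D x -> c <= deg x.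
Proof. by move=> Dx; rewrite -lee_fin degE k_gec. Qed.

Lemma deg_gt0 x : D x -> 0 < deg x.
Proof. by move=> Dx; exact: lt_le_trans (deg_ge Dx). Qed.

Lemma measurable_deg : measurable_fun setT deg.
Proof. exact: (measurable_Rintegral_section mu mD mk). Qed.

Lemma measurable_k_deg :
  measurable_fun setT (fun xy : T * T => k xy.1 xy.2 / deg xy.2).
Proof.
apply: measurable_funM => //; apply: measurable_funV.
exact: (measurableT_comp measurable_deg measurable_snd).
Qed.

Lemma k_deg_ge0 x y : 0 <= k x y / deg y.
Proof. by rewrite divr_ge0// deg_ge0. Qed.

Lemma k_deg_le x y : D y -> k x y / deg y <= c^-1 * k x y.
Proof.
move=> Dy; rewrite mulrC ler_wpM2r// lef_pV2 ?posrE ?deg_gt0//.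
exact: deg_ge.
Qed.

Lemma integrable_k_deg x : mu.-integrable D (EFin \o (fun y => k x y / deg y)).
Proof.
apply: (@integrable_bounded_by _ _ _ _ _ _ (fun y => c^-1 * k x y)) => //.
- apply: measurable_funTS.
  exact: (measurableT_comp measurable_k_deg (pair1_measurable x)).
- by move=> y Dy; rewrite ger0_norm ?k_deg_ge0// k_deg_le.
- by apply: integrableZl_EFin => //; exact: integrable_k.
Qed.

Lemma bidegE x : (bideg x)%:E = (\int[mu]_(y in D) (k x y / deg y)%:E)%E.
Proof. by rewrite RintegralE//; exact: integrable_k_deg. Qed.

Lemma bideg_ge0 x : 0 <= bideg x.
Proof. by apply: Rintegral_ge0 => y _; exact: k_deg_ge0. Qed.

Lemma bideg_ge x : D x -> c <= bideg x.
Proof.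
move=> Dx; apply: le_trans (deg_ge Dx) _; apply: le_Rintegral => //.
- exact: integrable_k.
- exact: integrable_k_deg.
- by move=> y Dy; rewrite ler_peMr// invf_ge1 ?deg_gt0 ?deg_le1.
Qed.

Lemma bideg_gt0 x : D x -> 0 < bideg x.
Proof. by move=> Dx; exact: lt_le_trans (bideg_ge Dx). Qed.

Lemma measurable_bideg : measurable_fun setT bideg.
Proof. exact: (measurable_Rintegral_section mu mD measurable_k_deg). Qed.

Lemma measurable_weight :
  measurable_fun setT (fun u : (T * T) * T => weight u.1.1 u.1.2 u.2).
Proof.
have m1 : measurable_fun setT (fun u : (T * T) * T => u.1.1).
  exact: measurableT_comp measurable_fst measurable_fst.
have m2 : measurable_fun setT (fun u : (T * T) * T => u.1.2).
  exact: measurableT_comp measurable_snd measurable_fst.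
apply: measurable_funM; first apply: measurable_funM.
- exact: (measurableT_comp mk (measurable_fun_pair m1 measurable_snd)).
- exact: (measurableT_comp mk (measurable_fun_pair measurable_snd m2)).
- apply: measurable_funV; apply: measurable_funM; first apply: measurable_funM.
  + exact: (measurableT_comp measurable_deg m1).
  + exact: (measurableT_comp measurable_bideg measurable_snd).
  + exact: (measurableT_comp measurable_deg m2).
Qed.

Lemma measurable_weight_section x :
  measurable_fun setT (fun yz : T * T => weight x yz.1 yz.2).
Proof.
have mp : measurable_fun setT (fun yz : T * T => ((x, yz.1), yz.2)).
  by apply: measurable_fun_pair => //; exact: measurable_fun_pair.
exact: (measurableT_comp measurable_weight mp).
Qed.

Lemma measurable_bikernel :
  measurable_fun setT (fun xy : T * T => bikernel xy.1 xy.2).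
Proof. exact: (measurable_Rintegral_section mu mD measurable_weight). Qed.

Lemma weight_ge0 x y z : 0 <= weight x y z.
Proof. by rewrite divr_ge0 ?mulr_ge0// ?deg_ge0 ?bideg_ge0. Qed.

Lemma bikernel_ge0 x y : 0 <= bikernel x y.
Proof. by apply: Rintegral_ge0 => z _; exact: weight_ge0. Qed.

Lemma weightE x y z :
  weight x y z = k x z / (deg x * bideg z) * (k z y / deg y).
Proof. by rewrite /weight invfM; ring. Qed.

Lemma weight_le x y z : D x -> D y -> D z ->
  weight x y z <= B / c ^+ 3 * k x z.
Proof.
move=> Dx Dy Dz; rewrite /weight [B / _ * _]mulrAC [B * _]mulrC.
apply: ler_pM => //; rewrite ?mulr_ge0 ?invr_ge0 ?mulr_ge0 ?deg_ge0 ?bideg_ge0//.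
  by rewrite ler_wpM2l.
rewrite lef_pV2 ?posrE ?exprn_gt0 ?mulr_gt0 ?deg_gt0 ?bideg_gt0//.
have c0 := ltW c_gt0.
rewrite !exprS expr0 mulr1 mulrA; apply: ler_pM; rewrite ?mulr_ge0 ?deg_ge//.
by apply: ler_pM => //; [exact: deg_ge|exact: bideg_ge].
Qed.

Lemma integrable_weight x y : D x -> D y ->
  mu.-integrable D (EFin \o weight x y).
Proof.
move=> Dx Dy.
apply: (@integrable_bounded_by _ _ _ _ _ _ (fun z => B / c ^+ 3 * k x z)) => //.
- apply: measurable_funTS.
  exact: (measurableT_comp measurable_weight (pair1_measurable (x, y))).
- by move=> z Dz; rewrite ger0_norm ?weight_ge0// weight_le.
- by apply: integrableZl_EFin => //; exact: integrable_k.
Qed.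

Lemma bikernelE x y : D x -> D y ->
  (bikernel x y)%:E = (\int[mu]_(z in D) (weight x y z)%:E)%E.
Proof. by move=> Dx Dy; rewrite RintegralE//; exact: integrable_weight. Qed.

Lemma bikernel_le x y : D x -> D y -> bikernel x y <= B / c ^+ 3.
Proof.
move=> Dx Dy; apply: (@le_trans _ _ (\int[mu]_(z in D) (B / c ^+ 3 * k x z))).
  apply: le_Rintegral => //.
  - exact: integrable_weight.
  - by apply: integrableZl_EFin => //; exact: integrable_k.
  - by move=> z Dz; exact: weight_le.
rewrite RintegralZl//; last exact: integrable_k.
have c0 := ltW c_gt0; apply: ler_piMr (deg_le1 x).
by rewrite divr_ge0 ?exprn_ge0// (le_trans (k_ge0 x x)).
Qed.

Lemma bikernelC x y : bikernel x y = bikernel y x.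
Proof.
apply: eq_Rintegral => z _; rewrite /weight (kC x z) (kC z y) [k z x * _]mulrC.
by congr (_ / _); rewrite mulrC mulrA [RHS]mulrAC [deg y * _]mulrC.
Qed.

Section tonelli.
Local Open Scope ereal_scope.

(** The order of integration over the intermediate point [z] and the end
    point [y] may be exchanged: this is the factorization of the bistochastic
    operator through its two normalized halves, on nonnegative integrands. *)
Lemma weight_tonelli x (F : T * T -> R) : measurable_fun setT F ->
  (forall z y, (0 <= F (z, y))%R) ->
  \int[mu]_(y in D) \int[mu]_(z in D) (weight x y z * F (z, y))%:E =
  \int[mu]_(z in D) ((k x z / (deg x * bideg z))%:E *
    \int[mu]_(y in D) (k z y / deg y * F (z, y))%:E).
Proof.
move=> mF F0.
rewrite (@tonelli_on _ _ _ _ _ _ _ _ _ mD mD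
   (fun yz : T * T => (weight x yz.1 yz.2 * F (yz.2, yz.1))%:E))/=; last 2 first.
- apply/measurable_EFinP/measurable_funM.
    exact: measurable_weight_section.
  by apply: (measurableT_comp mF); exact: measurable_fun_pair.
- by move=> y z _ _; rewrite lee_fin mulr_ge0 ?weight_ge0.
apply: eq_integral => z _; rewrite -ge0_integralZl//.
- by apply: eq_integral => y _; rewrite -EFinM weightE !mulrA.
- apply/measurable_EFinP/measurable_funTS/measurable_funM.
    exact: (measurableT_comp measurable_k_deg (pair1_measurable z)).
  exact: (measurableT_comp mF (pair1_measurable z)).
- by move=> y _; rewrite lee_fin mulr_ge0 ?k_deg_ge0.
- by rewrite lee_fin divr_ge0// mulr_ge0 ?deg_ge0 ?bideg_ge0.
Qed.

Lemma integral_k_div_deg x : D x ->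
  \int[mu]_(z in D) (k x z / deg x)%:E = 1.
Proof.
move=> Dx; under eq_integral do rewrite mulrC EFinM.
rewrite integralZl//; last exact: integrable_k.
by rewrite -degE -EFinM mulVf// gt_eqF// deg_gt0.
Qed.

Lemma integral_bikernel x : D x -> \int[mu]_(y in D) (bikernel x y)%:E = 1.
Proof.
move=> Dx; have := weight_tonelli x (@measurable_cst _ _ _ _ setT (1 : R)%R) _.
move=> /(_ (fun _ _ => ler01)) eqF.
transitivity (\int[mu]_(y in D) \int[mu]_(z in D) (weight x y z * 1)%:E).
  apply: eq_integral => y /set_mem Dy; rewrite bikernelE//.
  by apply: eq_integral => z _; rewrite mulr1.
rewrite eqF -(integral_k_div_deg Dx); apply: eq_integral => z /set_mem Dz.
under eq_integral do rewrite mulr1.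
by rewrite -bidegE -EFinM invfM mulrA mulfVK// gt_eqF// bideg_gt0.
Qed.

End tonelli.

Section deviation.
Local Open Scope ereal_scope.
Variables (f : T -> R) (psi : T -> T -> R) (E : R).
Hypothesis mf : measurable_fun D f.
Hypothesis mpsi : measurable_fun setT (fun xy : T * T => psi xy.1 xy.2).
Hypothesis psi_ge0 : forall x y, (0 <= psi x y)%R.
Hypothesis f_psi : forall x y z, D x -> D y -> D z ->
  (`|f y - f x| <= psi x z + psi z y)%R.
Hypothesis E_ge : forall x, D x -> \int[mu]_(y in D) (k x y * psi x y)%:E <= E%:E.

Let integral_k_psi z : D z ->
  \int[mu]_(y in D) (k z y / deg y * psi z y)%:E <= (E / c)%:E.
Proof.
move=> Dz; have mpz := measurableT_comp mpsi (pair1_measurable z).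
rewrite mulrC EFinM; apply: le_trans (lee_wpmul2l _ (E_ge Dz)); last first.
  by rewrite lee_fin invr_ge0 ltW.
rewrite -ge0_integralZl_EFin//; last 3 first.
- by move=> y _; rewrite lee_fin mulr_ge0.
- apply/measurable_EFinP/measurable_funTS/measurable_funM => //.
  exact: measurable_k.
- by rewrite invr_ge0 ltW.
apply: ge0_le_integral => //.
- by move=> y _; rewrite lee_fin mulr_ge0 ?k_deg_ge0.
- apply/measurable_EFinP/measurable_funTS/measurable_funM => //.
  exact: (measurableT_comp measurable_k_deg (pair1_measurable z)).
- apply/measurable_funeM/measurable_EFinP/measurable_funTS/measurable_funM => //.
  exact: measurable_k.
- by move=> y Dy; rewrite -EFinM lee_fin mulrA ler_wpM2r// k_deg_le.
Qed.

(** Passing through the intermediate point [z] splits the displacement from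
    [x] to [y] into two steps of the kernel [k], each of mean cost at most [E]
    before normalization. *)
Lemma bikernel_deviation x : D x ->
  \int[mu]_(y in D) (bikernel x y * `|f y - f x|)%:E <= (E / c + E / c ^+ 2)%:E.
Proof.
move=> Dx; have c0 := ltW c_gt0.
have mpx := measurableT_comp mpsi (pair1_measurable x).
have mpx1 : measurable_fun setT (fun zy : T * T => psi x zy.1).
  exact: (measurableT_comp mpx measurable_fst).
pose F (zy : T * T) := (psi x zy.1 + psi zy.1 zy.2)%R.
have mF : measurable_fun setT F by exact: measurable_funD.
have F0 z y : (0 <= F (z, y))%R by rewrite addr_ge0.
have mW : measurable_fun setT (fun yz : T * T =>
    (weight x yz.1 yz.2 * F (yz.2, yz.1))%:E).
  apply/measurable_EFinP/measurable_funM.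
    exact: measurable_weight_section.
  by apply: (measurableT_comp mF); exact: measurable_fun_pair.
apply: (@le_trans _ _ (\int[mu]_(y in D) \int[mu]_(z in D)
    (weight x y z * F (z, y))%:E)).
  apply: ge0_le_integral => //.
  - by move=> y _; rewrite lee_fin mulr_ge0 ?bikernel_ge0.
  - apply/measurable_EFinP/measurable_funM.
      apply: measurable_funTS.
      exact: (measurableT_comp measurable_bikernel (pair1_measurable x)).
    by apply: measurableT_comp => //; exact: measurable_funB.
  - exact/measurable_funTS/(measurable_integral_section mu mD mW).
  - move=> y Dy; rewrite mulrC EFinM bikernelE// -ge0_integralZl_EFin//; last 2 first.
    + by move=> z _; rewrite lee_fin weight_ge0.
    + apply/measurable_EFinP/measurable_funTS.
      exact: (measurableT_comp measurable_weight (pair1_measurable (x, y))).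
    apply: ge0_le_integral => //.
    + by move=> z _; rewrite -EFinM lee_fin mulr_ge0 ?weight_ge0.
    + apply/measurable_funeM/measurable_EFinP/measurable_funTS.
      exact: (measurableT_comp measurable_weight (pair1_measurable (x, y))).
    + exact/measurable_funTS/(measurableT_comp mW (pair1_measurable y)).
    + move=> z Dz; rewrite -EFinM lee_fin mulrC ler_wpM2l ?weight_ge0//.
      exact: f_psi.
rewrite weight_tonelli//.
have E0 : (0 <= E)%R.
  rewrite -lee_fin; apply: le_trans (E_ge Dx); apply: integral_ge0 => y _.
  by rewrite lee_fin mulr_ge0.
have mkx : measurable_fun D (fun z => k x z * psi x z)%R.
  by apply/measurable_funTS/measurable_funM => //; exact: measurable_k.
have mkdq : measurable_fun D (fun z => k x z / (deg x * bideg z))%R.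
  apply/measurable_funTS/measurable_funM; first exact: measurable_k.
  by apply/measurable_funV/measurable_funM => //; exact: measurable_bideg.
pose H z := ((deg x)^-1 * (k x z * psi x z) +
             (E / c) * ((c ^+ 1)^-1 * (k x z / deg x)))%R.
apply: (@le_trans _ _ (\int[mu]_(z in D) (H z)%:E)).
  apply: ge0_le_integral => //.
  - move=> z _; rewrite mule_ge0 ?integral_ge0//.
      by rewrite lee_fin divr_ge0// mulr_ge0 ?deg_ge0 ?bideg_ge0.
    by move=> y _; rewrite lee_fin mulr_ge0 ?k_deg_ge0.
  - apply: emeasurable_funM; first exact/measurable_EFinP.
    apply: measurable_funTS.
    apply: (measurable_integral_section mu mD
      (f := fun zy : T * T => (k zy.1 zy.2 / deg zy.2 * F zy)%:E)).
    apply/measurable_EFinP/measurable_funM => //; exact: measurable_k_deg.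
  - apply/measurable_EFinP/measurable_funD; first exact: measurable_funM.
    do 2 apply: measurable_funM => //; apply: measurable_funM => //.
    exact/measurable_funTS/measurable_k.
  - move=> z Dz.
    have dz : (0 < deg x * bideg z)%R by rewrite mulr_gt0 ?deg_gt0 ?bideg_gt0.
    apply: (@le_trans _ _ ((k x z / (deg x * bideg z))%:E *
        (bideg z * psi x z + E / c)%:E)).
      apply: lee_wpmul2l; first by rewrite lee_fin divr_ge0// ltW.
      under eq_integral do rewrite mulrDr EFinD.
      rewrite ge0_integralD//; last 4 first.
      + by move=> y _; rewrite lee_fin mulr_ge0 ?k_deg_ge0.
      + apply/measurable_EFinP/measurable_funTS/measurable_funM.
          exact: (measurableT_comp measurable_k_deg (pair1_measurable z)).
        by rewrite /=; exact: measurable_cst.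
      + by move=> y _; rewrite lee_fin mulr_ge0 ?k_deg_ge0.
      + apply/measurable_EFinP/measurable_funTS/measurable_funM.
          exact: (measurableT_comp measurable_k_deg (pair1_measurable z)).
        exact: (measurableT_comp mpsi (pair1_measurable z)).
      rewrite EFinD leeD ?integral_k_psi//.
      under eq_integral do rewrite mulrC EFinM.
      rewrite /= integralZl//; last exact: integrable_k_deg.
      by rewrite -bidegE -EFinM mulrC.
    rewrite -EFinM lee_fin /H mulrDr lerD//.
      rewrite le_eqVlt; apply/orP; left; apply/eqP.
      by field; rewrite !gt_eqF ?deg_gt0 ?bideg_gt0.
    rewrite mulrC ler_wpM2l//; first by rewrite divr_ge0.
    rewrite expr1 invfM mulrA mulrC ler_wpM2r//.
      by rewrite divr_ge0// deg_ge0.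
    by rewrite lef_pV2 ?posrE ?bideg_gt0// bideg_ge.
rewrite /H; under eq_integral do rewrite EFinD.
have kdi : mu.-integrable D (EFin \o (fun z => k x z / deg x)%R).
  apply: eq_integrable (integrableZl_EFin (deg x)^-1 mD (integrable_k x)) => //.
  by move=> z _ /=; rewrite mulrC.
have dV0 : (0 <= (deg x)^-1)%R by rewrite invr_ge0 deg_ge0.
rewrite ge0_integralD//; last 4 first.
- by move=> z _; rewrite lee_fin mulr_ge0// mulr_ge0.
- by apply/measurable_EFinP/measurable_funM.
- by move=> z _; rewrite lee_fin !mulr_ge0// invr_ge0.
- apply/measurable_EFinP; do 2 apply: measurable_funM => //.
  by apply: measurable_funM => //; exact/measurable_funTS/measurable_k.
rewrite EFinD; apply: leeD.
  under eq_integral do rewrite EFinM.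
  rewrite ge0_integralZl_EFin//; last 2 first.
  - by move=> z _; rewrite lee_fin mulr_ge0.
  - exact/measurable_EFinP.
  rewrite mulrC EFinM; apply: lee_pmul => //.
  - by apply: integral_ge0 => z _; rewrite lee_fin mulr_ge0.
  - by rewrite lee_fin lef_pV2 ?posrE ?deg_gt0// deg_ge.
  - exact: E_ge.
under eq_integral do rewrite mulrA EFinM.
rewrite integralZl// integral_k_div_deg// mule1 lee_fin.
by rewrite expr1 expr2 invfM mulrA.
Qed.

End deviation.

Section factorization.
Local Open Scope ereal_scope.

(** What remains of the operator once the outer convolution with [k] and the
    outer division by [deg] are split off. *)
Definition half_op (f : T -> R) z :=
  ((bideg z)^-1 * \int[mu]_(y in D) (k z y * (f y / deg y)))%R.

Variable f : T -> R.
Hypothesis fi : mu.-integrable D (EFin \o f).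

Let mfD : measurable_fun setT (f \_ D).
Proof.
by apply/(measurable_restrictT _ mD)/measurable_EFinP; exact: measurable_int fi.
Qed.

Let mfR : measurable_fun setT
  (fun xy : T * T => k xy.1 xy.2 * ((f \_ D) xy.2 / deg xy.2))%R.
Proof.
apply: measurable_funM => //; apply: measurable_funM.
  exact: (measurableT_comp mfD measurable_snd).
apply: measurable_funV; exact: (measurableT_comp measurable_deg measurable_snd).
Qed.

Let half_opE z : half_op f z = ((bideg z)^-1 *
  \int[mu]_(y in D) (k z y * ((f \_ D) y / deg y)))%R.
Proof. by congr (_ * _)%R; apply: eq_Rintegral => y yD; rewrite /patch yD. Qed.

Lemma measurable_half_op : measurable_fun setT (half_op f).
Proof.
rewrite (_ : half_op f = fun z => ((bideg z)^-1 *
  \int[mu]_(y in D) (k z y * ((f \_ D) y / deg y)))%R); last first.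
  by apply/funext => z; rewrite half_opE.
apply: measurable_funM; first exact/measurable_funV/measurable_bideg.
exact: (measurable_Rintegral_section mu mD mfR).
Qed.

Let integrable_half z :
  mu.-integrable D (EFin \o (fun y => k z y * (f y / deg y))%R) /\
  (`|\int[mu]_(y in D) (k z y * (f y / deg y))| <=
    B / c * \int[mu]_(y in D) `|f y|)%R.
Proof.
have le y : D y -> (`|k z y * (f y / deg y)| <= B / c * `|f y|)%R.
  move=> Dy; rewrite !normrM (ger0_norm (k_ge0 _ _)) normfV.
  rewrite (ger0_norm (deg_ge0 y)) [leRHS]mulrAC -mulrA.
  apply: ler_pM => //; first by rewrite mulr_ge0// invr_ge0 deg_ge0.
  by rewrite ler_wpM2l// lef_pV2 ?posrE ?deg_gt0// deg_ge.
have bi : mu.-integrable D (EFin \o (fun y => B / c * `|f y|)%R).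
  by apply: integrableZl_EFin => //; exact: integrable_norm.
have ki : mu.-integrable D (EFin \o (fun y => k z y * (f y / deg y))%R).
  apply: integrable_bounded_by bi => //.
  have := measurable_funTS (D := D) (measurableT_comp mfR (pair1_measurable z)).
  by apply: eq_measurable_fun => y yD /=; rewrite /patch yD.
split => //; rewrite (le_trans (le_normr_Rintegral _ _))//.
rewrite -RintegralZl//; last exact: integrable_norm.
by apply: le_Rintegral => //; exact: integrable_norm.
Qed.

Lemma half_op_bounded z : D z ->
  (`|half_op f z| <= B / c ^+ 2 * \int[mu]_(y in D) `|f y|)%R.
Proof.
move=> Dz; rewrite normrM normfV (ger0_norm (bideg_ge0 z)).
rewrite expr2 invfM mulrA [(_ / c * c^-1)%R]mulrC -mulrA ler_pM ?invr_ge0 ?bideg_ge0//.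
  by rewrite lef_pV2 ?posrE ?bideg_gt0// bideg_ge.
exact: (integrable_half z).2.
Qed.

Lemma bikernel_factor x : D x -> markov_op mu D bikernel f x =
  ((deg x)^-1 * \int[mu]_(z in D) (k x z * half_op f z))%R.
Proof.
move=> Dx.
pose g (yz : T * T) := (weight x yz.1 yz.2 * (f \_ D) yz.1)%R.
have mg : measurable_fun setT g.
  apply: measurable_funM.
    exact: measurable_weight_section.
  exact: (measurableT_comp mfD measurable_fst).
have gint y : D y -> \int[mu]_(z in D) (g (y, z))%:E = (bikernel x y * f y)%:E.
  move=> Dy; rewrite /g/= /patch mem_set//.
  under eq_integral do rewrite mulrC EFinM.
  by rewrite integralZl -?bikernelE -?EFinM 1?mulrC//; exact: integrable_weight.
have goo : \int[mu]_(y in D) \int[mu]_(z in D) `|g (y, z)|%:E < +oo.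
  rewrite (eq_integral (fun y => (bikernel x y * `|f y|)%:E)); last first.
    move=> y /set_mem Dy; rewrite /g/= /patch mem_set//.
    under eq_integral do
      rewrite normrM (ger0_norm (weight_ge0 _ _ _)) mulrC EFinM.
    by rewrite integralZl -?bikernelE -?EFinM 1?mulrC//; exact: integrable_weight.
  have bi : mu.-integrable D (EFin \o (fun y => B / c ^+ 3 * `|f y|)%R).
    by apply: integrableZl_EFin => //; exact: integrable_norm.
  have /integrableP[_] : mu.-integrable D (EFin \o (fun y => bikernel x y * `|f y|)%R).
    apply: integrable_bounded_by bi => //.
      apply: measurable_funM.
        apply: measurable_funTS.
        exact: (measurableT_comp measurable_bikernel (pair1_measurable x)).
      by apply: measurableT_comp => //; apply/measurable_EFinP; exact: measurable_int fi.
    move=> y Dy; rewrite normrM normr_id (ger0_norm (bikernel_ge0 _ _)).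
    by rewrite ler_wpM2r// bikernel_le.
  congr (_ < _); apply: eq_integral => y _ /=.
  by rewrite ger0_norm ?mulr_ge0 ?bikernel_ge0.
have [_] := fubini_on mD mD mg goo.
rewrite (eq_integral (fun y => (bikernel x y * f y)%:E)); last first.
  by move=> y /set_mem Dy; exact: gint.
move=> eqI; rewrite /markov_op /Rintegral eqI -RintegralZl//; last first.
  have bi := integrableZl_EFin (B / c ^+ 2 * \int[mu]_(y in D) `|f y|)%R mD
    (integrable_k x).
  apply: integrable_bounded_by bi => //.
    apply/measurable_funTS/measurable_funM; first exact: measurable_k.
    exact: measurable_half_op.
  move=> z Dz; rewrite normrM (ger0_norm (k_ge0 _ _)) mulrC ler_wpM2r//.
  exact: half_op_bounded.
congr fine; apply: eq_integral => z /set_mem Dz.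
rewrite /half_op mulrA mulrA EFinM RintegralE//; last exact: (integrable_half z).1.
rewrite -integralZl//; last exact: (integrable_half z).1.
apply: eq_integral => y yD; rewrite /g/= /patch yD -EFinM weightE invfM.
by congr EFin; ring.
Qed.

End factorization.
End bistochastic_kernel.

(** * Affine changes of variables in [R^n] *)

Section lebesgue_affine.
Context (R : realType).
Notation mu := (@lebesgue_measure R).
Local Open Scope ereal_scope.

(** The right-hand side is a measure in [A] that agrees with Lebesgue measure
    on intervals. *)
Lemma lebesgue_measure_affine (a b : R) (A : set (measurableTypeR R)) :
  (a != 0)%R -> measurable A ->
  mu A = `|a|%:E * mu ((fun t => a * t + b)%R @^-1` A).
Proof.
move=> a0 mA.
have mphi : measurable_fun setT
    ((fun t => a * t + b)%R : measurableTypeR R -> measurableTypeR R).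
  by apply: measurable_funD => //; exact: measurable_funM.
pose m := mscale (NngNum (normr_ge0 a))
  (measure_function_pushforward__canonical__measure_function_Measure mu mphi).
have := @lebesgue_measure_unique R m _ A mA.
apply=> X [[x y] _ <-]/=.
rewrite /m /mscale/= /pushforward.
have [yx|xy] := leP y x.
  by rewrite !set_itv_ge ?bnd_simp -?leNgt// preimage_set0 !measure0 mule0.
have muxy : mu `]x, y]%classic = (y - x)%:E by rewrite lebesgue_measure_itv/= lte_fin xy.
have [agt0|alt0] := ltP 0%R a; last first.
  have {}alt0 : (a < 0)%R by rewrite lt_neqAle a0.
  rewrite (_ : _ @^-1` _ = `[((y - b) / a)%R, ((x - b) / a)%R[%classic); last first.
    apply/seteqP; split => t /=; rewrite !in_itv/= ler_ndivrMr// ltr_ndivlMr//;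
      by move=> /andP[? ?]; apply/andP; split; lra.
  rewrite muxy lebesgue_measure_itv/= lte_fin ltr_nM2r ?invr_lt0// ltrD2r xy.
  by rewrite -EFinM ltr0_norm//; congr EFin; field.
rewrite (_ : _ @^-1` _ = `]((x - b) / a)%R, ((y - b) / a)%R]%classic); last first.
  apply/seteqP; split => t /=; rewrite !in_itv/= ler_pdivlMr// ltr_pdivrMr//;
    by move=> /andP[? ?]; apply/andP; split; lra.
rewrite muxy lebesgue_measure_itv/= lte_fin ltr_pM2r ?invr_gt0// ltrD2r xy.
by rewrite -EFinM gtr0_norm//; congr EFin; field.
Qed.

Lemma ge0_integral_affine (a b : R) (f : measurableTypeR R -> \bar R) : (a != 0)%R ->
  measurable_fun setT f -> (forall t, 0 <= f t) ->
  \int[mu]_t f (a * t + b)%R = (`|a|^-1)%:E * \int[mu]_t f t.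
Proof.
move=> a0 mf f0.
have mphi : measurable_fun setT
    ((fun t => a * t + b)%R : measurableTypeR R -> measurableTypeR R).
  by apply: measurable_funD => //; exact: measurable_funM.
pose m :=
  measure_function_pushforward__canonical__measure_function_Measure mu mphi.
have -> : \int[mu]_t f t = \int[mscale (NngNum (normr_ge0 a)) m]_t f t.
  apply: eq_measure_integral => A mA _.
  exact: lebesgue_measure_affine.
rewrite ge0_integral_mscale// /m ge0_integral_pushforward//= preimage_setT.
by rewrite muleA -EFinM mulVf ?normr_eq0// mul1e.
Qed.

End lebesgue_affine.

Section leb_integral.
Context (R : realType).
Local Open Scope ereal_scope.

Lemma integral_leb0 (f : 'rV[R]_0 -> \bar R) : measurable_fun setT f ->
  \int[leb R 0]_x f x = f 0%R.
Proof. by move=> mf; rewrite integral_dirac// diracT mul1e. Qed.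

Lemma ge0_integral_lebS n (f : 'rV[R]_n.+1 -> \bar R) : measurable_fun setT f ->
  (forall x, 0 <= f x) ->
  \int[leb R n.+1]_x f x =
  \int[lebesgue_measure]_t \int[leb R n]_x f (cons_rV (t, x)).
Proof.
move=> mf f0.
have mc := @measurable_cons_rV R n.
have := ge0_integral_pushforward mc (lebesgue_measure \x leb R n) measurableT mf.
move=> /(_ (fun x _ => f0 x)); rewrite preimage_setT fubini_tonelli1/=.
- by move=> <-; exact: eq_measure_integral.
- exact: measurableT_comp.
- by move=> x; exact: f0.
Qed.

Lemma integrable_lebS n (f : 'rV[R]_n.+1 -> R) :
  (leb R n.+1).-integrable setT (EFin \o f) ->
  (lebesgue_measure \x leb R n).-integrable setT (EFin \o (f \o @cons_rV R n)).
Proof.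
move=> fi; have mc := @measurable_cons_rV R n.
have mf := measurable_int _ fi.
apply/integrableP; split; first exact: (measurableT_comp mf mc).
have /integrableP[_] := fi; congr (_ < _).
have mnf : measurable_fun setT (fun x => `|(f x)%:E|).
  exact: measurableT_comp.
have := ge0_integral_pushforward mc (lebesgue_measure \x leb R n) measurableT mnf.
move=> /(_ (fun x _ => abse_ge0 _)); rewrite preimage_setT => <-.
exact: eq_measure_integral.
Qed.

Lemma measurable_affine_rV n (a : R) (b : 'rV[R]_n) :
  measurable_fun setT (fun x : 'rV[R]_n => a *: x + b)%R.
Proof.
apply/measurable_fun_rVP => i.
rewrite (_ : (fun _ => _) = (fun x : 'rV[R]_n => a * rV_coord i x + b 0 i)%R).
  apply: measurable_funD => //; apply: measurable_funM => //.
  exact: measurable_rV_coord.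
by apply/funext => x; rewrite !mxE.
Qed.

(** Induction on the dimension: the affine map acts coordinatewise, so each
    coordinate contributes a factor [|a|^-1]. *)
Lemma ge0_integral_affine_rV n (a : R) (b : 'rV[R]_n) (f : 'rV[R]_n -> \bar R) :
  (a != 0)%R -> measurable_fun setT f -> (forall x, 0 <= f x) ->
  \int[leb R n]_x f (a *: x + b)%R = (`|a| ^- n)%:E * \int[leb R n]_x f x.
Proof.
elim: n b f => [|n IHn] b f a0 mf f0.
  rewrite !integral_leb0//; last first.
    exact: (measurableT_comp mf (measurable_affine_rV a b)).
  by rewrite expr0 invr1 mul1e; congr f; apply/rowP => -[].
rewrite !ge0_integral_lebS//; last first.
  exact: (measurableT_comp mf (measurable_affine_rV a b)).
have mfc : measurable_fun setT (f \o @cons_rV R n).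
  exact: measurableT_comp mf (@measurable_cons_rV R n).
have consE t x : (a *: cons_rV (t, x) + b =
    cons_rV (a * t + b 0 ord0, a *: x + (uncons_rV b).2))%R.
  apply/rowP => i; rewrite !mxE.
  have [j ->|->] := unliftP ord0 i; rewrite ?liftK ?unlift_none//=.
  by rewrite !mxE.
under eq_integral do under eq_integral do rewrite consE.
pose g t := \int[leb R n]_x f (cons_rV (t, x)).
have mg : measurable_fun setT g.
  exact: (measurable_integral_section (leb R n) measurableT mfc).
transitivity (\int[lebesgue_measure]_t ((`|a| ^- n)%:E * g (a * t + b 0 ord0)%R)).
  apply: eq_integral => t _.
  rewrite (IHn _ (fun x => f (cons_rV (a * t + b 0 ord0, x)%R)))//.
  exact: (measurableT_comp mfc (pair1_measurable _)).
have g0 t : 0 <= g t by apply: integral_ge0.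
rewrite ge0_integralZl//.
- rewrite (ge0_integral_affine (b 0 ord0)%R a0 mg g0) muleA -EFinM.
  by rewrite -invfM -exprSr.
- apply: (measurableT_comp mg).
  by apply: measurable_funD => //; exact: measurable_funM.
Qed.

Lemma integrable_affine_rV n (a : R) (b : 'rV[R]_n) (f : 'rV[R]_n -> R) :
  (a != 0)%R -> (leb R n).-integrable setT (EFin \o f) ->
  (leb R n).-integrable setT (EFin \o (fun x => f (a *: x + b)%R)).
Proof.
move=> a0 /integrableP[mf foo]; apply/integrableP; split.
  exact: (measurableT_comp mf (measurable_affine_rV a b)).
rewrite (ge0_integral_affine_rV b (f := fun x => `|(f x)%:E|) a0)//; last first.
  exact: measurableT_comp.
by rewrite lte_mul_pinfty// lee_fin invr_ge0 exprn_ge0.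
Qed.

Lemma Rintegral_affine_rV n (a : R) (b : 'rV[R]_n) (f : 'rV[R]_n -> R) :
  (a != 0)%R -> (leb R n).-integrable setT (EFin \o f) ->
  (\int[leb R n]_x f (a *: x + b) = `|a| ^- n * \int[leb R n]_x f x)%R.
Proof.
move=> a0 fi; have mf := measurable_int _ fi.
rewrite /Rintegral -[X in (X * _)%R]/(fine (`|a| ^- n)%:E) -fineM//; last first.
  exact: integrable_fin_num.
congr fine.
rewrite [in LHS]integralE [in RHS]integralE muleBr//; last first.
  apply: fin_num_adde_defl; rewrite fin_numN.
  exact: integrable_neg_fin_num.
rewrite -(ge0_integral_affine_rV b (f := (EFin \o f)^\+))//; last first.
  exact: measurable_funepos.
rewrite -(ge0_integral_affine_rV b (f := (EFin \o f)^\-))//; last first.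
  exact: measurable_funeneg.
rewrite (_ : (fun x : 'rV_n => (f (a *: x + b)%R)%:E) =
  (EFin \o f) \o (fun x => a *: x + b)%R)//.
by rewrite funepos_comp funeneg_comp.
Qed.

(** Tonelli, splitting off one coordinate at a time. *)
Lemma ge0_integral_prod_rV n (f : 'I_n -> measurableTypeR R -> R) :
  (forall i, measurable_fun setT (f i)) -> (forall i t, (0 <= f i t)%R) ->
  \int[leb R n]_x (\prod_i f i (x 0 i))%:E =
  \prod_i \int[lebesgue_measure]_t (f i t)%:E.
Proof.
elim: n f => [|n IHn] f mf f0.
  rewrite integral_leb0 ?big_ord0//.
  rewrite (_ : (fun _ => _) = cst 1) => [|]; first exact: measurable_cst.
  by apply/funext => x; rewrite big_ord0.
have mP : measurable_fun setT
    (fun x : 'rV[R]_n.+1 => (\prod_i f i (x 0 i))%:E).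
  apply/measurable_EFinP; apply: measurable_prod => i _.
  exact: (measurableT_comp (mf i) (@measurable_rV_coord R n.+1 i)).
rewrite ge0_integral_lebS//; last by move=> x; rewrite lee_fin prodr_ge0.
rewrite big_ord_recl.
have mP' : measurable_fun setT
    (fun x : 'rV[R]_n => (\prod_i f (lift ord0 i) (x 0 i))%:E).
  apply/measurable_EFinP; apply: measurable_prod => i _.
  exact: (measurableT_comp (mf _) (@measurable_rV_coord R n i)).
transitivity (\int[lebesgue_measure]_t
   ((\int[leb R n]_x (\prod_i f (lift ord0 i) (x 0 i))%:E) * (f ord0 t)%:E)).
  apply: eq_integral => t _; rewrite muleC -ge0_integralZl//.
  - apply: eq_integral => x _; rewrite -EFinM big_ord_recl; congr (_ * _)%:E.
      by rewrite mxE unlift_none.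
    by apply: eq_bigr => i _; rewrite mxE liftK.
  - by move=> x _; rewrite lee_fin prodr_ge0.
  - by rewrite lee_fin.
rewrite ge0_integralZl//.
- by rewrite (IHn (fun i => f (lift ord0 i)))// muleC.
- exact/measurable_EFinP.
- by move=> t _; rewrite lee_fin.
- by apply: integral_ge0 => x _; rewrite lee_fin prodr_ge0.
Qed.

End leb_integral.

(** * Euclidean balls and radially decreasing densities *)

Section euclidean_norm.
Context (R : realType) (n : nat).
Implicit Types x y : 'rV[R]_n.

Lemma enorm_ge0 x : 0 <= enorm x. Proof. exact: sqrtr_ge0. Qed.

Lemma enorm_sqr x : enorm x ^+ 2 = \sum_i x 0 i ^+ 2.
Proof. by rewrite sqr_sqrtr// sumr_ge0// => i _; exact: sqr_ge0. Qed.

Lemma enorm_le x (r : R) : 0 <= r -> \sum_i x 0 i ^+ 2 <= r ^+ 2 -> enorm x <= r.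
Proof.
by move=> r0 xr; rewrite -(@ler_pXn2r _ 2)// ?nnegrE ?enorm_ge0// enorm_sqr.
Qed.

Lemma enormZ (a : R) x : enorm (a *: x) = `|a| * enorm x.
Proof.
rewrite /enorm -sqrtr_sqr -sqrtrM ?sqr_ge0//; congr Num.sqrt.
by rewrite mulr_sumr; apply: eq_bigr => i _; rewrite mxE exprMn.
Qed.

Lemma enormN x : enorm (- x) = enorm x.
Proof. by rewrite -scaleN1r enormZ normrN normr1 mul1r. Qed.

Lemma enorm0 : enorm (0 : 'rV[R]_n) = 0.
Proof. by rewrite -(scale0r (0 : 'rV[R]_n)) enormZ normr0 mul0r. Qed.

Lemma coord_le_enorm x i : `|x 0 i| <= enorm x.
Proof.
rewrite -sqrtr_sqr ler_wsqrtr// (bigD1 i)//= lerDl.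
by apply: sumr_ge0 => j _; exact: sqr_ge0.
Qed.

Lemma coord_le_norm x i : `|x 0 i| <= `|x|.
Proof.
rewrite [leRHS]mx_normrE.
exact: (le_bigmax _ (fun ij : 'I_1 * 'I_n => `|x ij.1 ij.2|) (0, i)).
Qed.

Lemma enorm_le_norm x : enorm x <= n%:R * `|x|.
Proof.
apply: enorm_le; first by rewrite mulr_ge0.
apply: (@le_trans _ _ (\sum_(i < n) `|x| ^+ 2)).
  apply: ler_sum => i _; rewrite -real_normK ?num_real//.
  by rewrite lerXn2r ?nnegrE// coord_le_norm.
rewrite sumr_const card_ord -[leLHS]mulr_natl exprMn ler_wpM2r ?sqr_ge0//.
rewrite expr2 -natrM ler_nat; case: (n) => // m; exact: leq_pmulr.
Qed.

Lemma norm_le_enorm x : `|x| <= enorm x.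
Proof.
rewrite [leLHS]mx_normrE; apply: bigmax_le; first exact: enorm_ge0.
by move=> [i j] _ /=; rewrite (ord1 i) coord_le_enorm.
Qed.

Lemma edot_le x y : edot x y <= enorm x * enorm y.
Proof.
have [x0|xN0] := eqVneq (enorm x) 0.
  rewrite x0 mul0r /edot big1// => i _.
  have := coord_le_enorm x i; rewrite x0 normr_le0 => /eqP ->.
  by rewrite mul0r.
have [y0|yN0] := eqVneq (enorm y) 0.
  rewrite y0 mulr0 /edot big1// => i _.
  have := coord_le_enorm y i; rewrite y0 normr_le0 => /eqP ->.
  by rewrite mulr0.
have x0 : 0 < enorm x by rewrite lt_def xN0 enorm_ge0.
have y0 : 0 < enorm y by rewrite lt_def yN0 enorm_ge0.
suff : edot x y / (enorm x * enorm y) <= 1.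
  by rewrite ler_pdivrMr ?mulr_gt0// mul1r.
rewrite /edot mulr_suml.
apply: (@le_trans _ _ (\sum_i (2^-1 * (enorm x ^- 2 * x 0 i ^+ 2) +
                            2^-1 * (enorm y ^- 2 * y 0 i ^+ 2)))); last first.
  rewrite big_split/= -!mulr_sumr -!enorm_sqr !mulVf ?expf_neq0//.
  by rewrite !mulr1; lra.
apply: ler_sum => i _.
have := sqr_ge0 (x 0 i / enorm x - y 0 i / enorm y).
rewrite sqrrB !expr_div_n; set A := x 0 i; set B := y 0 i => H.
have -> : A * B / (enorm x * enorm y) = A / enorm x * (B / enorm y).
  by field; rewrite xN0 yN0.
rewrite (mulrC _ (A ^+ 2)) (mulrC _ (B ^+ 2)).
by move: H; rewrite -mulr_natl; lra.
Qed.

Lemma enormD x y : enorm (x + y) <= enorm x + enorm y.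
Proof.
apply: enorm_le; first by rewrite addr_ge0 ?enorm_ge0.
rewrite sqrrD !enorm_sqr.
rewrite (_ : \sum_i (x + y) 0 i ^+ 2 =
   \sum_i x 0 i ^+ 2 + edot x y *+ 2 + \sum_i y 0 i ^+ 2).
  by rewrite lerD2r lerD2l lerMn2r edot_le orbT.
rewrite /edot -sumrMnl -!big_split/=.
by apply: eq_bigr => i _; rewrite mxE sqrrD.
Qed.

Lemma measurable_enorm : measurable_fun setT (@enorm R n).
Proof.
rewrite (_ : @enorm R n = (fun x => (\sum_i rV_coord i x ^+ 2) `^ 2^-1)).
  apply: (measurableT_comp (@measurable_powR R 2^-1)).
  apply: measurable_sum => i; apply: measurable_funX.
  exact: measurable_rV_coord.
apply/funext => x; rewrite powR12_sqrt//.
by apply: sumr_ge0 => i _; exact: sqr_ge0.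
Qed.

Lemma measurable_rVB :
  measurable_fun setT (fun xy : 'rV[R]_n * 'rV[R]_n => xy.2 - xy.1).
Proof.
apply/measurable_fun_rVP => i.
rewrite (_ : (fun _ => _) = (fun xy : 'rV[R]_n * 'rV[R]_n =>
    rV_coord i xy.2 - rV_coord i xy.1)); last first.
  by apply/funext => xy; rewrite !mxE.
by apply: measurable_funB;
  [exact: (measurableT_comp (@measurable_rV_coord R n i) measurable_snd)
  |exact: (measurableT_comp (@measurable_rV_coord R n i) measurable_fst)].
Qed.

Lemma measurable_edot w : measurable_fun setT (fun x : 'rV[R]_n => edot w x).
Proof.
apply: measurable_sum => i; apply: measurable_funM => //.
exact: (@measurable_rV_coord R n i).
Qed.

Lemma measurable_edot2 :
  measurable_fun setT (fun wx : 'rV[R]_n * 'rV[R]_n => edot wx.1 wx.2).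
Proof.
apply: measurable_sum => i; apply: measurable_funM.
  exact: (measurableT_comp (@measurable_rV_coord R n i) measurable_fst).
exact: (measurableT_comp (@measurable_rV_coord R n i) measurable_snd).
Qed.

Lemma measurable_eball x (e : R) : measurable (eball x e).
Proof.
rewrite (_ : eball x e = (fun y => enorm (y - x)) @^-1` `]-oo, e[%classic).
  rewrite -[X in measurable X]setTI.
  have m : measurable_fun setT (fun y => enorm (y - x)).
    rewrite (_ : (fun _ => _) = @enorm R n \o (fun y => 1 *: y + (- x))).
      exact: (measurableT_comp measurable_enorm (measurable_affine_rV 1 (- x))).
    by apply/funext => y /=; rewrite scale1r.
  by apply: m.
by apply/seteqP; split => y; rewrite /eball/= in_itv.
Qed.

End euclidean_norm.

Section leb_bounded.
Context (R : realType) (n : nat).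
Local Open Scope ereal_scope.

Lemma leb_bounded_lty (A : set 'rV[R]_n) : measurable A -> bounded_set A ->
  leb R n A < +oo.
Proof.
move=> mA [M [_ AM]].
have {}AM x : A x -> (`|x| <= `|M| + 1)%R.
  apply: AM; rewrite (le_lt_trans (ler_norm M))// ltrDl//.
pose N := (`|M| + 1)%R.
have N0 : (0 <= N)%R by rewrite addr_ge0.
have mbox : measurable
    [set x : 'rV[R]_n | forall i, x 0%R i \in `[(- N)%R, N]].
  exact: (@measurable_rV_box R n (fun i => `[(- N)%R, N]%classic)).
apply: (@le_lt_trans _ _ (leb R n
    [set x : 'rV[R]_n | forall i, x 0%R i \in `[(- N)%R, N]])).
  apply: le_measure; rewrite ?inE//= => x Ax i.
  by rewrite in_itv/= -ler_norml (le_trans (coord_le_norm x i))// AM.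
have := @leb_box R n (const_mx (- N)%R) (const_mx N).
under [X in leb _ _ X]eq_set do under eq_forall do rewrite !mxE.
by move=> ->; [exact: ltry|move=> i; rewrite !mxE; lra].
Qed.

Lemma leb_eball_lty (x : 'rV[R]_n) (e : R) : leb R n (eball x e) < +oo.
Proof.
apply: leb_bounded_lty; first exact: measurable_eball.
exists (`|x| + e)%R; split; first exact: num_real.
move=> M eM y /= xy; rewrite ltW// (le_lt_trans _ eM)//.
rewrite -[y](subrK x) (le_trans (ler_normD _ _))// addrC lerD2l.
by rewrite (le_trans (norm_le_enorm _))// ltW.
Qed.

Lemma leb_affine (a : R) (b : 'rV[R]_n) (A : set 'rV[R]_n) : (a != 0)%R ->
  measurable A ->
  leb R n ((fun x => a *: x + b)%R @^-1` A) = (`|a| ^- n)%:E * leb R n A.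
Proof.
move=> a0 mA.
have mA' : measurable ((fun x => a *: x + b)%R @^-1` A).
  by rewrite -[X in measurable X]setTI; exact: measurable_affine_rV.
have indE B : measurable B -> leb R n B = \int[leb R n]_x (\1_B x)%:E.
  by move=> mB; rewrite integral_indic// setIT.
rewrite (indE _ mA') (indE _ mA).
have mI : measurable_fun setT (fun x : 'rV[R]_n => (\1_A x : R)%:E).
  by apply/measurable_EFinP; exact: measurable_indic.
by rewrite -(ge0_integral_affine_rV b a0 mI)// => x; rewrite lee_fin.
Qed.

Lemma leb_eball_scale (x : 'rV[R]_n) (e : R) : (0 < e)%R ->
  leb R n (eball x e) = (e ^+ n)%:E * leb R n (eball 0%R 1%R).
Proof.
move=> e0; have eN0 : (e != 0)%R by rewrite gt_eqF.
have -> : eball 0%R 1%R = (fun y => e *: y + x)%R @^-1` (eball x e).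
  apply/seteqP; split => y; rewrite /eball/= subr0 addrK enormZ gtr0_norm//;
    by rewrite gtr_pMr.
rewrite leb_affine//; last exact: measurable_eball.
by rewrite muleA -EFinM gtr0_norm// mulfV ?mul1e// expf_neq0.
Qed.

Lemma leb_eball_gt0 (x : 'rV[R]_n) (e : R) : (0 < e)%R ->
  0 < leb R n (eball x e).
Proof.
(* The cube of half-side [e / (n + 1)] fits into the ball. *)
move=> e0; pose s := (e / n.+1%:R)%R.
have s0 : (0 < s)%R by rewrite divr_gt0.
have := @leb_box R n (x - const_mx s)%R (x + const_mx s)%R.
rewrite (_ : \prod_i _ = \prod_(i < n) (s + s))%R; last first.
  by apply: eq_bigr => i _; rewrite !mxE; ring.
move=> boxE; apply: (@lt_le_trans _ _ (\prod_(i < n) (s + s))%R%:E).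
  by rewrite lte_fin prodr_gt0// => i _; rewrite addr_gt0.
rewrite -boxE => [|i]; last by rewrite !mxE; lra.
apply: le_measure; rewrite ?inE.
- exact: (@measurable_rV_box R n
    (fun i => `[(x - const_mx s)%R 0%R i, (x + const_mx s)%R 0%R i]%classic)).
- exact: measurable_eball.
move=> y /= ybox; rewrite /eball/=.
have ys : (`|y - x| <= s)%R.
  rewrite [leLHS]mx_normrE; apply: bigmax_le; first exact: ltW.
  move=> [i j] _ /=; rewrite (ord1 i); have := ybox j.
  by rewrite in_itv/= !mxE ler_norml => /andP[? ?]; apply/andP; split; lra.
rewrite (le_lt_trans (enorm_le_norm _))//.
rewrite (@le_lt_trans _ _ (n%:R * s)%R)//; first by rewrite ler_wpM2l.
by rewrite /s mulrCA gtr_pMr// ltr_pdivrMr// mul1r ltr_nat.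
Qed.

End leb_bounded.

Section bounded_domain.
Context (R : realType) (n : nat) (Om : set 'rV[R]_n).
Hypothesis mOm : measurable Om.
Hypothesis bOm : bounded_set Om.

Let leb_Om : (leb R n Om < +oo)%E. Proof. exact: leb_bounded_lty. Qed.

Lemma integrable_cst_bounded (a : R) : (leb R n).-integrable Om (EFin \o cst a).
Proof.
apply/integrableP; split; first by apply/measurable_EFinP.
by rewrite (integral_cst _ _ `|a|%:E)//= lte_mul_pinfty// ge0_fin_numE.
Qed.

(** On a set of finite measure; for finite [p = r] because
    [|f| <= (r - 1) + |f| ^ r]. *)
Lemma LpOn_integrable (p : \bar R) (f : 'rV[R]_n -> R) : (1 <= p)%E ->
  LpOn Om p f -> (leb R n).-integrable Om (EFin \o f).
Proof.
move=> p1 fp; have mf : measurable_fun Om f := Lfun_restrict_measurable mOm fp.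
have mf' : measurable_fun Om (fun x => `|f x|).
  exact: measurableT_comp mf.
case: p p1 fp => [r| |] // r1 fp; last first.
  have [M _ fM] := Lnorm_restrict_oo_ae mOm fp.
  apply/integrableP; split; first exact/measurable_EFinP.
  apply: (@le_lt_trans _ _ (\int[leb R n]_(x in Om) (`|M|)%:E)%E).
    apply: ae_ge0_le_integral => //.
    - exact/measurable_EFinP.
    - apply: filterS fM => x fM Ox; rewrite lee_fin (le_trans (fM Ox))//.
      exact: ler_norm.
  by rewrite integral_cst//= lte_mul_pinfty// ge0_fin_numE.
rewrite lee_fin in r1; have r0 : 0 < r by exact: lt_le_trans r1.
have [_ fN] := (Lfun_restrictP _ mOm _ _).1 fp.
have fr := (Lnorm_restrict_lty (leb R n) Om f r0).1 fN.
have fri : (leb R n).-integrable Om (EFin \o (fun x => `|f x| `^ r)).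
  apply: ge0_integrable_EFin => //; exact: measurable_powR_norm.
have := integrableD_EFin mOm (integrable_cst_bounded (r - 1)) fri.
apply: integrable_bounded_by => // x Ox /=.
have := powR_tangent r1 ler01 (normr_ge0 (f x)).
rewrite !powR1 !mulr1; apply: le_trans.
by rewrite ler_peMl.
Qed.

End bounded_domain.

Section radially_decreasing.
Context (R : realType) (n : nat) (h : 'rV[R]_n -> R).
Hypothesis h_L1 : h \in Lfun (leb R n) 1%E.
Hypothesis h_ge0 : forall x, 0 <= h x.
Hypothesis h_norm1 : ('N[leb R n]_1[EFin \o h])%E = 1%E.
Hypothesis h_decr : forall x y, enorm x <= enorm y -> h y <= h x.

Lemma radial_measurable : measurable_fun setT h.
Proof. exact: measurable_Lfun h_L1. Qed.

Lemma radial_integrable : (leb R n).-integrable setT (EFin \o h).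
Proof. exact/Lfun1_integrable. Qed.

Lemma radial_integral : (\int[leb R n]_x (h x)%:E = 1)%E.
Proof.
rewrite -h_norm1 Lnorm1; apply: eq_integral => x _.
by rewrite gee0_abs// lee_fin.
Qed.

Lemma radial_le0 x : h x <= h 0.
Proof. by apply: h_decr; rewrite enorm0 enorm_ge0. Qed.

Lemma radial_even x : h (- x) = h x.
Proof. by apply/eqP; rewrite eq_le !h_decr// enormN. Qed.

(** In positive dimension [h] cannot vanish off the origin, a null set, as its
    integral is 1; being radially decreasing, it is then bounded below on a
    ball. *)
Lemma radial_lower_bound : exists a rho : R, [/\ 0 < a, 0 < rho &
  forall x, enorm x < rho -> a <= h x].
Proof.
have [n0|n0] := posnP n.
  exists (h 0), 1; split=> // [|x _]; last first.
    apply: h_decr; rewrite enorm0 (le_trans (enorm_le_norm _))//.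
    have -> : n%:R = 0 :> R by rewrite n0.
    by rewrite mul0r.
  rewrite lt_def h_ge0 andbT; apply/eqP => h00.
  have := radial_integral; rewrite integral0_eq => [/eqP|x _].
    by rewrite eq_sym onee_eq0.
  by congr EFin; apply/eqP; rewrite eq_le h_ge0 andbT -h00 radial_le0.
have [[x x0 hx]|nox] := pselect (exists2 x, 0 < enorm x & 0 < h x).
  exists (h x), (enorm x); split=> // y yx.
  by apply: h_decr; exact: ltW.
exfalso.
have hout x : x != 0 -> h x = 0.
  move=> xN0; apply/eqP; rewrite eq_le h_ge0 andbT leNgt; apply/negP => hx.
  apply: nox; exists x => //.
  by rewrite (lt_le_trans _ (norm_le_enorm x))// normr_gt0.
have m0 : measurable [set (0 : 'rV[R]_n)].
  rewrite (_ : [set _] = [set x : 'rV[R]_n | forall i, [set 0] (x 0 i)]).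
    by apply: (@measurable_rV_box R n (fun=> [set 0])) => i; exact: measurable_set1.
  apply/seteqP; split => x /= => [-> i|xi]; first by rewrite mxE.
  by apply/rowP => i; rewrite mxE xi.
have null : leb R n [set 0] = 0%E.
  have := @leb_box R n 0 0 (fun i => lexx _).
  rewrite (_ : [set _ | _] = [set 0]).
    move=> ->; congr EFin; apply/eqP/prodf_eq0; exists (Ordinal n0) => //.
    by rewrite mxE subrr.
  apply/seteqP; split => x /= => [xi|-> i]; last by rewrite mxE in_itv/= lexx.
  apply/rowP => i; have := xi i; rewrite !mxE in_itv/= => xi0.
  by apply/eqP; rewrite eq_le andbC.
have := radial_integral.
rewrite (ge0_negligible_integral m0)//.
- rewrite integral0_eq => [/eqP|x [_ /eqP x0]]; first by rewrite eq_sym onee_eq0.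
  by rewrite hout.
- exact: measurable_int radial_integrable.
- by move=> x _; rewrite lee_fin.
Qed.

Section dilation.
Variables (eps : R) (eps_gt0 : 0 < eps).

Lemma h_eps_ge0 x : 0 <= h_eps h eps x.
Proof. by rewrite mulr_ge0// invr_ge0 exprn_ge0// ltW. Qed.

Lemma k_eps_ge0 x y : 0 <= k_eps h eps x y.
Proof. exact: h_eps_ge0. Qed.

Lemma k_eps_le x y : k_eps h eps x y <= eps ^- n * h 0.
Proof. by rewrite ler_wpM2l ?radial_le0// invr_ge0 exprn_ge0// ltW. Qed.

Lemma k_epsC x y : k_eps h eps x y = k_eps h eps y x.
Proof. by rewrite /k_eps /h_eps -opprB scalerN radial_even. Qed.

Lemma measurable_h_eps : measurable_fun setT (h_eps h eps).
Proof.
apply: measurable_funM => //; apply: (measurableT_comp radial_measurable).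
apply: (eq_measurable_fun (fun x : 'rV[R]_n => eps^-1 *: x + 0)).
  by move=> x _; rewrite addr0.
exact: measurable_affine_rV.
Qed.

Lemma measurable_k_eps :
  measurable_fun setT (fun xy : 'rV[R]_n * 'rV[R]_n => k_eps h eps xy.1 xy.2).
Proof. exact: (measurableT_comp measurable_h_eps (@measurable_rVB R n)). Qed.

(** Change of variables [u = (y - x) / eps]. *)
Lemma k_eps_change (g : 'rV[R]_n -> R) (x : 'rV[R]_n) :
  measurable_fun setT g -> (forall u, 0 <= g u) ->
  (\int[leb R n]_y (eps ^- n * g (eps^-1 *: (y - x)))%:E =
  \int[leb R n]_u (g u)%:E)%E.
Proof.
move=> mg g0.
have eV0 : eps^-1 != 0 by rewrite invr_eq0 gt_eqF.
under eq_integral do rewrite EFinM scalerBr -scalerN.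
have mg' : measurable_fun setT
    (fun y : 'rV[R]_n => (g (eps^-1 *: y + eps^-1 *: - x))%:E).
  apply/measurable_EFinP.
  exact: (measurableT_comp mg (measurable_affine_rV _ _)).
rewrite ge0_integralZl_EFin//; last 2 first.
- by move=> y _; rewrite lee_fin.
- by rewrite invr_ge0 exprn_ge0// ltW.
rewrite (ge0_integral_affine_rV _ (f := EFin \o g) eV0)/=; last 2 first.
- exact/measurable_EFinP.
- by move=> u; rewrite lee_fin.
rewrite muleA -EFinM gtr0_norm ?invr_gt0// exprVn invrK mulVf ?mul1e//.
by rewrite expf_neq0// gt_eqF.
Qed.

Lemma integral_k_eps x : (\int[leb R n]_y (k_eps h eps x y)%:E = 1)%E.
Proof.
by rewrite k_eps_change ?radial_integral//; exact: radial_measurable.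
Qed.

Variable (Om : set 'rV[R]_n).
Hypothesis mOm : measurable Om.

Lemma k_eps_le1 x : (\int[leb R n]_(y in Om) (k_eps h eps x y)%:E <= 1)%E.
Proof.
rewrite -(integral_k_eps x); apply: ge0_subset_integral => //.
- apply/measurable_EFinP.
  exact: (measurableT_comp measurable_k_eps (pair1_measurable x)).
- by move=> y _; rewrite lee_fin k_eps_ge0.
Qed.

(** Thickness enters here: the ball on which the dilated kernel is bounded
    below meets [Om] in a fixed proportion of its volume, which scales like
    [eps ^+ n] and so compensates the normalization of the kernel. *)
Lemma k_eps_ge (c e0 a rho : R) :
  0 < c -> 0 < a -> 0 < rho -> eps * rho < e0 ->
  (forall e x, 0 < e < e0 -> Om x ->
      (c%:E * leb R n (eball x e) < leb R n (eball x e `&` Om))%E) ->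
  (forall x, enorm x < rho -> a <= h x) ->
  forall x, Om x ->
  ((a * c * rho ^+ n)%:E * leb R n (eball 0%R 1%R) <=
    \int[leb R n]_(y in Om) (k_eps h eps x y)%:E)%E.
Proof.
move=> c0 a0 rho0 er thk hrho x Ox.
have er0 : 0 < eps * rho by rewrite mulr_gt0.
have mI : measurable (eball x (eps * rho) `&` Om).
  by apply: measurableI => //; exact: measurable_eball.
apply: (@le_trans _ _ (\int[leb R n]_(y in eball x (eps * rho) `&` Om)
    (k_eps h eps x y)%:E)%E); last first.
  apply: ge0_subset_integral => //.
  - apply/measurable_EFinP/measurable_funTS.
    exact: (measurableT_comp measurable_k_eps (pair1_measurable x)).
  - by move=> y _; rewrite lee_fin k_eps_ge0.
apply: (@le_trans _ _ (\int[leb R n]_(y in eball x (eps * rho) `&` Om)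
    (eps ^- n * a)%:E)%E); last first.
  apply: ge0_le_integral => //.
  - by move=> y _; rewrite lee_fin mulr_ge0 ?invr_ge0 ?exprn_ge0 ?ltW.
  - apply/measurable_EFinP/measurable_funTS.
    exact: (measurableT_comp measurable_k_eps (pair1_measurable x)).
  - move=> y [xy _]; rewrite lee_fin ler_wpM2l ?invr_ge0 ?exprn_ge0 ?(ltW eps_gt0)//.
    apply: hrho; rewrite enormZ gtr0_norm ?invr_gt0// mulrC ltr_pdivrMr//.
    by rewrite mulrC.
rewrite integral_cst//.
have erange : 0 < eps * rho < e0 by rewrite er0.
have thk' := ltW (thk _ _ erange Ox).
apply: (@le_trans _ _ ((eps ^- n * a)%:E * (c%:E * leb R n (eball x (eps * rho))))%E).
  rewrite (leb_eball_scale x)// !muleA -!EFinM le_eqVlt; apply/orP; left; apply/eqP.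
  congr (_%:E * _)%E; rewrite exprMn; field.
  by rewrite expf_neq0// gt_eqF.
apply: lee_wpmul2l; last exact: thk'.
by rewrite lee_fin mulr_ge0 ?invr_ge0 ?exprn_ge0 ?ltW.
Qed.

End dilation.
End radially_decreasing.

(** * The bistochastic operator *)

Section bistochastic_operator.
Context (R : realType) (n : nat) (Om : set 'rV[R]_n) (h : 'rV[R]_n -> R).
Hypothesis mOm : measurable Om.
Hypothesis h_L1 : h \in Lfun (leb R n) 1%E.
Hypothesis h_ge0 : forall x, 0 <= h x.
Hypothesis h_norm1 : ('N[leb R n]_1[EFin \o h])%E = 1%E.
Hypothesis h_decr : forall x y, enorm x <= enorm y -> h y <= h x.
Variables (eps c : R).
Hypothesis eps_gt0 : 0 < eps.
Hypothesis c_gt0 : 0 < c.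
Hypothesis k_gec : forall x, Om x ->
  (c%:E <= \int[leb R n]_(y in Om) (k_eps h eps x y)%:E)%E.

Let k := k_eps h eps.
Let B := eps ^- n * h 0.
Let mk : measurable_fun setT (fun xy : 'rV[R]_n * 'rV[R]_n => k xy.1 xy.2).
Proof. exact: (measurable_k_eps h_L1 eps). Qed.
Let k_ge0 : forall x y, 0 <= k x y.
Proof. exact: k_eps_ge0. Qed.
Let k_le : forall x y, k x y <= B.
Proof. exact: k_eps_le. Qed.
Let kC : forall x y, k x y = k y x.
Proof. exact: k_epsC. Qed.
Let k_le1 : forall x, (\int[leb R n]_(y in Om) (k x y)%:E <= 1)%E.
Proof. by move=> x; exact: k_eps_le1. Qed.

Notation kap := (bikernel (leb R n) Om k).

Let mkap : measurable_fun setT (fun xy : 'rV[R]_n * 'rV[R]_n => kap xy.1 xy.2).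
Proof. exact: measurable_bikernel. Qed.
Let kap_ge0 : forall x y, 0 <= kap x y.
Proof. exact: bikernel_ge0. Qed.
Let kap_le : forall x y, Om x -> Om y -> kap x y <= B / c ^+ 3.
Proof. exact: bikernel_le. Qed.
Let kapC : forall x y, Om x -> Om y -> kap x y = kap y x.
Proof. by move=> x y _ _; exact: bikernelC. Qed.
Let kap1 : forall x, Om x -> (\int[leb R n]_(y in Om) (kap x y)%:E = 1)%E.
Proof. exact: (integral_bikernel mOm mk k_ge0 k_le c_gt0 k_le1 k_gec). Qed.

Lemma Ptilde_markov f : Ptilde Om h eps f = markov_op (leb R n) Om kap f.
Proof. by []. Qed.

Lemma Ptilde_kernel_well_defined : kernel_well_defined Om h eps.
Proof.
split=> [x Ox|x y Ox Oy]; last first.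
  exact: (integrable_weight mOm mk k_ge0 k_le c_gt0 k_le1 k_gec Ox Oy).
split.
- exact: (integrable_k mOm mk k_ge0 k_le1).
- exact: (integrable_k_deg mOm mk k_ge0 c_gt0 k_le1 k_gec).
- exact: (deg_gt0 mOm mk k_ge0 c_gt0 k_le1 k_gec Ox).
- exact: (bideg_gt0 mOm mk k_ge0 c_gt0 k_le1 k_gec Ox).
Qed.

Lemma Ptilde_integrable (p : \bar R) f x : (1 <= p)%E -> LpOn Om p f -> Om x ->
  (leb R n).-integrable Om (fun y => (ptilde Om h eps x y * f y)%:E).
Proof.
move=> p1 fp Ox.
exact: (markov_op_integrable mOm mkap kap_ge0 kap_le kap1 p1 fp Ox).
Qed.

Lemma Ptilde_is_well_defined (p : \bar R) : (1 <= p)%E ->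
  Ptilde_well_defined Om h eps p.
Proof.
move=> p1; split; first exact: Ptilde_kernel_well_defined.
by move=> f fp x Ox; exact: (Ptilde_integrable p1 fp Ox).
Qed.

Lemma Ptilde_le (p : \bar R) f x : (1 <= p)%E -> LpOn Om p f ->
  (leb R n).-integrable Om (EFin \o f) -> Om x ->
  `|Ptilde Om h eps f x| <=
    eps ^- n * h 0 / c ^+ 3 * \int[leb R n]_(y in Om) `|f y|.
Proof.
move=> p1 fp fi Ox; have pfi := Ptilde_integrable p1 fp Ox.
have fni := integrable_norm fi.
apply: le_trans (le_normr_Rintegral mOm pfi) _; rewrite -RintegralZl//.
apply: le_Rintegral => //; first exact: (integrable_norm pfi).
  exact: integrableZl_EFin.
move=> y Oy; rewrite normrM (ger0_norm (kap_ge0 x y)) ler_wpM2r//.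
exact: kap_le.
Qed.

Lemma Ptilde_LpOn (p : \bar R) f : (1 <= p)%E -> LpOn Om p f ->
  LpOn Om p (Ptilde Om h eps f).
Proof. exact: (markov_op_Lfun mOm mkap kap_ge0 kap_le kapC kap1). Qed.

Lemma Ptilde_contraction (p : \bar R) f : (1 <= p)%E -> LpOn Om p f ->
  (LpnormOn Om p (Ptilde Om h eps f) <= LpnormOn Om p f)%E.
Proof. exact: (markov_op_Lnorm_le mOm mkap kap_ge0 kap_le kapC kap1). Qed.

Lemma Ptilde_linear (p : \bar R) (a : R) f g x : (1 <= p)%E ->
  LpOn Om p f -> LpOn Om p g -> Om x ->
  Ptilde Om h eps (fun y => a * f y + g y) x =
  a * Ptilde Om h eps f x + Ptilde Om h eps g x.
Proof.
exact: (markov_op_linear mOm mkap kap_ge0 kap_le kap1).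
Qed.

Lemma Ptilde_Lp_operator (p : \bar R) : (1 <= p)%E ->
  Lp_operator Om p (Ptilde Om h eps).
Proof.
move=> p1; split.
- by move=> f; exact: Ptilde_LpOn.
- move=> f g fp gp fg; apply: aeW => x _.
  rewrite !Ptilde_markov; apply: markov_op_ae_eq => //.
  + exact: Lfun_restrict_measurable fp.
  + exact: Lfun_restrict_measurable gp.
- move=> a f g fp gp; apply: aeW => x Ox.
  exact: (Ptilde_linear a p1 fp gp Ox).
Qed.

(** The outer half of the operator is a convolution, restricted to [Om] and
    divided by the degree, of a bounded function: all regularity of
    [Ptilde f] comes from this form. *)
Lemma Ptilde_quotient f : (leb R n).-integrable Om (EFin \o f) ->
  exists (g : 'rV[R]_n -> R) (G : R), [/\ measurable_fun setT g,
    forall z, Om z -> `|g z| <= G &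
    forall x, Om x -> Ptilde Om h eps f x =
      (d_eps Om h eps x)^-1 *
      (\int[leb R n]_(z in Om) (k_eps h eps x z * g z))].
Proof.
move=> fi; exists (half_op (leb R n) Om k f).
exists (B / c ^+ 2 * \int[leb R n]_(y in Om) `|f y|); split.
- exact: measurable_half_op.
- by move=> z Oz; exact: (half_op_bounded mOm mk k_ge0 k_le c_gt0 k_le1 k_gec fi Oz).
- by move=> x Ox; exact: (bikernel_factor mOm mk k_ge0 k_le c_gt0 k_le1 k_gec fi Ox).
Qed.

Lemma Ptilde_deviation f (psi : 'rV[R]_n -> 'rV[R]_n -> R) (E : R) x : (leb R n).-integrable Om (EFin \o f) ->
  measurable_fun setT (fun xy : 'rV[R]_n * 'rV[R]_n => psi xy.1 xy.2) ->
  (forall x y, 0 <= psi x y) ->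
  (forall x y z, Om x -> Om y -> Om z -> `|f y - f x| <= psi x z + psi z y) ->
  (forall x, Om x ->
    (\int[leb R n]_(y in Om) (k_eps h eps x y * psi x y)%:E <= E%:E)%E) ->
  Om x -> `|Ptilde Om h eps f x - f x| <= E / c + E / c ^+ 2.
Proof.
move=> fi mpsi psi0 fpsi Epsi Ox.
have mf : measurable_fun Om f by exact: measurable_integrable fi.
have kapi : (leb R n).-integrable Om (EFin \o kap x).
  exact: (integrable_kap mOm mkap kap_ge0 kap1 Ox).
have kfi : (leb R n).-integrable Om (EFin \o (fun y => kap x y * f y)).
  have bi := integrableZl_EFin (B / c ^+ 3) mOm (integrable_norm fi).
  apply: integrable_bounded_by bi => //.
    exact: measurable_kapM.
  by move=> y Oy; rewrite /= normrM ger0_norm// ler_wpM2r// kap_le.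
have kfx : (leb R n).-integrable Om (EFin \o (fun y => kap x y * f x)).
  apply: eq_integrable (integrableZl_EFin (f x) mOm kapi) => // y _ /=.
  by rewrite mulrC.
have fxE : f x = \int[leb R n]_(y in Om) (kap x y * f x).
  by rewrite RintegralZr// {1}/Rintegral kap1//= mul1r.
rewrite Ptilde_markov /markov_op {1}fxE -RintegralB//.
have dki : (leb R n).-integrable Om (EFin \o (fun y => kap x y * f y - kap x y * f x)).
  exact: integrableB_EFin.
rewrite (le_trans (le_normr_Rintegral mOm dki))// -lee_fin.
rewrite RintegralE//; last exact: integrable_norm.
have := bikernel_deviation mOm mk k_ge0 k_le c_gt0 k_le1 k_gec mf mpsi psi0 fpsi Epsi Ox.
apply: le_trans; rewrite le_eqVlt; apply/orP; left; apply/eqP.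
apply: eq_integral => y _.
by rewrite -mulrBr normrM (ger0_norm (kap_ge0 _ _)).
Qed.

End bistochastic_operator.

(** * Strong convergence *)

Section limits.
Context (R : realType).

Lemma ereal_cvg0_right (F : R -> \bar R) : (forall t, 0 <= F t)%E ->
  (forall eta, 0 < eta -> \forall t \near 0^'+, (F t <= eta%:E)%E) ->
  F t @[t --> 0^'+] --> 0%E.
Proof.
move=> F0 Fle; apply/fine_cvgP; split.
  by apply: filterS (Fle 1 ltr01) => t Ft; rewrite ge0_fin_numE// (le_lt_trans Ft)// ltry.
apply/cvgr0Pnorm_le => eta eta0; apply: filterS (Fle _ eta0) => t Ft /=.
rewrite ger0_norm ?fine_ge0// -lee_fin fineK//.
by rewrite ge0_fin_numE// (le_lt_trans Ft)// ltry.
Qed.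

Lemma powR_norm_cvg0 (u : nat -> R) (r : R) : 1 <= r ->
  u k @[k --> \oo] --> 0 -> `|u k| `^ r @[k --> \oo] --> 0.
Proof.
move=> r1 /cvgr0Pnorm_le u0; apply/cvgr0Pnorm_le => e e0.
have m0 : 0 < Num.min 1 e by rewrite lt_min ltr01.
apply: filterS (u0 _ m0) => k; rewrite le_min => /andP[uk1 uke].
rewrite ger0_norm ?powR_ge0//.
have [->|ukN0] := eqVneq (u k) 0.
  by rewrite normr0 powR0 ?ltW// gt_eqF// (lt_le_trans _ r1).
by apply: le_trans uke; rewrite ge1r_powR// normr_gt0 ukN0.
Qed.

Lemma continuous_rV_measurable n (f : 'rV[R]_n -> R) : continuous f ->
  measurable_fun setT f.
Proof.
move=> cf.
apply: (measurability _ (measurable_realfun.RGenOpens.measurableE R)).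
move=> _ [_ [a [b ->] <-]]; rewrite setTI; apply: open_rV_measurable.
by apply: open_comp; [move=> x _; exact: cf|exact: interval_open].
Qed.

Lemma lipschitz_continuous n (f : 'rV[R]_n -> R) (L : R) :
  (forall x y, `|f y - f x| <= L * enorm (y - x)) -> continuous f.
Proof.
move=> fL x; apply/(@cvgrPdist_le _ R^o _ (nbhs x)) => e e0.
pose K := `|L| * n%:R + 1.
have K0 : 0 < K by rewrite ltr_wpDl// mulr_ge0.
have eK0 : 0 < e / K by rewrite divr_gt0.
apply/nbhs_ballP; exists (e / K) => //= y xy.
rewrite distrC (le_trans (fL _ _))//.
have {}xy : `|y - x| < e / K by rewrite -ball_normE /= distrC in xy.
apply: (@le_trans _ _ (K * `|y - x|)); last by rewrite mulrC -ler_pdivlMr// ltW.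
apply: (@le_trans _ _ (`|L| * (n%:R * `|y - x|))).
  rewrite (le_trans (ler_wpM2r (enorm_ge0 _) (ler_norm L)))//.
  by rewrite ler_wpM2l// enorm_le_norm.
by rewrite mulrA ler_wpM2r// lerDl.
Qed.

End limits.

Section inf_convolution.
Context (R : realType) (n : nat) (U : set 'rV[R]_n) (L : R).
Hypothesis L0 : 0 <= L.

Let vals (x : 'rV[R]_n) : set R :=
  range (fun y => \1_U y + L * enorm (x - y)).

(** The largest [L]-Lipschitz minorant of the indicator of [U]. *)
Definition lipschitz_minorant (x : 'rV[R]_n) : R := inf (vals x).

Let vals_ge0 x : lbound (vals x) 0.
Proof.
by move=> _ [y _ <-]; rewrite addr_ge0 ?mulr_ge0 ?enorm_ge0// indicE ler0n.
Qed.

Let vals_has_inf x : has_inf (vals x).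
Proof.
split; first by exists (\1_U x + L * enorm (x - x)); exists x.
by exists 0; exact: vals_ge0.
Qed.

Lemma lipschitz_minorant_ge0 x : 0 <= lipschitz_minorant x.
Proof. by apply: lb_le_inf; [exact: (vals_has_inf x).1|exact: vals_ge0]. Qed.

Lemma lipschitz_minorant_le x : lipschitz_minorant x <= \1_U x.
Proof.
apply: ge_inf; first exact: (vals_has_inf x).2.
by exists x => //; rewrite subrr enorm0 mulr0 addr0.
Qed.

Lemma lipschitz_minorant_le1 x : lipschitz_minorant x <= 1.
Proof.
by rewrite (le_trans (lipschitz_minorant_le x))// indicE; case: (_ \in _).
Qed.

Let lip1 x y : lipschitz_minorant y <= lipschitz_minorant x + L * enorm (y - x).
Proof.
rewrite -lerBlDr; apply: lb_le_inf; first exact: (vals_has_inf x).1.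
move=> _ [z _ <-]; rewrite lerBlDr -addrA -mulrDr.
apply: le_trans (_ : \1_U z + L * enorm (y - z) <= _); last first.
  rewrite lerD2l ler_wpM2l//.
  have -> : y - z = (x - z) + (y - x) by rewrite [RHS]addrC addrA subrK.
  exact: enormD.
by apply: ge_inf; [exact: (vals_has_inf y).2|exists z].
Qed.

Lemma lipschitz_minorant_lipschitz x y :
  `|lipschitz_minorant y - lipschitz_minorant x| <=
    Num.min 1 (L * enorm (y - x)).
Proof.
have := lipschitz_minorant_ge0 x; have := lipschitz_minorant_ge0 y.
have := lipschitz_minorant_le1 x; have := lipschitz_minorant_le1 y.
move=> y1 x1 y0 x0; rewrite le_min !ler_norml.
have := lip1 x y; have := lip1 y x; rewrite -(enormN (x - y)) opprB => yx xy.
by apply/andP; split; apply/andP; split; lra.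
Qed.

(** Off the ball of radius [d] the penalty alone exceeds 1. *)
Lemma lipschitz_minorant_eq1 x (d : R) : 1 <= L * d ->
  (forall y, enorm (x - y) < d -> U y) -> lipschitz_minorant x = 1.
Proof.
move=> Ld dU; apply/eqP; rewrite eq_le lipschitz_minorant_le1/=.
apply: lb_le_inf; first exact: (vals_has_inf x).1.
move=> _ [y _ <-]; have [xy|xy] := ltP (enorm (x - y)) d.
  by rewrite indicE mem_set ?lerDl ?mulr_ge0 ?enorm_ge0//; exact: dU.
rewrite (le_trans Ld)// (le_trans (ler_wpM2l L0 xy))// lerDr indicE.
exact: ler0n.
Qed.

End inf_convolution.

Section strong_convergence.
Context (R : realType) (n : nat) (Om : set 'rV[R]_n) (h : 'rV[R]_n -> R).
Hypothesis mOm : measurable Om.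
Hypothesis bOm : bounded_set Om.
Hypothesis h_L1 : h \in Lfun (leb R n) 1%E.
Hypothesis h_ge0 : forall x, 0 <= h x.
Hypothesis h_norm1 : ('N[leb R n]_1[EFin \o h])%E = 1%E.
Hypothesis h_decr : forall x y, enorm x <= enorm y -> h y <= h x.
Variables (eps0 c : R).
Hypothesis eps0_gt0 : 0 < eps0.
Hypothesis c_gt0 : 0 < c.
Hypothesis k_gec : forall eps x, 0 < eps < eps0 -> Om x ->
  (c%:E <= \int[leb R n]_(y in Om) (k_eps h eps x y)%:E)%E.
Variable r : R.
Hypothesis r1 : 1 <= r.

Let r0 : 0 < r. Proof. exact: lt_le_trans r1. Qed.
Let r1E : (1 <= r%:E)%E. Proof. by rewrite lee_fin. Qed.

Notation N := (LpnormOn Om r%:E).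
Notation P := (Ptilde Om h).
Notation Lr := (LpOn Om r%:E).

Let leb_Om : (leb R n Om < +oo)%E. Proof. exact: leb_bounded_lty. Qed.

Let LrP f : Lr f <-> measurable_fun Om f /\
  (\int[leb R n]_(x in Om) (`|f x| `^ r)%:E < +oo)%E.
Proof.
split=> [/Lfun_restrictP[//|mf foo]|[mf foo]].
  by split => //; exact/(Lnorm_restrict_lty _ _ _ r0).
by apply/Lfun_restrictP => //; split => //; exact/Lnorm_restrict_lty.
Qed.

Lemma eq_LpnormOn f g : (forall x, Om x -> f x = g x) -> N f = N g.
Proof.
move=> fg; rewrite /LpnormOn; congr (Lnorm _ _ (EFin \o _)).
by apply/funext => x; rewrite /patch; case: ifPn => // /set_mem /fg.
Qed.

Lemma LpnormOn_add (f g : 'rV[R]_n -> R) : measurable_fun Om f -> measurable_fun Om g ->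
  (N (fun x => f x + g x)%R <= N f + N g)%E.
Proof.
move=> mf mg; rewrite /LpnormOn.
rewrite (_ : _ \_ Om = (f \_ Om \+ g \_ Om)%R); last first.
  apply/funext => x; rewrite /patch/=; case: ifPn => //.
  by rewrite addr0.
by apply: eminkowski => //; exact/(measurable_restrictT _ mOm).
Qed.

Lemma LpnormOn_scale (a : R) f : Lr f ->
  N (fun x => a * f x)%R = (`|a|%:E * N f)%E.
Proof.
move=> fL; rewrite /LpnormOn.
have := LnormZ (Lfun_Sub r1E fL) a; rewrite /= => <-.
congr (Lnorm _ _ (EFin \o _)).
by apply/funext => x; rewrite /patch/=; case: ifPn => // _; rewrite scaler0.
Qed.

Lemma LpOn_lin (a : R) f g : Lr f -> Lr g -> Lr (fun x => a * f x + g x).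
Proof.
move=> fL gL.
have [mf fo] := (Lfun_restrictP _ mOm _ _).1 fL.
have [mg go] := (Lfun_restrictP _ mOm _ _).1 gL.
have maf : measurable_fun Om (fun x => a * f x) by exact: measurable_funM.
apply/Lfun_restrictP => //; split; first exact: measurable_funD.
apply: (le_lt_trans (LpnormOn_add maf mg)).
by rewrite LpnormOn_scale// lte_add_pinfty// lte_mul_pinfty.
Qed.

Definition recovered (f : 'rV[R]_n -> R) := Lr f /\
  forall eta, 0 < eta -> \forall eps \near 0^'+,
    (N (P eps f \- f)%R <= eta%:E)%E.

Let near_range : \forall eps \near (0 : R)^'+, 0 < eps < eps0.
Proof.
near=> eps; apply/andP; split; near: eps; first exact: nbhs_right_gt.
exact: nbhs_right_lt.
Unshelve. all: end_near. Qed.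

Let P_Lr eps f : 0 < eps < eps0 -> Lr f -> Lr (P eps f).
Proof.
move=> er; have /andP[e0 _] := er.
exact: (Ptilde_LpOn mOm h_L1 h_ge0 h_norm1 h_decr e0 c_gt0 (fun x => k_gec er)).
Qed.

Let P_lin eps a f g x : 0 < eps < eps0 -> Lr f -> Lr g -> Om x ->
  P eps (fun y => a * f y + g y) x = a * P eps f x + P eps g x.
Proof.
move=> er; have /andP[e0 _] := er => fL gL.
exact: (Ptilde_linear mOm h_L1 h_ge0 h_norm1 h_decr e0 c_gt0 (fun x => k_gec er)
  a r1E fL gL).
Qed.

Let LrB f g : Lr f -> Lr g -> Lr (f \- g).
Proof.
move=> fL gL; rewrite (_ : f \- g = fun x => -1 * g x + f x).
  exact: LpOn_lin.
by apply/funext => x /=; rewrite mulN1r addrC.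
Qed.

Let Lr_measurable f : Lr f -> measurable_fun Om f.
Proof. by move=> /LrP[]. Qed.

Lemma recovered_lin (a : R) f g : recovered f -> recovered g ->
  recovered (fun x => a * f x + g x).
Proof.
move=> [fL fc] [gL gc]; split; first exact: LpOn_lin.
move=> eta eta0; pose e1 := eta / (2 * (`|a| + 1)).
have a1 : 0 < `|a| + 1 by rewrite ltr_wpDl.
have e10 : 0 < e1 by rewrite divr_gt0// mulr_gt0.
have e20 : 0 < eta / 2 by rewrite divr_gt0.
near=> eps.
have er : 0 < eps < eps0 by near: eps.
rewrite (@eq_LpnormOn _ (fun x => a * (P eps f \- f) x + (P eps g \- g) x)); last first.
  by move=> x Ox /=; rewrite P_lin//; ring.
have dfL : Lr (P eps f \- f) by apply: LrB => //; exact: P_Lr.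
have dgL : Lr (P eps g \- g) by apply: LrB => //; exact: P_Lr.
apply: le_trans (LpnormOn_add _ _) _.
- by apply: measurable_funM => //; exact: Lr_measurable.
- exact: Lr_measurable.
rewrite LpnormOn_scale//.
apply: (@le_trans _ _ (`|a|%:E * e1%:E + (eta / 2)%:E)%E).
  apply: leeD; last by near: eps; exact: gc.
  by apply: lee_wpmul2l; [rewrite lee_fin|near: eps; exact: fc].
rewrite -EFinM -EFinD lee_fin.
have q : `|a| / (`|a| + 1) <= 1 by rewrite ler_pdivrMr// mul1r lerDl.
have -> : `|a| * e1 = eta / 2 * (`|a| / (`|a| + 1)).
  by rewrite /e1; field; rewrite gt_eqF.
by have := ler_wpM2l (ltW e20) q; lra.
Unshelve. all: end_near. Qed.

(** The operators are contractions, so the functions they recover form a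
    closed set. *)
Lemma recovered_approx f : Lr f ->
  (forall eta, 0 < eta -> exists2 g, recovered g & (N (f \- g)%R <= eta%:E)%E) ->
  recovered f.
Proof.
move=> fL fapp; split=> // eta eta0.
have e30 : 0 < eta / 3 by rewrite divr_gt0.
have [g [gL gc] fg] := fapp _ e30.
near=> eps.
have er : 0 < eps < eps0 by near: eps.
have e0 : 0 < eps by case/andP: er.
have fgL : Lr (f \- g) by exact: LrB.
have gfL : Lr (fun x => - 1 * (f \- g) x).
  rewrite (_ : (fun _ => _) = (g \- f)); first exact: LrB.
  by apply/funext => x /=; rewrite mulN1r opprB.
have dgL : Lr (P eps g \- g) by apply: LrB => //; exact: P_Lr.
rewrite (@eq_LpnormOn _ (fun x => P eps (f \- g) x +
    ((P eps g \- g) x + (- 1 * (f \- g) x)))); last first.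
  move=> x Ox /=; have -> : f \- g = (fun y => -1 * g y + f y).
    by apply/funext => y /=; rewrite mulN1r addrC.
  by rewrite P_lin//; ring.
apply: le_trans (LpnormOn_add _ _) _.
- by apply: Lr_measurable; exact: P_Lr.
- by apply: measurable_funD; exact: Lr_measurable.
rewrite (_ : eta%:E = ((eta / 3)%:E + ((eta / 3)%:E + (eta / 3)%:E))%E); last first.
  by rewrite -!EFinD; congr EFin; field.
apply: leeD.
  apply: le_trans fg.
  exact: (Ptilde_contraction mOm h_L1 h_ge0 h_norm1 h_decr e0 c_gt0
    (fun x => k_gec er) r1E fgL).
apply: le_trans (LpnormOn_add _ _) _; [exact: Lr_measurable..|].
apply: leeD; first by near: eps; exact: gc.
by rewrite LpnormOn_scale// normrN1 mul1e.
Unshelve. all: end_near. Qed.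

Lemma recovered_dominated (f g : 'rV[R]_n -> R) (u : nat -> 'rV[R]_n -> R) :
  Lr g -> measurable_fun Om f -> (forall k, recovered (u k)) ->
  (forall k x, Om x -> `|u k x| <= g x) ->
  (forall x, Om x -> u k x @[k --> \oo] --> f x) -> recovered f.
Proof.
move=> gL mf ur ug uf.
have g0 x : Om x -> 0 <= g x by move=> Ox; exact: le_trans (ug 0%N _ Ox).
have fg x : Om x -> `|f x| <= g x.
  move=> Ox; have cn : `|u k x| @[k --> \oo] --> `|f x|.
    by apply: cvg_norm; exact: uf.
  rewrite -(cvg_lim _ cn)//; apply: limr_le; first exact: cvgP cn.
  by apply: nearW => k; exact: ug.
have [mg goo] := (LrP _).1 gL.
have mu k : measurable_fun Om (u k) by apply: Lr_measurable; exact: (ur k).1.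
have gi : (leb R n).-integrable Om (EFin \o (fun x => `|g x| `^ r)).
  by apply: ge0_integrable_EFin => //; exact: measurable_powR_norm.
have g2i := integrableZl_EFin (2 `^ r) mOm gi.
apply: recovered_approx.
  apply/LrP; split => //; apply: le_lt_trans goo.
  apply: ge0_le_integral_EFin => //; try exact: measurable_powR_norm.
  by move=> x Ox; rewrite ge0_le_powR ?(ltW r0)// (ger0_norm (g0 x Ox)) fg.
move=> eta eta0.
have := @dominated_cvg _ _ _ (leb R n) Om mOm
  (fun k x => (`|f x - u k x| `^ r)%:E) (fun=> 0%E)
  (fun x => (2 `^ r * `|g x| `^ r)%:E).
rewrite integral0 => dc.
have {dc} : (\int[leb R n]_(x in Om) (`|f x - u k x| `^ r)%:E)%E @[k --> \oo] --> 0%E.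
  apply: dc => //.
  - move=> k; apply/measurable_EFinP.
    by apply: (measurable_powR_norm r (f := fun x => f x - u k x)); exact: measurable_funB.
  - move=> x Ox; apply/fine_cvgP; split; first exact: nearW.
    apply: (powR_norm_cvg0 r1 (u := fun k => f x - u k x)).
    rewrite -(subrr (f x)); apply: cvgB; first exact: cvg_cst.
    exact: uf.
  - move=> k x Ox; rewrite gee0_abs ?lee_fin ?powR_ge0// -powRM//.
    rewrite ge0_le_powR ?(ltW r0)// (le_trans (ler_normB _ _))//.
    by rewrite (ger0_norm (g0 _ Ox)) mulr_natl mulr2n lerD ?fg ?ug.
move=> /fine_cvgP[fnum] /cvgr0Pnorm_le /(_ (eta `^ r)).
rewrite powR_gt0// => /(_ isT) small.
have [k [kfin ksmall]] : exists k,
    (\int[leb R n]_(x in Om) (`|f x - u k x| `^ r)%:E)%E \is a fin_num /\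
    `|fine (\int[leb R n]_(x in Om) (`|f x - u k x| `^ r)%:E)%E| <= eta `^ r.
  near \oo => k; exists k; split; near: k => //.
exists (u k) => //.
rewrite /LpnormOn Lnorm_restrict//.
rewrite (_ : eta%:E = ((eta `^ r)%:E `^ r^-1)%E); last first.
  by rewrite poweR_EFin -powRrM mulfV ?gt_eqF// powRr1// ltW.
apply: ge0_le_poweR; first by rewrite invr_ge0 ltW.
  by apply: integral_ge0 => x _; rewrite lee_fin powR_ge0.
rewrite -(fineK kfin) lee_fin; exact: le_trans (ler_norm _) ksmall.
Unshelve. all: end_near. Qed.

Let integrable_h_min (L eps : R) : 0 <= L ->
  measurable_fun setT (fun u => h u * Num.min 1 (L * enorm (eps *: u))).
Proof.
move=> L0; apply: measurable_funM; first exact: radial_measurable.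
apply: measurable_minr => //; apply: measurable_funM => //.
under eq_fun do rewrite enormZ.
by apply: measurable_funM => //; exact: measurable_enorm.
Qed.

(** The mass of [h] displaced by the dilation vanishes in the limit. *)
Lemma mean_displacement_small (L eta : R) : 0 <= L -> 0 < eta ->
  \forall eps \near 0^'+,
  (\int[leb R n]_u (h u * Num.min 1 (L * enorm (eps *: u)))%:E <= eta%:E)%E.
Proof.
move=> L0 eta0.
have hi := radial_integrable h_L1.
have := @dominated_cvg _ _ _ (leb R n) setT measurableT
  (fun k u => (h u * Num.min 1 (L * enorm (k.+1%:R^-1 *: u)))%:E) (fun=> 0%E)
  (EFin \o h).
rewrite integral0 => dc.
have min0 a u : 0 <= Num.min 1 (L * enorm (a *: u : 'rV[R]_n)).
  by rewrite le_min ler01 mulr_ge0 ?enorm_ge0.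
have {dc} : (\int[leb R n]_u (h u *
    Num.min 1 (L * enorm (k.+1%:R^-1 *: u)))%:E)%E @[k --> \oo] --> 0%E.
  apply: dc => //.
  - by move=> k; apply/measurable_EFinP; exact: integrable_h_min.
  - move=> u _; apply/fine_cvgP; split; first exact: nearW.
    rewrite /comp/=; apply/cvgr0Pnorm_le => e e0.
    pose K := h u * (L * enorm u) + 1.
    have K0 : 0 < K by rewrite ltr_wpDl// !mulr_ge0 ?enorm_ge0.
    have eK : 0 < e / K by rewrite divr_gt0.
    near=> k.
    have ke : k.+1%:R^-1 < e / K.
      by near: k; exact: near_infty_natSinv_lt (PosNum eK).
    rewrite ger0_norm ?mulr_ge0//.
    apply: (@le_trans _ _ (K * k.+1%:R^-1)); last by rewrite mulrC -ler_pdivlMr// ltW.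
    apply: (@le_trans _ _ (h u * (L * enorm (k.+1%:R^-1 *: u)))).
      by rewrite ler_wpM2l// ge_min lexx orbT.
    rewrite enormZ ger0_norm// /K mulrDl mul1r.
    rewrite (_ : h u * _ = h u * (L * enorm u) / k.+1%:R); last by ring.
    by rewrite lerDl.
  - move=> k u _; rewrite gee0_abs ?lee_fin ?mulr_ge0//.
    by rewrite /= ler_piMr// ge_min lexx.
move=> /fine_cvgP[fnum] /cvgr0Pnorm_le /(_ _ eta0) small.
have [k [kfin ksmall]] : exists k,
    (\int[leb R n]_u (h u * Num.min 1 (L * enorm (k.+1%:R^-1 *: u)))%:E)%E
      \is a fin_num /\
    `|fine (\int[leb R n]_u (h u *
       Num.min 1 (L * enorm (k.+1%:R^-1 *: u)))%:E)%E| <= eta.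
  near \oo => k; exists k; split; near: k => //.
near=> eps.
have e0 : 0 < eps by near: eps; exact: nbhs_right_gt.
have ek : eps <= k.+1%:R^-1 by near: eps; apply: nbhs_right_le.
apply: (@le_trans _ _ (\int[leb R n]_u
  (h u * Num.min 1 (L * enorm (k.+1%:R^-1 *: u)))%:E)%E).
  apply: ge0_le_integral_EFin => //; try exact: integrable_h_min.
  - by move=> u _; rewrite mulr_ge0.
  - move=> u _; rewrite ler_wpM2l// le_min ge_min lexx/= ge_min.
    rewrite !enormZ ler_wpM2l ?orbT// ler_wpM2r ?enorm_ge0//.
    by rewrite !ger0_norm// ltW.
by rewrite -(fineK kfin) lee_fin (le_trans (ler_norm _)).
Unshelve. all: end_near. Qed.

Let leb_Om_integrable a : (leb R n).-integrable Om (EFin \o cst a).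
Proof. exact: integrable_cst_bounded. Qed.

Let Lr_bounded (f : 'rV[R]_n -> R) (M : R) : measurable_fun Om f ->
  (forall x, Om x -> `|f x| <= M) -> Lr f.
Proof.
move=> mf fM; apply/LrP; split => //.
apply: (@le_lt_trans _ _ (\int[leb R n]_(x in Om) (`|M| `^ r)%:E)%E).
  apply: ge0_le_integral_EFin => //; first exact: measurable_powR_norm.
  move=> x Ox; rewrite ge0_le_powR ?(ltW r0)//.
  by rewrite (le_trans (fM _ Ox))// ler_norm.
by rewrite integral_cst// lte_mul_pinfty// lee_fin powR_ge0.
Qed.

Lemma LpnormOn_le_bound (f : 'rV[R]_n -> R) (M : R) : measurable_fun Om f ->
  0 <= M -> (forall x, Om x -> `|f x| <= M) ->
  (N f <= M%:E * (leb R n Om) `^ r^-1)%E.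
Proof.
move=> mf M0 fM; rewrite /LpnormOn Lnorm_restrict//.
rewrite (_ : M%:E = ((M `^ r)%:E `^ r^-1)%E); last first.
  by rewrite poweR_EFin -powRrM mulfV ?gt_eqF// powRr1.
rewrite -poweRM ?lee_fin ?powR_ge0//; apply: ge0_le_poweR.
- by rewrite invr_ge0 ltW.
- by apply: integral_ge0 => x _; rewrite lee_fin powR_ge0.
rewrite -integral_cst//; apply: ge0_le_integral_EFin => //.
  exact: measurable_powR_norm.
by move=> x Ox; rewrite ge0_le_powR ?(ltW r0)// fM.
Qed.

(** [Ptilde_deviation] for the cost [min(1, L |y - x|)], which is subadditive,
    dominates the oscillation of [f] and has a small mean under the kernel. *)
Lemma recovered_lipschitz (f : 'rV[R]_n -> R) (L : R) : 0 <= L ->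
  (forall x, `|f x| <= 1) ->
  (forall x y, `|f y - f x| <= Num.min 1 (L * enorm (y - x))) -> recovered f.
Proof.
move=> L0 f1 fL.
have mf : measurable_fun setT f.
  apply: continuous_rV_measurable; apply: (@lipschitz_continuous _ _ _ L) => x y.
  by rewrite (le_trans (fL _ _))// ge_min lexx orbT.
have mfO : measurable_fun Om f by exact: measurable_funTS.
have fLr : Lr f by apply: (@Lr_bounded _ 1).
split => // eta eta0.
pose V := fine (leb R n Om `^ r^-1)%E + 1.
have V0 : 0 < V by rewrite ltr_wpDl// fine_ge0// poweR_ge0.
have Vfin : (leb R n Om `^ r^-1)%E \is a fin_num.
  by rewrite ge0_fin_numE ?poweR_ge0// poweR_lty.
pose K := c^-1 + c ^- 2.
have K0 : 0 < K by rewrite addr_gt0 ?invr_gt0 ?exprn_gt0.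
have e1 : 0 < eta / (K * V) by rewrite divr_gt0// mulr_gt0.
near=> eps.
have er : 0 < eps < eps0 by near: eps.
have e0 : 0 < eps by case/andP: er.
have small : (\int[leb R n]_u (h u * Num.min 1 (L * enorm (eps *: u)))%:E <=
    (eta / (K * V))%:E)%E by near: eps; exact: mean_displacement_small.
pose psi (x y : 'rV[R]_n) := Num.min 1 (L * enorm (y - x)).
have mpsi : measurable_fun setT (fun xy : 'rV[R]_n * 'rV[R]_n => psi xy.1 xy.2).
  apply: measurable_minr => //; apply: measurable_funM => //.
  exact: (measurableT_comp (@measurable_enorm R n) (@measurable_rVB R n)).
have psi0 x y : 0 <= psi x y by rewrite le_min ler01 mulr_ge0 ?enorm_ge0.
have psiD x y z : `|f y - f x| <= psi x z + psi z y.
  rewrite (le_trans (fL _ _))// /psi.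
  have : L * enorm (y - x) <= L * enorm (z - x) + L * enorm (y - z).
    rewrite -mulrDr ler_wpM2l//.
    have -> : y - x = (z - x) + (y - z) by rewrite [RHS]addrC addrA subrK.
    exact: enormD.
  have := enorm_ge0 (z - x); have := enorm_ge0 (y - z).
  move=> /(mulr_ge0 L0) A0 /(mulr_ge0 L0) B0 AB.
  rewrite ge_min; have [|] := leP 1 (L * enorm (z - x)) => H1.
    by rewrite lerDl le_min ler01 A0.
  have [|] := leP 1 (L * enorm (y - z)) => H2; first by rewrite lerDr B0.
  by rewrite AB orbT.
have Epsi x : Om x -> (\int[leb R n]_(y in Om) (k_eps h eps x y * psi x y)%:E <=
    (eta / (K * V))%:E)%E.
  move=> Ox; apply: le_trans small.
  rewrite -(k_eps_change e0 x (g := fun u => h u * Num.min 1 (L * enorm (eps *: u)))).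
  - rewrite (_ : (\int[leb R n]_y _)%E =
      (\int[leb R n]_y (k_eps h eps x y * psi x y)%:E)%E); last first.
      apply: eq_integral => y _; rewrite scalerA divff ?gt_eqF// scale1r.
      by rewrite mulrA.
    apply: ge0_subset_integral => //.
      apply/measurable_EFinP/measurable_funM.
        exact: (measurableT_comp (measurable_k_eps h_L1 eps) (pair1_measurable x)).
      exact: (measurableT_comp mpsi (pair1_measurable x)).
    by move=> y _; rewrite lee_fin mulr_ge0// k_eps_ge0.
  - exact: integrable_h_min.
  - by move=> u; rewrite mulr_ge0// le_min ler01 mulr_ge0 ?enorm_ge0.
have fi : (leb R n).-integrable Om (EFin \o f).
  by apply: (@integrable_bounded_by _ _ _ _ _ _ (cst 1)).
have dev x : Om x -> `|(P eps f \- f) x| <= eta / V.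
  move=> Ox; have := @Ptilde_deviation R n Om h mOm h_L1 h_ge0 h_norm1 h_decr eps c
    e0 c_gt0 (fun x => k_gec er) f psi (eta / (K * V)) x fi mpsi psi0
    (fun x y z _ _ _ => psiD x y z) Epsi Ox.
  move=> /le_trans; apply; rewrite -mulrDr -/K.
  by rewrite (_ : eta / (K * V) * K = eta / V)//; field; rewrite !gt_eqF.
apply: le_trans (LpnormOn_le_bound _ _ dev) _.
- by apply: Lr_measurable; apply: LrB => //; exact: P_Lr.
- by rewrite divr_ge0// ltW.
rewrite -(fineK Vfin) -EFinM lee_fin -mulrA; apply: ler_piMr; first exact: ltW.
by rewrite mulrC ler_pdivrMr// mul1r lerDl.
Unshelve. all: end_near. Qed.

(** The indicator of an open set is the limit of its Lipschitz minorants. *)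
Lemma recovered_open (U : set 'rV[R]_n) : open U -> recovered (\1_U).
Proof.
move=> oU.
apply: (@recovered_dominated _ (cst 1) (fun k => lipschitz_minorant U k%:R)).
- by apply: (@Lr_bounded _ 1) => // x _; rewrite normr1.
- by apply: measurable_indic; exact: open_rV_measurable.
- move=> k; apply: (@recovered_lipschitz _ k%:R) => //.
    by move=> x; rewrite ger0_norm ?lipschitz_minorant_ge0 ?lipschitz_minorant_le1.
  by move=> x y; exact: lipschitz_minorant_lipschitz.
- by move=> k x _; rewrite ger0_norm ?lipschitz_minorant_ge0 ?lipschitz_minorant_le1.
- move=> x _; have [Ux|nUx] := pselect (U x); last first.
    rewrite (_ : (fun _ => _) = cst (\1_U x)); first exact: cvg_cst.
    apply/funext => k; apply/eqP.
    rewrite eq_le lipschitz_minorant_le// indicE memNset//=.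
    exact: lipschitz_minorant_ge0.
  have /nbhs_ballP[d /= d0 dU] : nbhs x U by exact: open_nbhs_nbhs.
  apply: cvg_near_cst; near=> k.
  rewrite indicE mem_set//=; apply: (@lipschitz_minorant_eq1 _ _ _ _ _ _ d) => //.
    rewrite -ler_pdivrMr// mul1r; near: k; exact: nbhs_infty_ger.
  move=> y xy; apply: dU; rewrite -ball_normE /ball_/=.
  exact: le_lt_trans (norm_le_enorm _) xy.
Unshelve. all: end_near. Qed.

Let recovered_cst : recovered (cst 1).
Proof.
have := recovered_open openT; congr recovered.
by apply/funext => x; rewrite indicT.
Qed.

Let recovered_sum (I : eqType) (s : seq I) (a : I -> R) (u : I -> 'rV[R]_n -> R) :
  (forall i, recovered (u i)) -> recovered (fun x => \sum_(i <- s) a i * u i x).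
Proof.
move=> ur; elim: s => [|i s IH].
  rewrite (_ : (fun _ => _) = fun x => -1 * cst 1 x + cst 1 x).
    exact: recovered_lin.
  by apply/funext => x; rewrite big_nil /= mulr1 addNr.
rewrite (_ : (fun _ => _) = fun x => a i * u i x + \sum_(j <- s) a j * u j x).
  exact: recovered_lin.
by apply/funext => x; rewrite big_cons.
Qed.

Let partial_sum (F : nat -> set 'rV[R]_n) k x : trivIset setT F ->
  \sum_(i <- iota 0 k) 1 * \1_(F i) x = \1_(\bigcup_(i < k) F i) x :> R.
Proof.
move=> tF; elim: k => [|k IH]; first by rewrite big_nil bigcup_mkord big_ord0 indic0.
rewrite -addn1 iotaD big_cat/= big_seq1 IH add0n addn1 mul1r.
have -> : \bigcup_(i < k.+1) F i = \bigcup_(i < k) F i `|` F k.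
  by rewrite !bigcup_mkord big_ord_recr.
rewrite !indicE in_setU.
have [xk|] := boolP (x \in F k); last by rewrite addr0 orbF.
rewrite orbT memNset ?add0r// => -[i /= ik Fi].
move/trivIsetP : tF => /(_ i k I I); rewrite ltn_eqF// => /(_ isT).
by apply/eqP/set0P; exists x; split => //; exact: set_mem.
Qed.

(** Dynkin's lemma, from the open sets to all Borel sets. *)
Lemma recovered_measurable (A : set 'rV[R]_n) : measurable A -> recovered (\1_A).
Proof.
rewrite {1}rV_measurableE.
apply: (@dynkin_induction _ _ _ (fun A => recovered (\1_A))).
- exact: rV_measurableE.
- by move=> U V oU oV; exact: openI.
- by rewrite (_ : \1_setT = cst 1)//; apply/funext => x; rewrite indicT.
- by move=> U; exact: recovered_open.
- move=> B mB rB; rewrite (_ : \1__ = fun x => -1 * \1_B x + cst 1 x).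
    exact: recovered_lin.
  apply/funext => x; rewrite !indicE/= in_setC.
  by case: (x \in B) => /=; rewrite ?mulr1 ?mulr0 ?addNr ?add0r.
- move=> F mF tF rF.
  apply: (@recovered_dominated _ (cst 1)
    (fun k x => \sum_(i <- iota 0 k) 1 * \1_(F i) x)).
  + by apply: (@Lr_bounded _ 1) => // x _; rewrite normr1.
  + by apply: measurable_indic; exact: bigcup_measurable.
  + by move=> k; exact: recovered_sum.
  + move=> k x _; rewrite partial_sum// indicE.
    by case: (_ \in _); rewrite ?normr1 ?normr0 ?ler01.
  + move=> x _; rewrite (_ : (fun _ => _) =
      (fun k => \1_(\bigcup_(i < k) F i) x : R)); last first.
      by apply/funext => k; rewrite partial_sum.
    have [[i _ Fix]|nF] := pselect ((\bigcup_k F k) x).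
      apply: cvg_near_cst; near=> k.
      rewrite !indicE !mem_set//; first by exists i.
      by exists i => //=; near: k; exact: nbhs_infty_gt.
    rewrite (_ : (fun _ => _) = cst (\1_(\bigcup_k F k) x)); first exact: cvg_cst.
    apply/funext => k; rewrite !indicE !memNset// => -[i _ Fi].
    by apply: nF; exists i.
Unshelve. all: end_near. Qed.

Import HBNNSimple.

Let recovered_sfun (s : {nnsfun 'rV[R]_n >-> R}) : recovered s.
Proof.
have -> : (s : 'rV[R]_n -> R) = fun x =>
    \sum_(y <- finmap.enum_fset (fset_set (range s))) y * \1_(s @^-1` [set y]) x.
  by apply/funext => x; rewrite {1}fimfunE fsbig_finite.
apply: (@recovered_sum _ _ id (fun y => \1_(s @^-1` [set y]))) => y.
exact: recovered_measurable.
Qed.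

Let recovered_ge0 (f : 'rV[R]_n -> R) : measurable_fun setT f ->
  (forall x, 0 <= f x) -> Lr f -> recovered f.
Proof.
move=> mf f0 fL.
have mfE : measurable_fun setT (EFin \o f) by exact/measurable_EFinP.
have f0E x : setT x -> (0 <= (EFin \o f) x)%E by rewrite lee_fin.
apply: (@recovered_dominated _ f (fun k => nnsfun_approx measurableT mfE k)) => //.
- exact: measurable_funTS.
- move=> k x _; rewrite ger0_norm// nnsfun_approxE -lee_fin.
  exact: (le_approx k f0E).
- move=> x _; under eq_fun do rewrite nnsfun_approxE.
  exact: (cvg_approx f0E I (ltry (f x))).
Qed.

(** Indicators generate the simple functions, and these approximate the
    positive and negative parts of [f] from below. *)
Theorem recovered_Lr (f : 'rV[R]_n -> R) : Lr f -> recovered f.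
Proof.
move=> fL; pose g := f \_ Om.
have mg : measurable_fun setT g by exact: measurable_Lfun fL.
have gOm x : Om x -> g x = f x by move=> Ox; rewrite /g /patch mem_set.
have gL : Lr g.
  rewrite /LpOn/= (_ : g \_ Om = g)//.
  by apply/funext => x; rewrite /g /patch; case: ifPn => // ->.
have Lr_le (u : 'rV[R]_n -> R) : measurable_fun setT u ->
    (forall x, `|u x| <= `|g x|) -> Lr u.
  move=> mu ug; have [_ goo] := (LrP _).1 gL.
  have muO : measurable_fun Om u by exact: measurable_funTS.
  apply/LrP; split => //; apply: le_lt_trans goo.
  apply: ge0_le_integral_EFin => //; try by [exact: measurable_powR_norm];
    try by apply: measurable_powR_norm; exact: measurable_funTS.
  by move=> x _; rewrite ge0_le_powR ?(ltW r0).
have rg : recovered g.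
  rewrite (_ : g = fun x => - 1 * Num.max (- g x) 0 + Num.max (g x) 0); last first.
    apply/funext => x; move: (g x) => a; have [a0|/ltW a0] := leP 0 a.
      by rewrite max_r ?oppr_le0// mulr0 add0r.
    by rewrite max_l ?oppr_ge0// mulN1r opprK addr0.
  apply: recovered_lin; apply: recovered_ge0.
  - by apply: measurable_maxr => //; exact: measurable_funN.
  - by move=> x; rewrite le_max lexx orbT.
  - apply: Lr_le; first by apply: measurable_maxr => //; exact: measurable_funN.
    by move=> x; rewrite -(normrN (g x)) /Num.max; case: ifP; rewrite ?normr0.
  - exact: measurable_maxr.
  - by move=> x; rewrite le_max lexx orbT.
  - apply: Lr_le; first exact: measurable_maxr.
    by move=> x; rewrite /Num.max; case: ifP; rewrite ?normr0.
split => // eta eta0; apply: filterS (rg.2 _ eta0) => eps.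
rewrite (@eq_LpnormOn _ (P eps f \- f)%R)// => x Ox /=.
by rewrite gOm// !Ptilde_markov [in RHS]markov_op_restrict.
Qed.

Lemma Ptilde_cvg (f : 'rV[R]_n -> R) : Lr f ->
  N (P eps f \- f)%R @[eps --> 0^'+] --> 0%E.
Proof.
move=> fL; apply: ereal_cvg0_right => [eps|]; first exact: Lnorm_ge0.
exact: (recovered_Lr fL).2.
Qed.

End strong_convergence.

(** * Continuity of convolutions *)

Section translation.
Context (R : realType) (n : nat) (h : 'rV[R]_n -> R).
Hypothesis h_L1 : h \in Lfun (leb R n) 1%E.
Hypothesis h_ge0 : forall x, 0 <= h x.
Hypothesis h_norm1 : ('N[leb R n]_1[EFin \o h])%E = 1%E.
Hypothesis h_decr : forall x y, enorm x <= enorm y -> h y <= h x.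

Let mh := radial_measurable h_L1.
Let hi := radial_integrable h_L1.

Let Rh1 : (\int[leb R n]_x h x)%R = 1.
Proof. by rewrite /Rintegral radial_integral. Qed.

Let dil_i a : a != 0 -> (leb R n).-integrable setT (EFin \o (fun x => h (a *: x))).
Proof.
move=> a0; have := integrable_affine_rV 0 a0 hi.
by under eq_fun do rewrite addr0.
Qed.

Let Rh_dil a : a != 0 -> (\int[leb R n]_x h (a *: x))%R = `|a| ^- n.
Proof.
move=> a0; have := Rintegral_affine_rV 0 a0 hi.
by under eq_Rintegral do rewrite addr0; rewrite Rh1 mulr1.
Qed.

Let shift_i w : (leb R n).-integrable setT (EFin \o (fun x => h (x - w))).
Proof.
have := integrable_affine_rV (- w) (oner_neq0 R) hi.
by under eq_fun do rewrite scale1r.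
Qed.

(** Away from a ball of radius [rho], translating by [w] moves the value of
    [h] no further than dilating by a factor [l] close to 1 does, and the mass
    of the difference of two dilates of a radially decreasing function is the
    difference of their masses. *)
Lemma translation_bound (w : 'rV[R]_n) (rho l : R) : 0 < rho -> 0 < l < 1 ->
  enorm w <= (1 - l) * rho ->
  \int[leb R n]_u `|h (u - w) - h u| <=
    l ^- n - l ^+ n + h 0 * fine (leb R n (eball 0%R rho)).
Proof.
move=> rho0 /andP[l0 l1] wl.
have lN0 : l != 0 by rewrite gt_eqF.
have lV0 : l^-1 != 0 by rewrite invr_eq0.
have mb := @measurable_eball R n 0 rho.
have ii : (leb R n).-integrable setT (EFin \o (fun u => \1_(eball 0%R rho) u : R)).
  apply: ge0_integrable_EFin => //; first exact: measurable_indic.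
  by rewrite integral_indic// setIT leb_eball_lty.
pose b u := h (l *: u) - h (l^-1 *: u) + h 0 * \1_(eball 0%R rho) u.
have bi1 : (leb R n).-integrable setT (EFin \o (fun u => h (l *: u) - h (l^-1 *: u))).
  by apply: integrableB_EFin => //; exact: dil_i.
have bi2 : (leb R n).-integrable setT (EFin \o (fun u => h 0 * (\1_(eball 0%R rho) u : R))).
  exact: integrableZl_EFin.
apply: (@le_trans _ _ (\int[leb R n]_u b u)).
  apply: le_Rintegral => //.
  - by apply: integrable_norm; exact: integrableB_EFin.
  - exact: integrableD_EFin.
  move=> u _; rewrite /b.
  have hl : h u <= h (l *: u).
    by apply: h_decr; rewrite enormZ gtr0_norm// ler_piMl ?enorm_ge0// ltW.
  have hV : h (l^-1 *: u) <= h u.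
    apply: h_decr; rewrite enormZ gtr0_norm ?invr_gt0// ler_peMl ?enorm_ge0//.
    by rewrite invf_ge1// ltW.
  have [ub|ub] := ltP (enorm (u - 0)) rho.
    rewrite indicE mem_set// mulr1.
    have := radial_le0 h_decr (u - w); have := radial_le0 h_decr u.
    have := h_ge0 (u - w); have := h_ge0 u.
    by move=> ? ? ? ?; rewrite ler_norml; apply/andP; split; lra.
  rewrite indicE memNset ?mulr0 ?addr0; last by rewrite /eball/= ltNge ub.
  rewrite subr0 in ub.
  have wu : enorm w <= (1 - l) * enorm u.
    by rewrite (le_trans wl)// ler_wpM2l// subr_ge0 ltW.
  have h1 : h (u - w) <= h (l *: u).
    apply: h_decr; rewrite enormZ gtr0_norm//.
    by have := enormD (u - w) w; rewrite subrK; lra.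
  have h2 : h (l^-1 *: u) <= h (u - w).
    apply: h_decr; rewrite enormZ gtr0_norm ?invr_gt0//.
    have := enormD u (- w); rewrite enormN => /le_trans; apply.
    apply: (@le_trans _ _ ((2 - l) * enorm u)); first by lra.
    rewrite ler_wpM2r ?enorm_ge0// -(ler_pM2r l0) mulVf//.
    by have := sqr_ge0 (1 - l); rewrite !expr2; lra.
  by rewrite ler_norml; apply/andP; split; lra.
rewrite RintegralD// RintegralB//; [|exact: dil_i..].
rewrite RintegralZl// !Rh_dil// !gtr0_norm ?invr_gt0// exprVn invrK lerD2l.
rewrite le_eqVlt; apply/orP; left; apply/eqP; congr (_ * _).
by rewrite /Rintegral integral_indic// setIT.
Qed.

Lemma translation_continuous (eta : R) : 0 < eta -> exists2 delta, 0 < delta &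
  forall w, enorm w < delta -> \int[leb R n]_u `|h (u - w) - h u| <= eta.
Proof.
(* In dimension 0 balls do not shrink, and there is nothing to translate. *)
move=> eta0; have [n0|n0] := posnP n.
  exists 1 => // w _.
  have w0 : w = 0 by apply/rowP => i; exfalso; move: (i); rewrite n0 => -[].
  rewrite w0; under eq_Rintegral do rewrite subr0 subrr normr0.
  by rewrite Rintegral_cst// mul0r ltW.
pose V := fine (leb R n (eball 0%R 1)).
have V0 : 0 <= V by rewrite fine_ge0.
have h00 : 0 <= h 0 by [].
pose K := 2 * (h 0 * V + 1).
have K0 : 0 < K by rewrite mulr_gt0// ltr_wpDl// mulr_ge0.
pose rho := Num.min 1 (eta / K).
have rho0 : 0 < rho by rewrite lt_min ltr01 divr_gt0.
have small_ball : h 0 * fine (leb R n (eball 0%R rho)) <= eta / 2.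
  rewrite leb_eball_scale// fineM//; last by rewrite ge0_fin_numE// leb_eball_lty.
  rewrite /= mulrCA.
  apply: (@le_trans _ _ (eta / K * (h 0 * V + 1))); last first.
    by rewrite le_eqVlt; apply/orP; left; apply/eqP; rewrite /K; field;
       rewrite gt_eqF// ltr_wpDl// mulr_ge0.
  apply: ler_pM; rewrite ?exprn_ge0 ?mulr_ge0 ?(ltW rho0)//; last by rewrite lerDl.
  apply: (@le_trans _ _ rho); last by rewrite /rho ge_min lexx orbT.
  rewrite -[leRHS]expr1 ler_wiXn2l ?(ltW rho0)//.
  by rewrite /rho ge_min lexx.
have [l l01 lsmall] : exists2 l : R, 0 < l < 1 & l ^- n - l ^+ n <= eta / 2.
  have e20 : 0 < eta / 2 by rewrite divr_gt0.
  have cl : (fun l : R => l ^- n - l ^+ n) @ (1 : R) --> (1 : R) ^- n - 1 ^+ n.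
    apply: cvgB; last exact: exprn_continuous.
    by apply: cvgV; [rewrite expr1n oner_eq0|exact: exprn_continuous].
  have cl' : (fun l : R => l ^- n - l ^+ n) @ (1 : R)^'- --> (0 : R).
    have -> : (0 : R) = 1 ^- n - 1 ^+ n by rewrite expr1n invr1 subrr.
    exact: cvg_at_left_filter.
  near (1 : R)^'- => l; exists l.
    apply/andP; split; near: l; [|exact: nbhs_left_lt].
    by apply: nbhs_left_gt.
  rewrite (le_trans (ler_norm _))//; near: l.
  by move/cvgr0Pnorm_le : cl' => /(_ _ e20).
exists ((1 - l) * rho).
  by case/andP: l01 => ? ?; rewrite mulr_gt0// subr_gt0.
move=> w wd; rewrite (le_trans (translation_bound rho0 l01 (ltW wd)))//.
by lra.
Unshelve. all: end_near. Qed.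

Variables (Om : set 'rV[R]_n) (eps : R).
Hypothesis mOm : measurable Om.
Hypothesis eps_gt0 : 0 < eps.

Lemma k_eps_conv_integrable (g : 'rV[R]_n -> R) (G : R) x :
  measurable_fun setT g -> (forall z, Om z -> `|g z| <= G) ->
  (leb R n).-integrable Om (EFin \o (fun z => k_eps h eps x z * g z)).
Proof.
move=> mg gG.
have ki : (leb R n).-integrable Om (EFin \o k_eps h eps x).
  apply: ge0_integrable_EFin => //.
  - apply: measurable_funTS.
    exact: (measurableT_comp (measurable_k_eps h_L1 eps) (pair1_measurable x)).
  - by move=> z _; exact: k_eps_ge0.
  - by apply: le_lt_trans (ltry 1); exact: k_eps_le1.
have := integrableZl_EFin G mOm ki; apply: integrable_bounded_by => //.
  apply: measurable_funM; apply: measurable_funTS => //.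
  exact: (measurableT_comp (measurable_k_eps h_L1 eps) (pair1_measurable x)).
move=> z Oz; rewrite normrM (ger0_norm (k_eps_ge0 _ _ _ _))// mulrC.
by rewrite ler_wpM2r ?gG// k_eps_ge0.
Qed.

(** Two averages of [g] differ by at most the bound of [g] times the distance
    in [L^1] of two translates of [h]. *)
Lemma k_eps_conv_continuous (g : 'rV[R]_n -> R) (G : R) :
  measurable_fun setT g -> (forall z, Om z -> `|g z| <= G) ->
  continuous (fun x => \int[leb R n]_(z in Om) (k_eps h eps x z * g z)).
Proof.
move=> mg gG x; apply/(@cvgrPdist_le _ R^o _ (nbhs x)) => eta eta0.
have G1 : 0 < `|G| + 1 by rewrite ltr_wpDl.
have [delta d0 trans] := translation_continuous (divr_gt0 eta0 G1).
(* The factor [n + 1] passes from the sup norm to the Euclidean norm. *)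
have dn0 : 0 < eps * delta / n.+1%:R by rewrite !(divr_gt0, mulr_gt0).
apply/nbhs_ballP; exists (eps * delta / n.+1%:R) => //= y.
rewrite -ball_normE /= => xy.
pose w := eps^-1 *: (y - x).
have wd : enorm w < delta.
  rewrite enormZ gtr0_norm ?invr_gt0// mulrC ltr_pdivrMr// mulrC.
  rewrite (le_lt_trans (enorm_le_norm _))// distrC.
  rewrite (@le_lt_trans _ _ (n.+1%:R * `|x - y|))//.
    by rewrite ler_wpM2r// ler_nat.
  by rewrite -ltr_pdivlMl// [ltRHS]mulrC.
have kd z : k_eps h eps y z - k_eps h eps x z =
    eps ^- n * (h (eps^-1 *: (z - x) - w) - h (eps^-1 *: (z - x))).
  rewrite /k_eps /h_eps -mulrBr /w -scalerBr.
  by congr (_ * (h (_ *: _) - _)); rewrite opprB addrA subrK.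
have iy := k_eps_conv_integrable y mg gG.
have ix := k_eps_conv_integrable x mg gG.
rewrite distrC -RintegralB//.
have di := integrableB_EFin mOm iy ix.
rewrite (le_trans (le_normr_Rintegral mOm di))//.
pose phi (u : 'rV[R]_n) : R := `|h (u - w) - h u|.
have phii : (leb R n).-integrable setT (EFin \o phi).
  by apply: integrable_norm; exact: integrableB_EFin.
have mphi : measurable_fun setT phi by exact: measurable_integrable phii.
have := trans w wd; rewrite ler_pdivlMr//; apply: le_trans.
rewrite -lee_fin RintegralE//; last exact: integrable_norm.
rewrite EFinM RintegralE// muleC.
rewrite -(k_eps_change eps_gt0 x mphi (fun u => normr_ge0 _)).
have mphi' : measurable_fun setT (fun z : 'rV[R]_n => eps ^- n * phi (eps^-1 *: (z - x))).
  apply: measurable_funM => //; apply: (measurableT_comp mphi).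
  apply: (eq_measurable_fun (fun z : 'rV[R]_n => eps^-1 *: z + eps^-1 *: - x)).
    by move=> z _; rewrite scalerBr scalerN.
  exact: measurable_affine_rV.
have phi0 z : 0 <= eps ^- n * phi (eps^-1 *: (z - x)).
  by apply: mulr_ge0; [rewrite invr_ge0 exprn_ge0// ltW|exact: normr_ge0].
rewrite -ge0_integralZl_EFin//; last 2 first.
- by move=> z _; rewrite lee_fin.
- exact/measurable_EFinP.
apply: (@le_trans _ _ (\int[leb R n]_(z in Om)
    ((`|G| + 1)%:E * (eps ^- n * phi (eps^-1 *: (z - x)))%:E))%E); last first.
  apply: ge0_subset_integral => //.
  - by apply: measurable_funeM; exact/measurable_EFinP.
  - by move=> z _; rewrite mule_ge0 ?lee_fin// ltW.
apply: ge0_le_integral => //.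
- exact: (measurable_int _ (integrable_norm di)).
- by apply: measurable_funeM; exact/measurable_EFinP/measurable_funTS.
move=> z Oz; rewrite -EFinM lee_fin -mulrBl normrM kd normrM.
rewrite (ger0_norm (_ : 0 <= eps ^- n)); last by rewrite invr_ge0 exprn_ge0// ltW.
rewrite mulrC ler_wpM2r ?phi0// (le_trans (gG _ Oz))//.
by rewrite (le_trans (ler_norm _))// lerDl.
Qed.

End translation.

(** * Sums, products and inverses of [C^r] functions *)

Section Cr_algebra.
Context (R : realType) (n : nat) (Om : set 'rV[R]_n).
Hypothesis oOm : open Om.
Implicit Types f g : 'rV[R]_n -> R.

Lemma within_continuous_at f :
  {within Om, continuous f} <-> (forall x, Om x -> {for x, continuous f}).
Proof.
rewrite continuous_open_subspace//; split=> [cf x Ox|cf x].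
  by apply: cf; rewrite inE.
by rewrite inE => Ox; exact: cf.
Qed.

Lemma within_continuous_cst (a : R) : {within Om, continuous (fun=> a : R)}.
Proof.
by apply: (within_continuous_at (fun=> a)).2 => x _; exact: cst_continuous.
Qed.

Lemma within_continuousD f g : {within Om, continuous f} ->
  {within Om, continuous g} -> {within Om, continuous (fun x => f x + g x)}.
Proof.
move=> /within_continuous_at cf /within_continuous_at cg.
apply: (within_continuous_at (fun x => f x + g x)).2 => x Ox.
exact: (continuousD (cf x Ox) (cg x Ox)).
Qed.

Lemma within_continuousM f g : {within Om, continuous f} ->
  {within Om, continuous g} -> {within Om, continuous (fun x => f x * g x)}.
Proof.
move=> /within_continuous_at cf /within_continuous_at cg.
apply: (within_continuous_at (fun x => f x * g x)).2 => x Ox.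
exact: (continuousM (cf x Ox) (cg x Ox)).
Qed.

Lemma within_continuousV f : (forall x, Om x -> f x != 0) ->
  {within Om, continuous f} -> {within Om, continuous (fun x => (f x)^-1)}.
Proof.
move=> f0 /within_continuous_at cf.
apply: (within_continuous_at (fun x => (f x)^-1)).2 => x Ox.
exact: (continuousV (f0 x Ox) (cf x Ox)).
Qed.

Lemma near_eq_on f g x : (forall y, Om y -> f y = g y) -> Om x ->
  \near x, f x = g x.
Proof.
move=> fg Ox; have : nbhs x Om by exact: open_nbhs_nbhs.
by apply: filterS => y /fg.
Qed.

Lemma eq_within_continuous f g : (forall y, Om y -> f y = g y) ->
  {within Om, continuous f} -> {within Om, continuous g}.
Proof.
by move=> fg; apply: subspace_eq_continuous => y; rewrite inE => /fg.
Qed.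

Lemma eq_Cr r f g : (forall y, Om y -> f y = g y) -> Cr r Om f -> Cr r Om g.
Proof.
elim: r f g => [|r IH] f g fg /=; first exact: eq_within_continuous.
move=> [cf df]; split; first exact: eq_within_continuous cf.
move=> i; have [di Dr] := df i; split=> [x Ox|].
  exact: (near_eq_derivable (near_eq_on fg Ox) (di x Ox)).
apply: IH Dr => x Ox; exact: (near_eq_derive _ (near_eq_on fg Ox)).
Qed.

Lemma CrS_le r f : Cr r.+1 Om f -> Cr r Om f.
Proof.
elim: r f => [|r IH] f; first by case.
move=> [cf df]; split=> // i; have [di Dr] := df i; split=> //.
exact: IH.
Qed.

Lemma Cr_cst r (a : R) : Cr r Om (fun=> a).
Proof.
elim: r a => [|r IH] a; first exact: within_continuous_cst.
split; first exact: within_continuous_cst.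
move=> i; split=> [x _|]; first exact: derivable_cst.
by apply: eq_Cr (IH 0) => x _; rewrite derive_cst.
Qed.

Lemma CrD r f g : Cr r Om f -> Cr r Om g -> Cr r Om (fun x => f x + g x).
Proof.
elim: r f g => [|r IH] f g; first exact: within_continuousD.
move=> [cf df] [cg dg]; split; first exact: within_continuousD.
move=> i; have [di Di] := df i; have [ei Ei] := dg i; split=> [x Ox|].
  exact: (derivableD (di x Ox) (ei x Ox)).
apply: eq_Cr (IH _ _ Di Ei) => x Ox.
by rewrite -(deriveD (di x Ox) (ei x Ox)).
Qed.

Lemma CrM r f g : Cr r Om f -> Cr r Om g -> Cr r Om (fun x => f x * g x).
Proof.
elim: r f g => [|r IH] f g; first exact: within_continuousM.
move=> fr gr; have fr' := CrS_le fr; have gr' := CrS_le gr.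
move: fr gr => [cf df] [cg dg]; split; first exact: within_continuousM.
move=> i; have [di Di] := df i; have [ei Ei] := dg i; split=> [x Ox|].
  exact: (derivableM (di x Ox) (ei x Ox)).
apply: eq_Cr (CrD (IH _ _ fr' Ei) (IH _ _ gr' Di)) => x Ox.
by rewrite -[RHS]/('D_(delta_mx 0 i) (f * g) x) (deriveM (di x Ox) (ei x Ox)).
Qed.

Lemma CrV r f : (forall x, Om x -> f x != 0) -> Cr r Om f ->
  Cr r Om (fun x => (f x)^-1).
Proof.
elim: r f => [|r IH] f f0; first exact: within_continuousV.
move=> fr; have fr' := CrS_le fr.
move: fr => [cf df]; split; first exact: within_continuousV.
move=> i; have [di Di] := df i; split=> [x Ox|].
  exact: (derivableV (f0 x Ox) (di x Ox)).
have fV := IH f f0 fr'.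
apply: eq_Cr (CrM (Cr_cst r (-1)) (CrM (CrM fV fV) Di)) => x Ox.
by rewrite (deriveV (f0 x Ox) (di x Ox)) mulN1r scaleNr expr2 invfM.
Qed.

End Cr_algebra.

(** * The tent and its Fourier transform *)

Section tent.
Context (R : realType).
Notation mu := (@lebesgue_measure R).
Local Notation mR := (measurableTypeR R).

Definition tent (t : mR) : R := Num.max 0 (1 - `|t|).

Lemma tent_ge0 t : 0 <= tent t. Proof. by rewrite le_max lexx. Qed.

Lemma tent_le1 t : tent t <= 1.
Proof. by rewrite ge_max ler01 lerBlDr lerDl normr_ge0. Qed.

Lemma tent0 : tent 0 = 1. Proof. by rewrite /tent normr0 subr0 max_r. Qed.

Lemma continuous_tent : continuous (tent : R -> R).
Proof.
move=> t; apply: (@continuous_max _ _ (cst 0) (fun t => 1 - `|t|) t).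
  exact: cst_continuous.
by apply: continuousB; [exact: cst_continuous|exact: norm_continuous].
Qed.

Lemma measurable_tent : measurable_fun [set: mR] tent.
Proof. exact: continuous_measurable_fun continuous_tent. Qed.

Lemma tent_outside t : 1 <= `|t| -> tent t = 0.
Proof. by move=> t1; rewrite /tent max_l// subr_le0. Qed.

(** The tent being the convolution square of an indicator, this Fourier
    transform is a square, hence nonnegative. *)
Definition tent_hat (x : R) : R := \int[mu]_t (tent t * cos (t * x)).

Let wave (x al t : R) := tent t * cos (t * x + al).

Let continuous_cos_affine x al : continuous (fun t : R => cos (t * x + al)).
Proof.
by move=> t; apply/differentiable_continuous/derivable1_diffP; exact: ex_derive.
Qed.

Let continuous_wave x al : continuous (wave x al).
Proof.
move=> t; exact: (continuousM (@continuous_tent t) (@continuous_cos_affine x al t)).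
Qed.

Let wave_restrict x al : wave x al = wave x al \_ `[-1, 1].
Proof.
apply/funext => t; rewrite patchE; case: ifPn => //.
rewrite notin_setE/= in_itv/= => t1; rewrite /wave tent_outside ?mul0r//.
by rewrite leNgt; apply: contra_notN t1 => /ltW; rewrite ler_norml.
Qed.

Lemma integrable_wave x al : mu.-integrable setT (EFin \o (wave x al)).
Proof.
rewrite wave_restrict -restrict_EFin.
apply: (integrable_mkcond (mu := mu) (EFin \o wave x al) (measurable_itv `[-1, 1])).1.
apply: continuous_compact_integrable; first exact: segment_compact.
by apply: continuous_subspaceT => t; exact: continuous_wave.
Qed.

Let integral_wave_itv x al :
  \int[mu]_t wave x al t = \int[mu]_(t in `[-1, 1]) wave x al t.
Proof. by rewrite [LHS]/Rintegral {1}wave_restrict [RHS]Rintegral_mkcond. Qed.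

Let iw x al (A : set mR) : measurable A -> mu.-integrable A (EFin \o wave x al).
Proof. by move=> mA; apply: (integrableS _ _ _ (integrable_wave x al)). Qed.

Let integral_wave_split x al : \int[mu]_t wave x al t =
  \int[mu]_(t in `[-1, 0]) ((1 - (-1) * t) * cos (t * x + al)) +
  \int[mu]_(t in `[0, 1]) ((1 - 1 * t) * cos (t * x + al)).
Proof.
rewrite integral_wave_itv.
have -> : [set` `[-1, 1]] = [set` `[-1, (0:R)[] `|` [set` `[0, (1:R)]].
  by rewrite -itv_bndbnd_setU ?bnd_simp// lerN10.
rewrite Rintegral_setU//; last 2 first.
- by apply: iw; exact: measurableU.
- apply/disj_set2P; rewrite -subset0 => t /=; rewrite !in_itv/=.
  by move=> [/andP[_ t0] /andP[t0' _]]; move: t0; rewrite ltNge t0'.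
rewrite Rintegral_itv_bndo_bndc; last exact: iw.
congr (_ + _); apply: eq_Rintegral => t; rewrite inE/= in_itv/= => /andP[t0 t1].
- by rewrite /wave/tent ler0_norm// mulN1r max_r// opprK -lerBlDl sub0r.
- by rewrite /wave/tent ger0_norm// mul1r max_r// subr_ge0.
Qed.

Let ramp_integral (s x al a b : R) : x != 0 -> a < b ->
  \int[mu]_(t in `[a, b]) ((1 - s * t) * cos (t * x + al)) =
  ((1 - s * b) * sin (b * x + al) / x - s * cos (b * x + al) / x ^+ 2) -
  ((1 - s * a) * sin (a * x + al) / x - s * cos (a * x + al) / x ^+ 2).
Proof.
move=> x0 ab.
(* The antiderivative obtained by integrating by parts. *)
pose F t := (1 - s * t) * sin (t * x + al) / x - s * cos (t * x + al) / x ^+ 2.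
pose f t := (1 - s * t) * cos (t * x + al).
have dF t : is_derive (t : R) (1 : R) F (f t).
  rewrite /F /f; apply: is_derive_eq.
  rewrite /GRing.scale/=; field.
  exact: x0.
have cf : continuous f.
  move=> t; rewrite /f.
  by apply/differentiable_continuous/derivable1_diffP; exact: ex_derive.
have cF t : {for t, continuous F}.
  by apply/differentiable_continuous/derivable1_diffP; apply: ex_derive.
rewrite /Rintegral (@continuous_FTC2 _ f F)//.
- by apply: continuous_subspaceT.
- split=> [t _||]; first exact: ex_derive.
  + by apply: cvg_at_right_filter; exact: cF.
  + by apply: cvg_at_left_filter; exact: cF.
- by move=> t _; rewrite derive1E; exact: derive_val.
Qed.

Lemma integral_tent_cos (x al : R) : x != 0 ->
  \int[mu]_t (tent t * cos (t * x + al)) =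
  cos al * (2 * (1 - cos x) / x ^+ 2).
Proof.
move=> x0; rewrite integral_wave_split.
rewrite !ramp_integral ?ltr01// ?oppr_lt0//.
rewrite !(mul1r, mul0r, add0r, mulr0, subr0, mulN1r, opprK, subrr).
rewrite !cosD cosN sinN; field.
exact: x0.
Qed.

Lemma tent_hatE x : x != 0 -> tent_hat x = 2 * (1 - cos x) / x ^+ 2.
Proof.
move=> x0; rewrite -[RHS]mul1r -[X in X * _](@cos0 R) -integral_tent_cos//.
by apply: eq_Rintegral => t _; rewrite addr0.
Qed.

Lemma integral_tent_wave x al :
  \int[mu]_t (tent t * cos (t * x + al)) = cos al * tent_hat x.
Proof.
have [->|x0] := eqVneq x 0; last by rewrite integral_tent_cos// tent_hatE.
rewrite /tent_hat -RintegralZl//; last first.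
  have := integrable_wave 0 0; apply: eq_integrable => // t _.
  by rewrite /wave /= addr0.
by apply: eq_Rintegral => t _; rewrite mulr0 add0r cos0 mulr1 mulrC.
Qed.

Lemma tent_hat_ge0 x : 0 <= tent_hat x.
Proof.
have [->|x0] := eqVneq x 0.
  by apply: Rintegral_ge0 => t _; rewrite mulr0 cos0 mulr1 tent_ge0.
by rewrite tent_hatE// divr_ge0 ?sqr_ge0// mulr_ge0// subr_ge0 cos_le1.
Qed.

Lemma tent_hat_gt0 x : 0 < x < 1 -> 0 < tent_hat x.
Proof.
move=> /andP[x0 x1]; rewrite tent_hatE ?gt_eqF//.
rewrite divr_gt0 ?exprn_gt0// mulr_gt0// subr_gt0 lt_neqAle cos_le1 andbT.
apply/eqP => cx; have := cos2Dsin2 x; rewrite cx expr1n => /eqP.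
rewrite -subr_eq0 addrAC subrr add0r sqrf_eq0 gt_eqF// sin_gt0_pi//.
by rewrite x0 (lt_trans x1)// (lt_le_trans _ (pi_ge2 _))// ltr1n.
Qed.

(** Near the origin because the tent has finite mass, far from it by the
    closed form, which decays like [x ^- 2]. *)
Lemma tent_hat_le x : tent_hat x <= 8 / (1 + x ^+ 2).
Proof.
have d0 : 0 < 1 + x ^+ 2 by rewrite ltr_pwDl// sqr_ge0.
have [x1|x1] := leP (x ^+ 2) 1; last first.
  have x0 : x != 0 by rewrite -sqrf_eq0 gt_eqF// (lt_trans ltr01).
  rewrite tent_hatE// ler_pdivlMr// mulrAC ler_pdivrMr ?(lt_trans ltr01)//.
  have := cos_geN1 x; nra.
apply: (@le_trans _ _ 4); last by rewrite ler_pdivlMr//; lra.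
have -> : tent_hat x = \int[mu]_t wave x 0 t.
  by apply: eq_Rintegral => t _; rewrite /wave addr0.
rewrite integral_wave_itv.
apply: (@le_trans _ _ (\int[mu]_(t in `[-1, 1]) 1)); last first.
  rewrite Rintegral_cst; last exact: measurable_itv.
  rewrite mul1r [X in fine X]lebesgue_measure_itv/= lte_fin ifT/=; lra.
apply: le_Rintegral => //.
- exact: iw.
- by apply: continuous_compact_integrable; [exact: segment_compact|
    apply: continuous_subspaceT; exact: cst_continuous].
move=> t _; rewrite /wave.
by rewrite (le_trans (ler_wpM2l (tent_ge0 t) (cos_le1 _)))// mulr1 tent_le1.
Qed.

End tent.

Section tent_product.
Context (R : realType).
Notation mu := (@lebesgue_measure R).
Local Notation mR := (measurableTypeR R).

Lemma integral_lebS n (f : 'rV[R]_n.+1 -> R) :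
  (leb R n.+1).-integrable setT (EFin \o f) ->
  (\int[leb R n.+1]_x (f x)%:E =
   \int[lebesgue_measure]_t \int[leb R n]_x (f (cons_rV (t, x)))%:E)%E.
Proof.
move=> fi; have mc := @measurable_cons_rV R n.
have fci := integrable_lebS fi.
have := integral_pushforward mc (measurable_int _ fi) _ measurableT.
rewrite preimage_setT => /(_ _ fci) pE.
transitivity (\int[lebesgue_measure \x leb R n]_z
    ((EFin \o f) \o @cons_rV R n) z)%E.
  by rewrite -pE; exact: eq_measure_integral.
by rewrite -(integral12_prod_meas1 fci).
Qed.

Lemma integrable_tent : mu.-integrable [set: mR] (EFin \o @tent R).
Proof.
have := integrable_wave (R := R) 0 0; apply: eq_integrable => // t _ /=.
by rewrite mulr0 addr0 cos0 mulr1.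
Qed.

Lemma measurable_tent_hat : measurable_fun [set: mR] (@tent_hat R).
Proof.
apply: (@measurable_Rintegral_section _ _ mR mR R mu _ measurableT
  (fun xt : mR * mR => tent xt.2 * cos (xt.2 * xt.1))).
apply: measurable_funM.
  exact: (measurableT_comp (@measurable_tent R) measurable_snd).
have mcos : measurable_fun [set: mR] (@cos R).
  exact: continuous_measurable_fun (@continuous_cos R).
by apply: (measurableT_comp mcos); exact: measurable_funM.
Qed.

Lemma integral_tent_hat_lty : (\int[mu]_x (tent_hat x)%:E < +oo)%E.
Proof.
have c8 : continuous (fun x : R => 8 / (1 + x ^+ 2)).
  move=> x; have d0 : 1 + x ^+ 2 != 0 by rewrite gt_eqF// ltr_pwDl// sqr_ge0.
  by apply/differentiable_continuous/derivable1_diffP; exact: ex_derive.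
have p8 x : 0 <= 8 / (1 + x ^+ 2) :> R.
  by rewrite divr_ge0// addr_ge0// sqr_ge0.
apply: (@le_lt_trans _ _ (\int[mu]_x (8 / (1 + x ^+ 2))%:E)%E).
  apply: ge0_le_integral_EFin => //.
  - exact: measurable_tent_hat.
  - exact: continuous_measurable_fun c8.
  - by move=> x _; exact: tent_hat_ge0.
  - by move=> x _; exact: tent_hat_le.
rewrite ge0_symfun_integralT//; last by move=> x /=; rewrite sqrrN.
rewrite lte_mul_pinfty// -set_itvcy.
under eq_integral => x _ do rewrite EFinM -[1 + x ^+ 2]/(oneDsqr x).
rewrite ge0_integralZl//.
- by rewrite integral0y_oneDsqr lte_mul_pinfty// ltry.
- apply/measurable_EFinP; apply: measurable_funTS.
  exact: continuous_measurable_fun (@continuous_oneDsqrV R).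
Qed.

(** [tent_hat] is positive on [(0, 1)]. *)
Lemma integral_tent_hat_gt0 : (0 < \int[mu]_x (tent_hat x)%:E)%E.
Proof.
have mth := measurable_tent_hat.
rewrite lt_neqAle integral_ge0 ?andbT; last first.
  by move=> x _; rewrite lee_fin tent_hat_ge0.
apply/eqP => I0; have : (\int[mu]_x `|(tent_hat x)%:E| = 0)%E.
  by rewrite I0; apply: eq_integral => x _; rewrite gee0_abs// lee_fin tent_hat_ge0.
move/(ae_eq_integral_abs mu measurableT ((measurable_EFinP _ _).2 mth)) => -[A [mA A0 sA]].
have : (mu (`]0%R, 1%R[%classic : set mR) <= mu A)%E.
  apply: le_measure; rewrite ?inE//.
  move=> x; rewrite /= in_itv/= => x01; apply: sA => /= /(_ I) [].
  by apply/eqP; rewrite gt_eqF// tent_hat_gt0.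
by rewrite A0 lebesgue_measure_itv/= lte_fin ltr01 sube0 lee_fin ler10.
Qed.

Lemma prod_gt0_lty (I : eqType) (s : seq I) (F : I -> \bar R) :
  (forall i, (0 < F i < +oo)%E) -> (0 < \prod_(i <- s) F i < +oo)%E.
Proof.
move=> F0; elim/big_ind : _ => //; first by rewrite lte_fin ltr01 ltry.
move=> x y /andP[x0 xy] /andP[y0 yy]; rewrite mule_gt0//=.
by rewrite lte_mul_pinfty// ?ge0_fin_numE// ltW.
Qed.

Variable n : nat.

Definition tents (w : 'rV[R]_n) : R := \prod_i tent (w 0 i).
Definition tents_hat (x : 'rV[R]_n) : R := \prod_i tent_hat (x 0 i).

Lemma tents_ge0 w : 0 <= tents w.
Proof. by apply: prodr_ge0 => i _; exact: tent_ge0. Qed.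

Lemma tents_le1 w : tents w <= 1.
Proof. by apply: prodr_ile1 => i _; rewrite tent_ge0 tent_le1. Qed.

Lemma tents_hat_ge0 x : 0 <= tents_hat x.
Proof. by apply: prodr_ge0 => i _; exact: tent_hat_ge0. Qed.

Lemma measurable_tents : measurable_fun setT tents.
Proof.
apply: measurable_prod => i _.
exact: (measurableT_comp (@measurable_tent R) (@measurable_rV_coord R n i)).
Qed.

Lemma measurable_tents_hat : measurable_fun setT tents_hat.
Proof.
apply: measurable_prod => i _.
exact: (measurableT_comp measurable_tent_hat (@measurable_rV_coord R n i)).
Qed.

Lemma integrable_tents : (leb R n).-integrable setT (EFin \o tents).
Proof.
apply: ge0_integrable_EFin => //.
- exact: measurable_tents.
- by move=> w _; exact: tents_ge0.
rewrite (ge0_integral_prod_rV (f := fun=> @tent R)).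
- suff /andP[] : (0 <= \prod_(i < n) \int[mu]_t (tent t)%:E < +oo)%E by [].
  elim/big_ind : _ => [|x y /andP[x0 xy] /andP[y0 yy]|i _].
  + by rewrite lee_fin ler01 ltry.
  + by rewrite mule_ge0//= lte_mul_pinfty// ge0_fin_numE.
  + rewrite integral_ge0/=; last by move=> x _; rewrite lee_fin tent_ge0.
    by rewrite -RintegralE// ?ltry//; exact: integrable_tent.
- by move=> _; exact: measurable_tent.
- by move=> _ t; exact: tent_ge0.
Qed.

Lemma integral_tents_hat : (0 < \int[leb R n]_x (tents_hat x)%:E < +oo)%E.
Proof.
rewrite (ge0_integral_prod_rV (f := fun=> @tent_hat R)).
- apply: prod_gt0_lty => _.
  by rewrite integral_tent_hat_gt0 integral_tent_hat_lty.
- by move=> _; exact: measurable_tent_hat.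
- by move=> _ t; exact: tent_hat_ge0.
Qed.

Lemma integrable_tents_hat : (leb R n).-integrable setT (EFin \o tents_hat).
Proof.
apply: ge0_integrable_EFin => //.
- exact: measurable_tents_hat.
- by move=> w _; exact: tents_hat_ge0.
- by case/andP: integral_tents_hat.
Qed.

Lemma integrable_tents_cos x al :
  (leb R n).-integrable setT (EFin \o (fun w => tents w * cos (edot w x + al))).
Proof.
apply: integrable_bounded_by integrable_tents => //.
  apply: measurable_funM; first exact: measurable_tents.
  have mcos : measurable_fun [set: mR] (@cos R).
    exact: continuous_measurable_fun (@continuous_cos R).
  apply: (measurableT_comp mcos); apply: measurable_funD => //.
  exact: (measurableT_comp (@measurable_edot2 R n) (pair2_measurable x)).
move=> w _; rewrite normrM ger0_norm ?tents_ge0// ler_piMr ?tents_ge0//.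
by rewrite ler_norml cos_geN1 cos_le1.
Qed.

End tent_product.

(** Fubini: the phase [al] carries the contribution of the coordinates already
    integrated out. *)
Lemma integral_tents_cos (R : realType) n (x : 'rV[R]_n) al :
  \int[leb R n]_w (tents w * cos (edot w x + al)) = cos al * tents_hat x.
Proof.
apply: EFin_inj; rewrite RintegralE//; last exact: integrable_tents_cos.
elim: n x al => [|n IH] x al.
  rewrite integral_leb0.
    by rewrite /tents /tents_hat /edot !big_ord0 add0r mul1r mulr1.
  exact: measurable_int (integrable_tents_cos x al).
rewrite (integral_lebS (integrable_tents_cos x al)).
pose x' : 'rV[R]_n := \row_j x 0 (lift ord0 j).
have fE t w : tents (cons_rV (t, w)) * cos (edot (cons_rV (t, w)) x + al) =
    tent t * (tents w * cos (edot w x' + (t * x 0 ord0 + al))).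
  rewrite /tents /edot !big_ord_recl mulrA; congr (_ * _ * cos _).
  - by rewrite mxE unlift_none.
  - by apply: eq_bigr => i _; rewrite mxE liftK.
  - rewrite mxE unlift_none/= addrAC [_ + al + _]addrC; congr (_ + _).
    by apply: eq_bigr => i _; rewrite !mxE liftK.
under eq_integral => t _.
  under eq_integral do rewrite fE EFinM.
  rewrite integralZl//; last exact: integrable_tents_cos.
  rewrite IH -EFinM mulrA [_ * tents_hat _]mulrC.
  over.
rewrite -RintegralE//.
  rewrite RintegralZl//; last exact: integrable_wave.
  rewrite integral_tent_wave mulrCA /tents_hat big_ord_recl [X in _ * X]mulrC.
  by do 3 congr (_ _); apply: eq_bigr => i _; rewrite mxE.
by apply: integrableZl_EFin => //; exact: integrable_wave.
Qed.

(** * Cosine and sine transforms *)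

Section real_fubini.
Context d1 d2 (T1 : measurableType d1) (T2 : measurableType d2) (R : realType).
Variables (m1 : {sigma_finite_measure set T1 -> \bar R}).
Variables (m2 : {sigma_finite_measure set T2 -> \bar R}).

Lemma Rfubini (f : T1 -> T2 -> R) (U : T1 -> R) :
  measurable_fun setT (fun z => f z.1 z.2) ->
  (forall x, m2.-integrable setT (EFin \o (f x))) ->
  (forall y, m1.-integrable setT (EFin \o (f ^~ y))) ->
  (forall x, \int[m2]_y `|f x y| <= U x) ->
  m1.-integrable setT (EFin \o U) ->
  \int[m1]_x \int[m2]_y f x y = \int[m2]_y \int[m1]_x f x y.
Proof.
move=> mf f2 f1 fU iU.
have mnf : measurable_fun setT (fun z => `|f z.1 z.2|) by exact: measurableT_comp.
have [|fi fE] := @fubini_on _ _ _ _ _ m1 m2 _ _ measurableT measurableT _ mf.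
  apply: le_lt_trans (_ : (\int[m1]_x `|U x|%:E < +oo)%E); last first.
    by have /integrableP[] := iU.
  apply: ge0_le_integral => //.
  - by move=> x _; apply: integral_ge0.
  - apply: (@measurable_integral_section _ _ _ _ _ _ _ measurableT
      (fun z => `|f z.1 z.2|%:E)).
    exact/measurable_EFinP.
  - by apply/measurable_EFinP; apply: measurableT_comp => //;
      apply/measurable_EFinP; exact: measurable_int iU.
  - move=> x _; rewrite -RintegralE//; last exact: (integrable_norm (f2 x)).
    by rewrite lee_fin (le_trans (fU x))// ler_norm.
rewrite [LHS]/Rintegral [RHS]/Rintegral; congr fine.
under eq_integral do rewrite RintegralE//.
by under [RHS]eq_integral do rewrite RintegralE//.
Qed.

Lemma Rfubini_prod (f : T1 -> T2 -> R) (u : T1 -> R) (v : T2 -> R) :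
  measurable_fun setT (fun z => f z.1 z.2) ->
  m1.-integrable setT (EFin \o u) -> m2.-integrable setT (EFin \o v) ->
  (forall x y, `|f x y| <= u x * v y) ->
  \int[m1]_x \int[m2]_y f x y = \int[m2]_y \int[m1]_x f x y.
Proof.
move=> mf ui vi fuv.
have f2 x : m2.-integrable setT (EFin \o (f x)).
  have := integrableZl_EFin (u x) measurableT vi; apply: integrable_bounded_by => //.
  exact: (measurableT_comp mf (pair1_measurable x)).
apply: (@Rfubini _ (fun x => (\int[m2]_y v y) * u x)) => //.
- move=> y; have := integrableZl_EFin (v y) measurableT ui.
  apply: integrable_bounded_by => //.
    exact: (measurableT_comp mf (pair2_measurable y)).
  by move=> x _; rewrite mulrC.
- move=> x; rewrite mulrC -RintegralZl//; apply: le_Rintegral => //.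
    exact: (integrable_norm (f2 x)).
  exact: (integrableZl_EFin (u x) measurableT vi).
- exact: integrableZl_EFin.
Qed.

End real_fubini.

Section trigonometric_transform.
Context (R : realType) (n : nat).
Notation mu := (leb R n).
Implicit Types (a b : 'rV[R]_n -> R) (w x y z : 'rV[R]_n).

(** The Fourier transform of [a] is [cosT a - i sinT a]. *)
Definition cosT a w : R := \int[mu]_x (a x * cos (edot w x)).
Definition sinT a w : R := \int[mu]_x (a x * sin (edot w x)).

Lemma measurable_cosR : measurable_fun [set: measurableTypeR R] (@cos R).
Proof. exact: continuous_measurable_fun (@continuous_cos R). Qed.

Lemma measurable_sinR : measurable_fun [set: measurableTypeR R] (@sin R).
Proof. exact: continuous_measurable_fun (@continuous_sin R). Qed.

Lemma normr_cos (t : R) : `|cos t| <= 1.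
Proof. by rewrite ler_norml cos_geN1 cos_le1. Qed.

Lemma normr_sin (t : R) : `|sin t| <= 1.
Proof. by rewrite ler_norml sin_geN1 sin_le1. Qed.

Lemma edotBr w x y : edot w (x - y) = edot w x - edot w y.
Proof. by rewrite /edot -sumrB; apply: eq_bigr => i _; rewrite !mxE mulrBr. Qed.

Lemma edotDr w x y : edot w (x + y) = edot w x + edot w y.
Proof. by rewrite /edot -big_split; apply: eq_bigr => i _; rewrite !mxE mulrDr. Qed.

Lemma edotZl (t : R) w x : edot (t *: w) x = t * edot w x.
Proof. by rewrite /edot mulr_sumr; apply: eq_bigr => i _; rewrite !mxE mulrA. Qed.

Lemma edotZr (t : R) w x : edot w (t *: x) = t * edot w x.
Proof. by rewrite /edot mulr_sumr; apply: eq_bigr => i _; rewrite !mxE mulrCA. Qed.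

Lemma integrable_modulated a (u : 'rV[R]_n -> R) :
  mu.-integrable setT (EFin \o a) -> measurable_fun setT u ->
  (forall x, `|u x| <= 1) -> mu.-integrable setT (EFin \o (fun x => a x * u x)).
Proof.
move=> ai m_u u1; have ma : measurable_fun setT a.
  exact: measurable_integrable ai.
apply: integrable_bounded_by (integrable_norm ai) => //.
  exact: measurable_funM.
by move=> x _ /=; rewrite normrM ler_piMr.
Qed.

Lemma integrable_cosM a w : mu.-integrable setT (EFin \o a) ->
  mu.-integrable setT (EFin \o (fun x => a x * cos (edot w x))).
Proof.
move=> ai; apply: integrable_modulated => //; last by move=> x; exact: normr_cos.
exact: (measurableT_comp measurable_cosR (measurable_edot w)).
Qed.

Lemma integrable_sinM a w : mu.-integrable setT (EFin \o a) ->
  mu.-integrable setT (EFin \o (fun x => a x * sin (edot w x))).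
Proof.
move=> ai; apply: integrable_modulated => //; last by move=> x; exact: normr_sin.
exact: (measurableT_comp measurable_sinR (measurable_edot w)).
Qed.

Lemma measurable_cosT a : measurable_fun setT a -> measurable_fun setT (cosT a).
Proof.
move=> ma; apply: (@measurable_Rintegral_section _ _ _ _ R mu _ measurableT
  (fun wx : 'rV[R]_n * 'rV[R]_n => a wx.2 * cos (edot wx.1 wx.2))).
apply: measurable_funM; first exact: measurableT_comp ma measurable_snd.
exact: (measurableT_comp measurable_cosR (@measurable_edot2 R n)).
Qed.

Lemma measurable_sinT a : measurable_fun setT a -> measurable_fun setT (sinT a).
Proof.
move=> ma; apply: (@measurable_Rintegral_section _ _ _ _ R mu _ measurableT
  (fun wx : 'rV[R]_n * 'rV[R]_n => a wx.2 * sin (edot wx.1 wx.2))).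
apply: measurable_funM; first exact: measurableT_comp ma measurable_snd.
exact: (measurableT_comp measurable_sinR (@measurable_edot2 R n)).
Qed.

Lemma cosT_le a w : mu.-integrable setT (EFin \o a) ->
  `|cosT a w| <= \int[mu]_x `|a x|.
Proof.
move=> ai; apply: le_trans (le_normr_Rintegral measurableT (integrable_cosM w ai)) _.
apply: le_Rintegral => //; first exact: (integrable_norm (integrable_cosM w ai)).
  exact: (integrable_norm ai).
by move=> x _; rewrite normrM ler_piMr// normr_cos.
Qed.

Lemma sinT_le a w : mu.-integrable setT (EFin \o a) ->
  `|sinT a w| <= \int[mu]_x `|a x|.
Proof.
move=> ai; apply: le_trans (le_normr_Rintegral measurableT (integrable_sinM w ai)) _.
apply: le_Rintegral => //; first exact: (integrable_norm (integrable_sinM w ai)).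
  exact: (integrable_norm ai).
by move=> x _; rewrite normrM ler_piMr// normr_sin.
Qed.

Lemma integral_cosB a w z : mu.-integrable setT (EFin \o a) ->
  \int[mu]_x (a x * cos (edot w (z - x))) =
  cos (edot w z) * cosT a w + sin (edot w z) * sinT a w.
Proof.
move=> ai; have ci := integrable_cosM w ai; have si := integrable_sinM w ai.
rewrite /cosT /sinT -!RintegralZl// -RintegralD//; last 2 first.
- exact: (integrableZl_EFin (cos (edot w z)) measurableT ci).
- exact: (integrableZl_EFin (sin (edot w z)) measurableT si).
apply: eq_Rintegral => x _; rewrite edotBr cosB; ring.
Qed.

Lemma integral_cosD a w z : mu.-integrable setT (EFin \o a) ->
  \int[mu]_x (a x * cos (edot w (z + x))) =
  cos (edot w z) * cosT a w - sin (edot w z) * sinT a w.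
Proof.
move=> ai; have ci := integrable_cosM w ai; have si := integrable_sinM w ai.
rewrite /cosT /sinT -!RintegralZl// -RintegralB//; last 2 first.
- exact: (integrableZl_EFin (cos (edot w z)) measurableT ci).
- exact: (integrableZl_EFin (sin (edot w z)) measurableT si).
apply: eq_Rintegral => x _; rewrite edotDr cosD; ring.
Qed.

Lemma integral_sinD a w z : mu.-integrable setT (EFin \o a) ->
  \int[mu]_x (a x * sin (edot w (z + x))) =
  sin (edot w z) * cosT a w + cos (edot w z) * sinT a w.
Proof.
move=> ai; have ci := integrable_cosM w ai; have si := integrable_sinM w ai.
rewrite /cosT /sinT -!RintegralZl// -RintegralD//; last 2 first.
- exact: (integrableZl_EFin (sin (edot w z)) measurableT ci).
- exact: (integrableZl_EFin (cos (edot w z)) measurableT si).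
apply: eq_Rintegral => x _; rewrite edotDr sinD; ring.
Qed.

Lemma tents_hat_le x : tents_hat x <= 8 ^+ n.
Proof.
rewrite -[X in _ ^+ X]card_ord -prodr_const; apply: ler_prod => i _.
rewrite tent_hat_ge0 (le_trans (tent_hat_le _))// ler_pdivrMr.
  by rewrite ler_peMr// lerDl sqr_ge0.
by rewrite ltr_pwDl// sqr_ge0.
Qed.

(** The transform of the dilated multiplier concentrates at 0 as [t] does. *)
Lemma integral_dilated_tents (t : R) x : 0 < t ->
  \int[mu]_w (tents (t *: w) * cos (edot w x)) = t ^- n * tents_hat (t^-1 *: x).
Proof.
move=> t0; have tN0 : t != 0 by rewrite gt_eqF.
have ti := integrable_tents_cos (t^-1 *: x) 0.
have := Rintegral_affine_rV 0 tN0 ti; rewrite gtr0_norm// => tE.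
rewrite -[tents_hat _]mul1r -[X in X * tents_hat _]cos0 -integral_tents_cos -tE.
by apply: eq_Rintegral => w _; rewrite !addr0 edotZl edotZr mulrA divff// mul1r.
Qed.

End trigonometric_transform.

(** * A weighted Parseval identity *)

Section parseval.
Context (R : realType) (n : nat).
Notation mu := (leb R n).
Implicit Types (a b : 'rV[R]_n -> R) (w x y z : 'rV[R]_n).

Lemma integrable_dilated_tents (t : R) : 0 < t ->
  mu.-integrable setT (EFin \o (fun w => tents (t *: w))).
Proof.
move=> t0; have := integrable_affine_rV 0 (lt0r_neq0 t0) (integrable_tents R n).
by apply: eq_integrable => // w _ /=; rewrite addr0.
Qed.

Lemma measurable_dilated_tents (t : R) :
  measurable_fun setT (fun w : 'rV[R]_n => tents (t *: w)).
Proof.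
have := measurable_affine_rV t (0 : 'rV[R]_n).
move=> /(measurableT_comp (@measurable_tents R n)); apply: eq_measurable_fun.
by move=> w _ /=; rewrite addr0.
Qed.

(** Fubini, and the substitution [x = z - t y]. *)
Lemma tents_convolution (t : R) a z : 0 < t -> mu.-integrable setT (EFin \o a) ->
  \int[mu]_w (tents (t *: w) *
    (cos (edot w z) * cosT a w + sin (edot w z) * sinT a w)) =
  \int[mu]_y (tents_hat y * a (z - t *: y)).
Proof.
move=> t0 ai; have ma : measurable_fun setT a.
  exact: measurable_integrable ai.
have mcosB : measurable_fun setT
    (fun wx : 'rV[R]_n * 'rV[R]_n => cos (edot wx.1 (z - wx.2))).
  apply: (measurableT_comp (@measurable_cosR R)).
  have mp : measurable_fun setT
      (fun wx : 'rV[R]_n * 'rV[R]_n => (wx.1, z - wx.2)).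
    apply: measurable_fun_pair => //.
    apply: (measurableT_comp (f := fun x : 'rV[R]_n => z - x)) => //.
    have := measurable_affine_rV (-1) z; apply: eq_measurable_fun => x _.
    by rewrite scaleN1r addrC.
  exact: (measurableT_comp (@measurable_edot2 R n) mp).
transitivity (\int[mu]_w \int[mu]_x
    (tents (t *: w) * (a x * cos (edot w (z - x))))).
  apply: eq_Rintegral => w _; rewrite -integral_cosB// -RintegralZl//.
  apply: integrable_modulated => //; last by move=> x; exact: normr_cos.
  exact: (measurableT_comp mcosB (pair1_measurable w)).
rewrite (@Rfubini_prod _ _ _ _ _ _ _ _ (fun w => tents (t *: w)) (fun x => `|a x|)).
- transitivity (\int[mu]_x (t ^- n * (a x * tents_hat (t^-1 *: (z - x))))).
    apply: eq_Rintegral => x _.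
    under eq_Rintegral do rewrite mulrCA.
    rewrite RintegralZl//; last first.
      apply: integrable_modulated => //.
      - exact: integrable_dilated_tents.
      - exact: (measurableT_comp mcosB (pair2_measurable x)).
      - by move=> w; exact: normr_cos.
    by rewrite integral_dilated_tents// mulrCA.
  have Ki : mu.-integrable setT
      (EFin \o (fun x => a x * tents_hat (t^-1 *: (z - x)))).
    have := integrableZl_EFin (8 ^+ n) measurableT (integrable_norm ai).
    apply: integrable_bounded_by => //.
      apply: measurable_funM => //.
      have := measurable_affine_rV (- t^-1) (t^-1 *: z).
      move=> /(measurableT_comp (@measurable_tents_hat R n)).
      apply: eq_measurable_fun => x _ /=.
      by rewrite scalerBr scaleNr addrC.
    move=> x _; rewrite normrM mulrC ler_wpM2r//.
    by rewrite ger0_norm ?tents_hat_ge0// tents_hat_le.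
  have tN0 : - t != 0 by rewrite oppr_eq0 gt_eqF.
  rewrite RintegralZl//.
  have := Rintegral_affine_rV z tN0 Ki; rewrite normrN gtr0_norm// => <-.
  apply: eq_Rintegral => y _; rewrite mulrC scaleNr [- _ + z]addrC opprB.
  by rewrite [z + _]addrC subrK scalerA mulVf ?gt_eqF// scale1r.
- apply: measurable_funM.
    exact: (measurableT_comp (measurable_dilated_tents t) measurable_fst).
  by apply: measurable_funM => //; exact: measurableT_comp ma measurable_snd.
- exact: integrable_dilated_tents.
- exact: (integrable_norm ai).
- move=> w x; rewrite normrM ger0_norm ?tents_ge0// ler_wpM2l ?tents_ge0//.
  by rewrite normrM ler_piMr// normr_cos.
Qed.

Lemma measurable_shear (t : R) :
  measurable_fun setT (fun yz : 'rV[R]_n * 'rV[R]_n => yz.2 - t *: yz.1).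
Proof.
have mp : measurable_fun setT
    (fun yz : 'rV[R]_n * 'rV[R]_n => (t *: yz.1, yz.2)).
  apply: measurable_fun_pair => //.
  apply: (measurableT_comp (f := fun x : 'rV[R]_n => t *: x)) => //.
  have := measurable_affine_rV t (0 : 'rV[R]_n); apply: eq_measurable_fun => x _.
  by rewrite addr0.
exact: (measurableT_comp (@measurable_rVB R n) mp).
Qed.

(** The multiplier makes every integral absolutely convergent. As [t] tends to
    0 it tends to 1, while the right-hand side, an average of the correlation
    of [a] and [b] around the origin, tends to a multiple of the correlation
    itself: this is both Bessel's inequality and Fourier inversion. *)
Lemma weighted_parseval (t M : R) a b : 0 < t ->
  mu.-integrable setT (EFin \o a) -> mu.-integrable setT (EFin \o b) ->
  (forall x, `|b x| <= M) ->
  \int[mu]_w (tents (t *: w) * (cosT a w * cosT b w + sinT a w * sinT b w)) =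
  \int[mu]_y (tents_hat y * \int[mu]_z (b z * a (z - t *: y))).
Proof.
move=> t0 ai bi bM; set A := \int[mu]_x `|a x|.
have ma : measurable_fun setT a.
  exact: measurable_integrable ai.
have mb : measurable_fun setT b.
  exact: measurable_integrable bi.
have M0 : 0 <= M by rewrite (le_trans _ (bM 0)).
pose I w z := cos (edot w z) * cosT a w + sin (edot w z) * sinT a w.
have mI : measurable_fun setT (fun wz : 'rV[R]_n * 'rV[R]_n => I wz.1 wz.2).
  have me := @measurable_edot2 R n.
  apply: measurable_funD; apply: measurable_funM.
  - exact: (measurableT_comp (@measurable_cosR R) me).
  - exact: (measurableT_comp (measurable_cosT ma) measurable_fst).
  - exact: (measurableT_comp (@measurable_sinR R) me).
  - exact: (measurableT_comp (measurable_sinT ma) measurable_fst).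
have IA w z : `|I w z| <= 2 * A.
  rewrite (le_trans (ler_normD _ _))// mulr_natl mulr2n lerD//.
    by rewrite normrM (le_trans _ (cosT_le w ai))// ler_piMl// normr_cos.
  by rewrite normrM (le_trans _ (sinT_le w ai))// ler_piMl// normr_sin.
transitivity (\int[mu]_w \int[mu]_z (tents (t *: w) * (b z * I w z))).
  apply: eq_Rintegral => w _; rewrite RintegralZl//; last first.
    have := integrableZl_EFin (2 * A) measurableT (integrable_norm bi).
    apply: integrable_bounded_by => //.
      apply: measurable_funM => //.
      exact: (measurableT_comp mI (pair1_measurable w)).
    by move=> z _; rewrite normrM mulrC ler_wpM2r.
  congr (_ * _); have ci := integrable_cosM w bi; have si := integrable_sinM w bi.
  rewrite /cosT -[X in X + _]RintegralZl// -[X in _ + X]RintegralZl//.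
  rewrite -RintegralD//; last 2 first.
  - exact: (integrableZl_EFin (cosT a w) measurableT ci).
  - exact: (integrableZl_EFin (sinT a w) measurableT si).
  by apply: eq_Rintegral => z _; rewrite /I /cosT; ring.
rewrite (@Rfubini_prod _ _ _ _ _ _ _ _ (fun w => tents (t *: w))
  (fun z => 2 * A * `|b z|)); first last.
- move=> w z; rewrite normrM ger0_norm ?tents_ge0// ler_wpM2l ?tents_ge0//.
  by rewrite normrM mulrC ler_wpM2r.
- exact: (integrableZl_EFin (2 * A) measurableT (integrable_norm bi)).
- exact: integrable_dilated_tents.
- apply: measurable_funM.
    exact: (measurableT_comp (measurable_dilated_tents t) measurable_fst).
  by apply: measurable_funM => //; exact: measurableT_comp mb measurable_snd.
have mz := measurable_shear t.
have shift_i y : mu.-integrable setT (EFin \o (fun z => a (z - t *: y))).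
  have := integrable_affine_rV (- (t *: y)) (oner_neq0 R) ai.
  by apply: eq_integrable => // z _ /=; rewrite scale1r.
have ma2 := measurableT_comp ma mz.
have refl_i z : mu.-integrable setT (EFin \o (fun y => a (z - t *: y))).
  have tN0 : - t != 0 by rewrite oppr_eq0 gt_eqF.
  have := integrable_affine_rV z tN0 ai.
  by apply: eq_integrable => // y _ /=; rewrite scaleNr addrC.
transitivity (\int[mu]_z \int[mu]_y (tents_hat y * (b z * a (z - t *: y)))).
  apply: eq_Rintegral => z _; under eq_Rintegral do rewrite mulrCA.
  rewrite RintegralZl//; last first.
    have := integrableZl_EFin (2 * A) measurableT (integrable_dilated_tents t0).
    apply: integrable_bounded_by => //.
      apply: measurable_funM; first exact: measurable_dilated_tents.
      exact: (measurableT_comp mI (pair2_measurable z)).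
    by move=> w _; rewrite normrM mulrC (ger0_norm (tents_ge0 _)) ler_wpM2r// tents_ge0.
  rewrite (tents_convolution z t0 ai) -RintegralZl//; last first.
    have := integrableZl_EFin (8 ^+ n) measurableT (integrable_norm (refl_i z)).
    apply: integrable_bounded_by => //.
      apply: measurable_funM; first exact: measurable_tents_hat.
      exact: measurable_integrable (refl_i z).
    move=> y _; rewrite normrM ler_wpM2r//.
    by rewrite ger0_norm ?tents_hat_ge0// tents_hat_le.
  by apply: eq_Rintegral => y _; rewrite mulrCA.
have bound y z : `|tents_hat y * (b z * a (z - t *: y))| <=
    tents_hat y * M * `|a (z - t *: y)|.
  by rewrite !normrM mulrA ger0_norm ?tents_hat_ge0// ler_wpM2r// ler_wpM2l// tents_hat_ge0.
have mf : measurable_fun setT (fun yz : 'rV[R]_n * 'rV[R]_n =>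
    tents_hat yz.1 * (b yz.2 * a (yz.2 - t *: yz.1))).
  apply: measurable_funM.
    exact: (measurableT_comp (@measurable_tents_hat R n) measurable_fst).
  by apply: measurable_funM => //; exact: measurableT_comp mb measurable_snd.
have f2 y : mu.-integrable setT
    (EFin \o (fun z => tents_hat y * (b z * a (z - t *: y)))).
  have := integrableZl_EFin (tents_hat y * M) measurableT (integrable_norm (shift_i y)).
  apply: integrable_bounded_by => //.
  exact: (measurableT_comp mf (pair1_measurable y)).
have shiftA y : \int[mu]_z `|a (z - t *: y)| = A.
  have := Rintegral_affine_rV (- (t *: y)) (oner_neq0 R) (integrable_norm ai).
  rewrite normr1 expr1n invr1 mul1r => sE.
  transitivity (\int[mu]_x (normr \o a) (1 *: x - t *: y)); last exact: sE.
  by apply: eq_Rintegral => z _ /=; rewrite scale1r.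
rewrite -(@Rfubini _ _ _ _ _ _ _ _ (fun y => A * M * tents_hat y)) //.
- apply: eq_Rintegral => y _; rewrite RintegralZl//.
  have := integrableZl_EFin M measurableT (integrable_norm (shift_i y)).
  apply: integrable_bounded_by => //.
    apply: measurable_funM => //.
    exact: measurable_integrable (shift_i y).
  by move=> z _; rewrite normrM ler_wpM2r.
- move=> z; have := integrableZl_EFin (8 ^+ n * M) measurableT (integrable_norm (refl_i z)).
  apply: integrable_bounded_by => //.
    exact: (measurableT_comp mf (pair2_measurable z)).
  move=> y _; rewrite (le_trans (bound y z))// ler_wpM2r// ler_wpM2r//.
  exact: tents_hat_le.
- move=> y; have sNi := integrable_norm (shift_i y).
  rewrite -mulrA mulrC [M * _]mulrC -(shiftA y) -RintegralZl//.
  apply: le_Rintegral => //; first exact: (integrable_norm (f2 y)).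
  exact: (integrableZl_EFin (tents_hat y * M) measurableT sNi).
- exact: (integrableZl_EFin (A * M) measurableT (@integrable_tents_hat R n)).
Qed.

End parseval.

(** * Fourier inversion *)

Section limit_theorems.
Context d (T : measurableType d) (R : realType).
Variable mu : {measure set T -> \bar R}.

Lemma fatou_le (F : nat -> T -> R) (f : T -> R) (B : \bar R) :
  (forall k, measurable_fun setT (F k)) -> (forall k x, 0 <= F k x) ->
  (forall x, F k x @[k --> \oo] --> f x) ->
  (\forall k \near \oo, (\int[mu]_x (F k x)%:E <= B)%E) ->
  (\int[mu]_x (f x)%:E <= B)%E.
Proof.
move=> mF F0 Ff [N _ FB].
have mG k : measurable_fun setT (fun x => (F (k + N)%N x)%:E).
  exact/measurable_EFinP.
have := fatou mu measurableT mG (fun k x _ => F0 (k + N)%N x).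
have -> : (\int[mu]_x limn_einf (fun k => (F (k + N)%N x)%:E) =
    \int[mu]_x (f x)%:E)%E.
  apply: eq_integral => x _.
  have FfE : ((F (k + N)%N x)%:E @[k --> \oo] --> (f x)%:E)%E.
    apply: cvg_EFin; first exact: nearW.
    by rewrite (cvg_shiftn N (fun k => F k x)).
  rewrite is_cvg_limn_einfE; first exact: cvg_lim FfE.
  by apply/cvg_ex; exists (f x)%:E.
move=> /le_trans; apply; rewrite limn_einf_lim; apply: lime_le.
  exact: is_cvg_einfs.
apply: nearW => k; apply: le_trans (FB (k + N)%N _); last by rewrite /= leq_addl.
by apply: ereal_inf_lbound; exists k => /=.
Qed.

Lemma Rdominated_cvg (F : nat -> T -> R) (f g : T -> R) :
  (forall k, measurable_fun setT (F k)) -> measurable_fun setT f ->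
  mu.-integrable setT (EFin \o g) ->
  (forall k x, `|F k x| <= g x) ->
  (forall x, F k x @[k --> \oo] --> f x) ->
  \int[mu]_x F k x @[k --> \oo] --> \int[mu]_x f x.
Proof.
move=> mF mf ig Fg Ff.
have Ffe x : ((F k x)%:E @[k --> \oo] --> (f x)%:E)%E.
  by apply: cvg_EFin; [exact: nearW|exact: Ff].
have fg x : `|f x| <= g x.
  rewrite -(cvg_lim (@Rhausdorff R) (cvg_norm (Ff x))); apply: limr_le.
    by apply/cvg_ex; exists `|f x|; exact: cvg_norm (Ff x).
  by apply: nearW => k; exact: Fg.
have fi : mu.-integrable setT (EFin \o f).
  by apply: integrable_bounded_by ig => // x _; exact: fg.
have := @dominated_cvg _ _ _ mu setT measurableT
  (fun k x => (F k x)%:E) (EFin \o f) (EFin \o g)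
  (fun k => (measurable_EFinP _ _).2 (mF k)) (fun x _ => Ffe x)
  (fun=> fun=> isT) ig
  (fun k x _ => Fg k x).
by rewrite -RintegralE// => /fine_cvgP[_].
Qed.

End limit_theorems.

Section fourier_inversion.
Context (R : realType) (n : nat).
Notation mu := (leb R n).
Implicit Types (a b : 'rV[R]_n -> R) (w x y z : 'rV[R]_n).

Lemma tents_cvg1 w : tents (k.+1%:R^-1 *: w) @[k --> \oo] --> (1 : R).
Proof.
have -> : (fun k => tents (k.+1%:R^-1 *: w)) =
    (fun k => \prod_(i < n) tent (k.+1%:R^-1 * w 0 i)).
  by apply/funext => k; apply: eq_bigr => i _; rewrite mxE.
suff : \prod_(i < n) tent (k.+1%:R^-1 * w 0 i) @[k --> \oo] -->
    \prod_(i < n) (1 : R) by rewrite big1.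
apply: cvg_big => [|i _]; first exact: mul_continuous.
have h0 : (k.+1%:R^-1 * w 0 i) @[k --> \oo] --> 0 * w 0 i.
  by apply: cvgM; [exact: cvg_harmonic|exact: cvg_cst].
have := cvg_comp _ _ h0 (@continuous_tent R (0 * w 0 i)).
by rewrite mul0r tent0.
Qed.

Lemma measurable_edotl x : measurable_fun setT (fun w : 'rV[R]_n => edot w x).
Proof. exact: (measurableT_comp (@measurable_edot2 R n) (pair2_measurable x)). Qed.

Definition kappa : R := \int[mu]_y tents_hat y.

Lemma kappa_gt0 : 0 < kappa.
Proof.
have /andP[K0 _] := integral_tents_hat R n.
by rewrite -lte_fin RintegralE//; exact: integrable_tents_hat.
Qed.

(** Bessel's inequality: pairing [b] with itself in [weighted_parseval] bounds
    the weighted energies of its transform uniformly in the weight. *)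
Lemma transform_L2 (M : R) b : mu.-integrable setT (EFin \o b) ->
  (forall x, `|b x| <= M) ->
  (\int[mu]_w (cosT b w ^+ 2 + sinT b w ^+ 2)%:E < +oo)%E.
Proof.
move=> bi bM; set A := \int[mu]_x `|b x|.
have mb : measurable_fun setT b.
  exact: measurable_integrable bi.
have mC := measurable_cosT mb; have mS := measurable_sinT mb.
have M0 : 0 <= M by rewrite (le_trans _ (bM 0)).
have mE : measurable_fun setT (fun w => cosT b w ^+ 2 + sinT b w ^+ 2).
  by apply: measurable_funD; exact: measurable_funX.
have E0 w : 0 <= cosT b w ^+ 2 + sinT b w ^+ 2 by rewrite addr_ge0 ?sqr_ge0.
apply: le_lt_trans (ltry (kappa * (M * A))).
apply: (@fatou_le _ _ _ _ (fun k w =>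
  tents (k.+1%:R^-1 *: w) * (cosT b w ^+ 2 + sinT b w ^+ 2))).
- move=> k; apply: measurable_funM => //.
  exact: measurable_dilated_tents.
- by move=> k w; rewrite mulr_ge0 ?tents_ge0.
- move=> w; rewrite -[X in _ --> X]mul1r.
  by apply: cvgM; [exact: tents_cvg1|exact: cvg_cst].
apply: nearW => k; have t0 : 0 < k.+1%:R^-1 :> R by rewrite invr_gt0.
rewrite -RintegralE//; last first.
  have := integrableZl_EFin (A ^+ 2 + A ^+ 2) measurableT (integrable_dilated_tents n t0).
  apply: integrable_bounded_by => //.
    apply: measurable_funM => //.
    exact: measurable_dilated_tents.
  move=> w _; rewrite normrM mulrC (ger0_norm (tents_ge0 _)) ler_wpM2r ?tents_ge0//.
  rewrite ger0_norm// -(real_normK (num_real (cosT b w))).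
  rewrite -(real_normK (num_real (sinT b w))).
  by rewrite lerD// ler_sqr ?nnegrE ?integral_ge0 ?cosT_le ?sinT_le// /A Rintegral_ge0.
rewrite lee_fin; under eq_Rintegral do rewrite !expr2.
rewrite (weighted_parseval t0 bi bi bM).
rewrite /kappa -RintegralZr//; last exact: integrable_tents_hat.
have i2 y : `|\int[mu]_z (b z * b (z - k.+1%:R^-1 *: y))| <= M * A.
  have si := integrable_affine_rV (- (k.+1%:R^-1 *: y)) (oner_neq0 R) bi.
  have bbi : mu.-integrable setT
      (EFin \o (fun z => b z * b (z - k.+1%:R^-1 *: y))).
    have := integrableZl_EFin M measurableT (integrable_norm bi).
    apply: integrable_bounded_by => //.
      apply: measurable_funM => //; apply/measurable_EFinP.
      have := measurable_int _ si; apply: eq_measurable_fun => z _ /=.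
      by rewrite scale1r.
    by move=> z _; rewrite normrM mulrC ler_wpM2r.
  apply: le_trans (le_normr_Rintegral measurableT bbi) _.
  rewrite /A -RintegralZl//; last exact: (integrable_norm bi).
  apply: le_Rintegral => //; first exact: (integrable_norm bbi).
    exact: (integrableZl_EFin M measurableT (integrable_norm bi)).
  by move=> z _; rewrite normrM mulrC ler_wpM2r.
have Ki := integrable_tents_hat R n.
apply: le_Rintegral => //.
- have := integrableZl_EFin (M * A) measurableT Ki.
  apply: integrable_bounded_by => //.
    apply: measurable_funM; first exact: measurable_tents_hat.
    apply: (@measurable_Rintegral_section _ _ _ _ R mu _ measurableT
      (fun yz : 'rV[R]_n * 'rV[R]_n => b yz.2 * b (yz.2 - k.+1%:R^-1 *: yz.1))).
    apply: measurable_funM; first exact: measurableT_comp mb measurable_snd.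
    apply: (measurableT_comp mb); exact: measurable_shear.
  move=> y _; rewrite normrM mulrC (ger0_norm (tents_hat_ge0 _)).
  by rewrite ler_wpM2r ?tents_hat_ge0.
- have := integrableZl_EFin (M * A) measurableT Ki.
  by apply: eq_integrable => // y _ /=; rewrite mulrC.
- move=> y _; rewrite ler_wpM2l ?tents_hat_ge0//.
  exact: le_trans (ler_norm _) (i2 y).
Qed.

Variable h : 'rV[R]_n -> R.
Hypothesis hi : mu.-integrable setT (EFin \o h).
Hypothesis h_even : forall x, h (- x) = h x.

Lemma sinT_even w : sinT h w = 0.
Proof.
have N10 : -1 != 0 :> R by rewrite oppr_eq0 oner_neq0.
have := Rintegral_affine_rV 0 N10 (integrable_sinM w hi).
rewrite normrN normr1 expr1n invr1 mul1r -[X in _ = X]/(sinT h w) => E.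
suff : sinT h w = - sinT h w.
  by move=> /eqP; rewrite -addr_eq0 -mulr2n mulrn_eq0/= => /eqP.
rewrite -[LHS]E -[RHS]mulN1r /sinT -RintegralZl//; last exact: integrable_sinM.
apply: eq_Rintegral => x _.
by rewrite addr0 scaleN1r h_even -scaleN1r edotZr mulN1r sinN mulrN mulN1r.
Qed.

Let shift s x : R := h (x - s).

Let shift_i s : mu.-integrable setT (EFin \o shift s).
Proof.
have := integrable_affine_rV (- s) (oner_neq0 R) hi.
by apply: eq_integrable => // z _ /=; rewrite scale1r.
Qed.

Let shift_cosT s w : cosT (shift s) w = cos (edot w s) * cosT h w.
Proof.
have := Rintegral_affine_rV s (oner_neq0 R) (integrable_cosM w (shift_i s)).
rewrite normr1 expr1n invr1 mul1r -[X in _ = X]/(cosT (shift s) w) => <-.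
rewrite -[RHS]subr0 -[in RHS](mulr0 (sin (edot w s))) -(sinT_even w).
rewrite -integral_cosD//; apply: eq_Rintegral => x _.
by rewrite /shift scale1r addrK [x + s]addrC.
Qed.

Let shift_sinT s w : sinT (shift s) w = sin (edot w s) * cosT h w.
Proof.
have := Rintegral_affine_rV s (oner_neq0 R) (integrable_sinM w (shift_i s)).
rewrite normr1 expr1n invr1 mul1r -[X in _ = X]/(sinT (shift s) w) => <-.
rewrite -[RHS]addr0 -[in RHS](mulr0 (cos (edot w s))) -(sinT_even w).
rewrite -integral_sinD//; apply: eq_Rintegral => x _.
by rewrite /shift scale1r addrK [x + s]addrC.
Qed.

Variables (G : 'rV[R]_n -> R) (M V : R).
Hypothesis Gi : mu.-integrable setT (EFin \o G).
Hypothesis GM : forall x, `|G x| <= M.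
Let v s := \int[mu]_z (G z * h (z - s)).
Hypothesis v_continuous : continuous v.
Hypothesis v_bounded : forall s, `|v s| <= V.
Hypothesis Qi : mu.-integrable setT (EFin \o (fun w => cosT h w * cosT G w)).
Hypothesis Qi' : mu.-integrable setT (EFin \o (fun w => cosT h w * sinT G w)).

(** [weighted_parseval] for [G] and the translate of [h] by [s], whose
    transform is that of [h] up to a phase; both sides converge as [t] tends
    to 0, by dominated convergence. *)
Lemma convolution_inversion s :
  kappa * v s = \int[mu]_w (cosT h w * cosT G w * cos (edot w s) +
                            cosT h w * sinT G w * sin (edot w s)).
Proof.
pose Q w := cosT h w * cosT G w * cos (edot w s) +
            cosT h w * sinT G w * sin (edot w s).
have mv : measurable_fun setT v by exact: continuous_rV_measurable.
have mQ : measurable_fun setT Q.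
  apply: measurable_funD; apply: measurable_funM.
  - exact: measurable_integrable Qi.
  - exact: (measurableT_comp (@measurable_cosR R) (measurable_edotl s)).
  - exact: measurable_integrable Qi'.
  - exact: (measurableT_comp (@measurable_sinR R) (measurable_edotl s)).
pose t k : R := k.+1%:R^-1.
have t0 k : 0 < t k by rewrite invr_gt0.
have E k : \int[mu]_w (tents (t k *: w) * Q w) =
    \int[mu]_y (tents_hat y * v (s + t k *: y)).
  have := weighted_parseval (t0 k) (shift_i s) Gi GM.
  under eq_Rintegral do rewrite shift_cosT shift_sinT.
  move=> wE; transitivity (\int[mu]_w (tents (t k *: w) *
      (cos (edot w s) * cosT h w * cosT G w +
       sin (edot w s) * cosT h w * sinT G w))).
    by apply: eq_Rintegral => w _; rewrite /Q; ring.
  rewrite wE; apply: eq_Rintegral => y _; congr (_ * _).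
  by apply: eq_Rintegral => z _; rewrite /shift opprD addrA addrAC.
have L1 : \int[mu]_w (tents (t k *: w) * Q w) @[k --> \oo] --> \int[mu]_w Q w.
  apply: (@Rdominated_cvg _ _ _ _ _ _
    (fun w => `|cosT h w * cosT G w| + `|cosT h w * sinT G w|)) => //.
  - move=> k; apply: measurable_funM => //.
    exact: measurable_dilated_tents.
  - by apply: integrableD_EFin => //; [exact: (integrable_norm Qi)|exact: (integrable_norm Qi')].
  - move=> k w; rewrite normrM ger0_norm ?tents_ge0//.
    rewrite (le_trans (ler_piMl _ (tents_le1 _)))//.
    rewrite (le_trans (ler_normD _ _))// lerD// normrM ler_piMr//.
      exact: normr_cos.
    exact: normr_sin.
  - move=> w; rewrite -[X in _ --> X]mul1r.
    by apply: cvgM; [exact: tents_cvg1|exact: cvg_cst].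
have L2 : \int[mu]_y (tents_hat y * v (s + t k *: y)) @[k --> \oo] -->
    \int[mu]_y (tents_hat y * v s).
  apply: (@Rdominated_cvg _ _ _ _ _ _ (fun y => V * tents_hat y)) => //.
  - move=> k; apply: measurable_funM; first exact: measurable_tents_hat.
    have := measurableT_comp mv (measurable_affine_rV (t k) s).
    by apply: eq_measurable_fun => y _; rewrite /= addrC.
  - by apply: measurable_funM => //; exact: measurable_tents_hat.
  - exact: (integrableZl_EFin V measurableT (@integrable_tents_hat R n)).
  - move=> k y; rewrite normrM mulrC (ger0_norm (tents_hat_ge0 _)).
    by rewrite ler_wpM2r ?tents_hat_ge0.
  - move=> y; apply: cvgM; first exact: cvg_cst.
    have sy : s + t k *: y @[k --> \oo] --> s; last first.
      exact: (cvg_comp _ _ sy (@v_continuous s)).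
    suff : s + t k *: y @[k --> \oo] --> s + 0 *: y by rewrite scale0r addr0.
    apply: cvgD; first exact: cvg_cst.
    by apply: cvgZr_tmp; exact: cvg_harmonic.
rewrite /kappa -RintegralZr//; last exact: integrable_tents_hat.
rewrite -[RHS]/(\int[mu]_w Q w).
move: L1 L2; under eq_fun do rewrite E.
by move=> /(cvg_lim (@Rhausdorff R)) <- /(cvg_lim (@Rhausdorff R)) <-.
Qed.

End fourier_inversion.

(** * Plancherel transforms of integrable functions *)

Section plancherel.
Context (R : realType) (n : nat) (h : 'rV[R]_n -> R).
Notation mu := (leb R n).
Hypothesis hi : mu.-integrable setT (EFin \o h).

Let mh : measurable_fun setT h.
Proof. exact: measurable_integrable hi. Qed.

Let trunc (N : nat) w := fourier_re (eball 0 N%:R) h w.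

Let mtrunc N : measurable_fun setT (trunc N).
Proof.
apply: (@measurable_Rintegral_section _ _ _ _ R mu _ (measurable_eball 0 N%:R)
  (fun wx : 'rV[R]_n * 'rV[R]_n => h wx.2 * cos (edot wx.1 wx.2))).
apply: measurable_funM; first exact: measurableT_comp mh measurable_snd.
exact: (measurableT_comp (@measurable_cosR R) (@measurable_edot2 R n)).
Qed.

Lemma fourier_re_cvg w : trunc N w @[N --> \oo] --> cosT h w.
Proof.
pose F N x := ((fun x => h x * cos (edot w x)) \_ (eball 0 N%:R)) x.
have -> : trunc ^~ w = fun N => \int[mu]_x F N x.
  by apply/funext => N; rewrite /trunc /fourier_re Rintegral_mkcond.
have mc : measurable_fun setT (fun x => h x * cos (edot w x)).
  exact: measurable_integrable (integrable_cosM w hi).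
apply: (@Rdominated_cvg _ _ _ _ _ _ (fun x => `|h x|)) => //.
- move=> N; apply/(measurable_restrictT _ (measurable_eball _ _)).
  exact: measurable_funTS.
- exact: (integrable_norm hi).
- move=> N x; rewrite /F patchE; case: ifPn => _; last by rewrite normr0.
  by rewrite normrM ler_piMr// normr_cos.
- move=> x; apply: cvg_near_cst; near=> N.
  rewrite /F patchE ifT// inE /eball /= subr0.
  by near: N; exact: nbhs_infty_gtr.
Unshelve. all: by end_near. Qed.

(** The Plancherel transform of an integrable function is its Fourier integral:
    along the truncations the former is the mean-square limit, the latter the
    pointwise one, and Fatou's lemma identifies them. *)
Lemma plancherel_ae (gr : 'rV[R]_n -> R) : measurable_fun setT gr ->
  ('N[mu]_2%:E[EFin \o (trunc N \- gr)%R] @[N --> \oo] --> 0)%E ->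
  ae_eq mu setT (EFin \o (cosT h)) (EFin \o gr).
Proof.
move=> mgr L2.
have mC := measurable_cosT mh.
pose D w := cosT h w - gr w.
have mD : measurable_fun setT D by exact: measurable_funB.
have small (eta : R) : 0 < eta -> (\int[mu]_w (`|D w| `^ 2)%:E <= (eta `^ 2)%:E)%E.
  move=> eta0.
  apply: (@fatou_le _ _ _ _ (fun N w => `|trunc N w - gr w| `^ 2)).
  - move=> N; apply: (measurable_powR_norm 2 (f := fun w => trunc N w - gr w)).
    exact: measurable_funB.
  - by move=> N w; exact: powR_ge0.
  - move=> w; rewrite /D powR_mulrn//.
    have tw := @fourier_re_cvg w.
    have : `|trunc N w - gr w| ^+ 2 @[N --> \oo] --> `|cosT h w - gr w| ^+ 2.
      have tn : `|trunc N w - gr w| @[N --> \oo] --> `|cosT h w - gr w|.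
        by apply: cvg_norm; apply: cvgB => //; exact: cvg_cst.
      by rewrite expr2; under eq_fun do rewrite expr2; exact: cvgM.
    by under eq_fun do rewrite -powR_mulrn//.
  have /fine_cvgP[fnum /cvgr0Pnorm_le /(_ eta eta0) Nle] := L2.
  near=> N.
  set I := (\int[mu]_x _)%E.
  have I0 : (0 <= I)%E by apply: integral_ge0 => w _; rewrite lee_fin powR_ge0.
  have NE : 'N[mu]_2%:E[EFin \o (trunc N \- gr)%R]%E = (I `^ 2^-1)%E.
    rewrite -[I]/(\int[mu]_(x in setT) (`|(trunc N \- gr) x| `^ 2)%:E)%E.
    rewrite -Lnorm_restrict//; congr (Lnorm _ _ (EFin \o _)).
    by apply/funext => w; rewrite patchE in_setT.
  have -> : I = ('N[mu]_2%:E[EFin \o (trunc N \- gr)%R]%E `^ 2)%E.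
    by rewrite NE -poweRrM mulVf// poweRe1.
  rewrite -poweR_EFin.
  apply: ge0_le_poweR => //; first exact: Lnorm_ge0.
  have Nfin : ('N[mu]_2%:E[EFin \o (trunc N \- gr)%R])%E \is a fin_num.
    by near: N.
  rewrite -(fineK Nfin) lee_fin; apply: le_trans (ler_norm _) _.
  by near: N.
have D0 : (\int[mu]_w `|(`|D w| `^ 2)%:E| = 0)%E.
  under eq_integral do rewrite gee0_abs ?lee_fin ?powR_ge0//.
  apply/eqP; rewrite eq_le integral_ge0 ?andbT; last first.
    by move=> w _; rewrite lee_fin powR_ge0.
  apply/lee_addgt0Pr => e e0; rewrite add0e.
  have := small (Num.sqrt e); rewrite sqrtr_gt0 => /(_ e0).
  by rewrite powR_mulrn ?sqrtr_ge0// sqr_sqrtr// ltW.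
have mD2 : measurable_fun setT (EFin \o (fun w => `|D w| `^ 2)).
  by apply/measurable_EFinP; exact: measurable_powR_norm.
have := (ae_eq_integral_abs mu measurableT mD2).1 D0.
apply: filterS => w /(_ I) /= [] /powR_eq0_eq0/eqP.
by rewrite normr_eq0 subr_eq0 => /eqP ->.
Unshelve. all: by end_near. Qed.

Lemma Hr_weighted_transform (r : nat) : Hr r h ->
  (\int[mu]_w (cosT h w ^+ 2 * (1 + enorm w ^+ 2) ^+ r)%:E < +oo)%E.
Proof.
move=> [_ [gr [gi [[gr2 gi2 Lre _] fin]]]].
have mgr := measurable_Lfun gr2; have mgi := measurable_Lfun gi2.
have mC := measurable_cosT mh.
have mE : measurable_fun setT (fun w : 'rV[R]_n => (1 + enorm w ^+ 2) ^+ r).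
  apply: measurable_funX; apply: measurable_funD => //.
  by apply: measurable_funX; exact: measurable_enorm.
have E0 (w : 'rV[R]_n) : 0 <= (1 + enorm w ^+ 2) ^+ r.
  by rewrite exprn_ge0// addr_ge0// sqr_ge0.
apply: le_lt_trans fin.
have -> : (\int[mu]_w (cosT h w ^+ 2 * (1 + enorm w ^+ 2) ^+ r)%:E =
    \int[mu]_w (gr w ^+ 2 * (1 + enorm w ^+ 2) ^+ r)%:E)%E.
  apply: ae_eq_integral => //.
  - by apply/measurable_EFinP; apply: measurable_funM => //; exact: measurable_funX.
  - by apply/measurable_EFinP; apply: measurable_funM => //; exact: measurable_funX.
  - have := plancherel_ae mgr Lre.
    by apply: filterS => w /(_ I) [] /= ->.
apply: ge0_le_integral_EFin => //.
- by apply: measurable_funM => //; exact: measurable_funX.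
- by apply: measurable_funM => //; apply: measurable_funD; exact: measurable_funX.
- by move=> w _; rewrite mulr_ge0 ?sqr_ge0.
- by move=> w _; rewrite ler_wpM2r// lerDl sqr_ge0.
Qed.

End plancherel.

(** * Differentiation of trigonometric integrals *)

Section trigonometric_integrals.
Context (R : realType) (n : nat).
Notation mu := (leb R n).
Implicit Types (A B : 'rV[R]_n -> R) (x y w : 'rV[R]_n).

(** Dominated convergence being about sequences, continuity in [x] is
    tested along them. *)
Lemma sequential_continuity (f : 'rV[R]_n -> R) x :
  (forall y : nat -> 'rV[R]_n, y k @[k --> \oo] --> x ->
    f (y k) @[k --> \oo] --> f x) ->
  {for x, continuous f}.
Proof.
move=> fx; apply/(@cvgrPdist_le _ R^o _ (nbhs x)) => e e0; apply: contrapT => H.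
have /choice[y yP] : forall k : nat, exists y : 'rV[R]_n,
    `|x - y| < k.+1%:R^-1 /\ ~ `|f x - f y| <= e.
  move=> k; apply: contrapT => Hk; apply: H.
  apply/nbhs_ballP; exists k.+1%:R^-1 => /=; first by rewrite invr_gt0.
  move=> y; rewrite -ball_normE /= => xy; apply: contrapT => fxy.
  by apply: Hk; exists y.
have yx : y k @[k --> \oo] --> x.
  apply/cvgrPdist_lt => eta eta0.
  have := @cvg_harmonic R => /cvgr0Pnorm_lt /(_ eta eta0).
  apply: filterS => k; rewrite /= ger0_norm ?invr_ge0//.
  exact: lt_trans (yP k).1.
have /cvgrPdist_le /(_ e e0) [N _ /(_ N (leqnn N))] := fx y yx.
exact: (yP N).2.
Qed.

Variable lam : R.

Definition trig_integral A B x : R :=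
  \int[mu]_w (A w * cos (lam * edot w x) + B w * sin (lam * edot w x)).

(** The weight [(1 + |w|) ^ r] grows like [(1 + |w| ^ 2) ^ (r / 2)] and has
    an integer exponent. *)
Definition has_moment (r : nat) A :=
  mu.-integrable setT (EFin \o (fun w => A w * (1 + enorm w) ^+ r)).

Let bracket_ge1 r w : 1 <= (1 + enorm w) ^+ r.
Proof. by rewrite exprn_ege1// lerDl enorm_ge0. Qed.

Let measurable_bracket r :
  measurable_fun setT (fun w : 'rV[R]_n => (1 + enorm w) ^+ r).
Proof.
by apply: measurable_funX; apply: measurable_funD => //; exact: measurable_enorm.
Qed.

Lemma has_moment_measurable r A : has_moment r A -> measurable_fun setT A.
Proof.
move=> Ai; have mAb : measurable_fun setT (fun w => A w * (1 + enorm w) ^+ r).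
  exact: measurable_integrable Ai.
have := measurable_funM mAb (measurable_funV (measurable_bracket r)).
apply: eq_measurable_fun => w _ /=; rewrite mulfK//.
by rewrite gt_eqF// (lt_le_trans ltr01).
Qed.

Lemma has_moment_mul r A (c : R) (a : 'rV[R]_n -> R) : has_moment r.+1 A ->
  measurable_fun setT a -> (forall w, `|a w| <= `|c| * (1 + enorm w)) ->
  has_moment r (fun w => a w * A w).
Proof.
move=> Ai m_a ac; have mA := has_moment_measurable Ai.
have := integrableZl_EFin `|c| measurableT (integrable_norm Ai).
apply: integrable_bounded_by => //.
  by apply: measurable_funM => //; exact: measurable_funM.
move=> w _; rewrite /= exprS !normrM (ger0_norm (x := 1 + enorm w)); last first.
  by rewrite addr_ge0// enorm_ge0.
rewrite [leRHS](_ : _ =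
  `|c| * (1 + enorm w) * (`|A w| * `|(1 + enorm w) ^+ r|)); last by ring.
by rewrite -mulrA ler_wpM2r// mulr_ge0.
Qed.

Lemma has_moment_le r s A : (s <= r)%N -> has_moment r A -> has_moment s A.
Proof.
move=> sr Ai; have mA := has_moment_measurable Ai.
apply: integrable_bounded_by (integrable_norm Ai) => //.
  by apply: measurable_funM => //; exact: (measurable_bracket s).
move=> w _; rewrite /= !normrM ler_wpM2l// !ger0_norm ?(le_trans ler01)//.
by rewrite ler_weXn2l// lerDl enorm_ge0.
Qed.

Let mphase x : measurable_fun setT (fun w : 'rV[R]_n => lam * edot w x).
Proof. by apply: measurable_funM => //; exact: measurable_edotl. Qed.

Let mintegrand A B x : measurable_fun setT A -> measurable_fun setT B ->
  measurable_fun setT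
    (fun w : 'rV[R]_n => A w * cos (lam * edot w x) + B w * sin (lam * edot w x)).
Proof.
move=> mA mB; apply: measurable_funD; apply: measurable_funM => //.
  exact: (measurableT_comp (@measurable_cosR R) (mphase x)).
exact: (measurableT_comp (@measurable_sinR R) (mphase x)).
Qed.

Let integrand_le A B (t : R) w :
  `|A w * cos t + B w * sin t| <= `|A w| + `|B w|.
Proof.
rewrite (le_trans (ler_normD _ _))// lerD// normrM ler_piMr//.
  exact: normr_cos.
exact: normr_sin.
Qed.

Let integrable_normD A B : has_moment 0 A -> has_moment 0 B ->
  mu.-integrable setT (EFin \o (fun w => `|A w| + `|B w|)).
Proof.
move=> Ai Bi; have := integrableD_EFin measurableT (integrable_norm Ai) (integrable_norm Bi).
by apply: eq_integrable => // w _ /=; rewrite !expr0 !mulr1.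
Qed.

Let integrable_integrand A B x : has_moment 0 A -> has_moment 0 B ->
  mu.-integrable setT (EFin \o
    (fun w => A w * cos (lam * edot w x) + B w * sin (lam * edot w x))).
Proof.
move=> Ai Bi; apply: integrable_bounded_by (integrable_normD Ai Bi) => //.
  by apply: mintegrand; [exact: has_moment_measurable Ai|
    exact: has_moment_measurable Bi].
Qed.

Lemma trig_integral_continuous A B : has_moment 0 A -> has_moment 0 B ->
  continuous (trig_integral A B).
Proof.
move=> Ai Bi x; apply: sequential_continuity => y yx.
have mA := has_moment_measurable Ai; have mB := has_moment_measurable Bi.
apply: Rdominated_cvg (integrable_normD Ai Bi) _ _ => //.
- by move=> k; exact: mintegrand.
- exact: mintegrand.
move=> w.
have phase_cvg : lam * edot w (y k) @[k --> \oo] --> lam * edot w x.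
  apply: cvgM; first exact: cvg_cst.
  apply: cvg_big => [|i _]; [exact: add_continuous|apply: cvgM]; first exact: cvg_cst.
  exact: (cvg_comp _ _ yx (@coord_continuous _ _ _ 0 i x)).
apply: cvgD; (apply: cvgM; first exact: cvg_cst).
  exact: (cvg_comp _ _ phase_cvg (@continuous_cos R _)).
exact: (cvg_comp _ _ phase_cvg (@continuous_sin R _)).
Qed.

Let dA (i : 'I_n) B w : R := lam * w 0 i * B w.
Let dB (i : 'I_n) A w : R := - (lam * w 0 i) * A w.

Let edot_line w x i (s : R) :
  edot w (s *: delta_mx 0 i + x) = s * w 0 i + edot w x.
Proof.
rewrite edotDr edotZr; congr (_ * _ + _).
rewrite /edot (bigD1 i)//= mxE !eqxx mulr1 big1 ?addr0// => j ji.
by rewrite mxE eqxx (negbTE ji) mulr0.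
Qed.

Lemma trig_integral_derive A B x i : has_moment 1 A -> has_moment 1 B ->
  derivable (trig_integral A B) x (delta_mx 0 i) /\
  'D_(delta_mx 0 i) (trig_integral A B) x = trig_integral (dA i B) (dB i A) x.
Proof.
move=> Ai Bi; have Ai0 := has_moment_le (leq0n 1) Ai; have Bi0 := has_moment_le (leq0n 1) Bi.
pose f (s : R) w := A w * cos (lam * (s * w 0 i + edot w x)) +
                    B w * sin (lam * (s * w 0 i + edot w x)).
pose df (s : R) w := dA i B w * cos (lam * (s * w 0 i + edot w x)) +
                    dB i A w * sin (lam * (s * w 0 i + edot w x)).
have fd (s : R) w : is_derive s (1 : R) (f ^~ w) (df s w).
  rewrite /f /df /dA /dB; apply: is_derive_eq.
  rewrite /GRing.scale /=; ring.
pose F s := \int[mu]_w f s w.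
have FE s : F s = trig_integral A B (s *: delta_mx 0 i + x).
  by apply: eq_Rintegral => w _; rewrite /f edot_line.
pose G w := `|lam| * ((`|A w| + `|B w|) * (1 + enorm w)).
have Gi : mu.-integrable setT (EFin \o G).
  apply: integrableZl_EFin => //.
  have := integrableD_EFin measurableT (integrable_norm Ai) (integrable_norm Bi).
  apply: eq_integrable => // w _ /=.
  by rewrite !expr1 !normrM (ger0_norm (x := 1 + _)) ?addr_ge0 ?enorm_ge0// mulrDl.
have G0 w : 0 <= G w by rewrite !mulr_ge0// ?addr_ge0// enorm_ge0.
have fi s : `]-1, 1[%classic s -> mu.-integrable setT (EFin \o f s).
  move=> _; have := integrable_integrand (s *: delta_mx 0 i + x) Ai0 Bi0.
  by apply: eq_integrable => // w _ /=; rewrite edot_line.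
have I0 : (`]-1, 1[%classic : set R) 0 by rewrite /= in_itv/= ltrN10 ltr01.
have dfE s w : partial1of2 f s w = df s w.
  by rewrite /partial1of2 derive1E; exact: derive_val.
have wi w : `|w 0 i| <= 1 + enorm w.
  by rewrite (le_trans (coord_le_enorm w i))// lerDr.
have fG s w : `]-1, 1[%classic s -> setT w -> `|partial1of2 f s w| <= G w.
  move=> _ _; rewrite dfE (le_trans (integrand_le _ _ _ _))//.
  rewrite /dA /dB !normrM normrN normrM -mulrDr /G -mulrA [`|B w| + _]addrC.
  by rewrite ler_wpM2l// mulrC ler_wpM2l// addr_ge0.
have dfs s w : `]-1, 1[%classic s -> setT w -> derivable (f ^~ w) s 1.
  by move=> _ _; exact: ex_derive.
have Fder := derivable_under_integral measurableT I0 fi dfs G0 Gi fG.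
have Fval := differentiation_under_integral measurableT I0 fi dfs G0 Gi fG.
have quot : (fun h : R => h^-1 *: ((trig_integral A B \o shift x)
      (h *: delta_mx 0 i) - trig_integral A B x)) =
    (fun h : R => h^-1 *: ((F \o shift (0 : R)) (h *: (1 : R)) - F 0)).
  apply/funext => h /=; rewrite !FE scale0r add0r addr0.
  by rewrite /GRing.scale/= mulr1.
split; first by rewrite /derivable quot.
rewrite /derive quot -[LHS]/('D_1 F 0) -derive1E Fval.
by apply: eq_Rintegral => w _; rewrite dfE /df mul0r add0r.
Qed.

Lemma Cr_trig_integral (Om : set 'rV[R]_n) r A B :
  has_moment r A -> has_moment r B -> Cr r Om (trig_integral A B).
Proof.
elim: r A B => [|r IH] A B Ai Bi /=.
  by apply: continuous_subspaceT; exact: trig_integral_continuous.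
have Ai1 : has_moment 1 A by exact: has_moment_le Ai.
have Bi1 : has_moment 1 B by exact: has_moment_le Bi.
split.
  apply: continuous_subspaceT; apply: trig_integral_continuous;
    [exact: has_moment_le Ai|exact: has_moment_le Bi].
move=> i; split=> [x _|]; first exact: (trig_integral_derive x i Ai1 Bi1).1.
have -> : (fun x => 'D_(delta_mx 0 i) (trig_integral A B) x) =
    trig_integral (dA i B) (dB i A).
  by apply/funext => x; rewrite (trig_integral_derive x i Ai1 Bi1).2.
have mw : measurable_fun setT (fun w : 'rV[R]_n => lam * w 0 i).
  by apply: measurable_funM => //; exact: (measurable_rV_coord i).
have wi w : `|lam * w 0 i| <= `|lam| * (1 + enorm w).
  by rewrite normrM ler_wpM2l// (le_trans (coord_le_enorm w i))// lerDr.
apply: IH.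
  exact: (has_moment_mul (c := lam) Bi mw wi).
apply: (has_moment_mul (c := lam) Ai).
  exact: measurableT_comp.
by move=> w; rewrite normrN.
Qed.

End trigonometric_integrals.

(** * Regularity of the bistochastic operator *)

Section regularity.
Context (R : realType) (n : nat) (h : 'rV[R]_n -> R) (Om : set 'rV[R]_n).
Notation mu := (leb R n).
Hypothesis h_L1 : h \in Lfun (leb R n) 1%E.
Hypothesis h_ge0 : forall x, 0 <= h x.
Hypothesis h_norm1 : ('N[leb R n]_1[EFin \o h])%E = 1%E.
Hypothesis h_decr : forall x y, enorm x <= enorm y -> h y <= h x.
Hypothesis mOm : measurable Om.
Hypothesis oOm : open Om.
Hypothesis bOm : bounded_set Om.
Variable eps : R.
Hypothesis eps_gt0 : 0 < eps.

Let hi : mu.-integrable setT (EFin \o h). Proof. exact: radial_integrable. Qed.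
Let mh : measurable_fun setT h. Proof. exact: radial_measurable h_L1. Qed.
Let h_le0 x : h x <= h 0. Proof. exact: radial_le0. Qed.

(** Cauchy-Schwarz: [h] in [H^r] puts the weight on the first factor. *)
Lemma product_has_moment r (G : 'rV[R]_n -> R) : Hr r h ->
  measurable_fun setT G -> (\int[mu]_w (G w ^+ 2)%:E < +oo)%E ->
  has_moment r (fun w => cosT h w * G w).
Proof.
move=> hr mG G2; have mC := measurable_cosT mh.
have mE : measurable_fun setT (fun w : 'rV[R]_n => (1 + enorm w) ^+ r).
  by apply: measurable_funX; apply: measurable_funD => //; exact: measurable_enorm.
have mE2 : measurable_fun setT (fun w : 'rV[R]_n => (1 + enorm w ^+ 2) ^+ r).
  apply: measurable_funX; apply: measurable_funD => //.
  by apply: measurable_funX; exact: measurable_enorm.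
have i1 : mu.-integrable setT
    (EFin \o (fun w => cosT h w ^+ 2 * (1 + enorm w ^+ 2) ^+ r)).
  apply: ge0_integrable_EFin => //.
  - by apply: measurable_funM => //; exact: measurable_funX.
  - by move=> w _; rewrite mulr_ge0 ?sqr_ge0// exprn_ge0// addr_ge0// sqr_ge0.
  - exact: Hr_weighted_transform.
have i2 : mu.-integrable setT (EFin \o (fun w => G w ^+ 2)).
  apply: ge0_integrable_EFin => //; first exact: measurable_funX.
  by move=> w _; exact: sqr_ge0.
have := integrableD_EFin measurableT (integrableZl_EFin (2 ^+ r) measurableT i1) i2.
apply: integrable_bounded_by => //.
  by apply: measurable_funM => //; exact: measurable_funM.
move=> w _.
set c := cosT h w; set e := (1 + enorm w) ^+ r.
have e0 : 0 <= e by rewrite exprn_ge0// addr_ge0// enorm_ge0.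
have e2 : e ^+ 2 <= 2 ^+ r * (1 + enorm w ^+ 2) ^+ r.
  rewrite -exprMn /e -exprM mulnC exprM lerXn2r ?nnegrE ?sqr_ge0//.
    by rewrite mulr_ge0// addr_ge0// sqr_ge0.
  have := sqr_ge0 (1 - enorm w); nra.
apply: (@le_trans _ _ (c ^+ 2 * e ^+ 2 + G w ^+ 2)); last first.
  by rewrite lerD2r [2 ^+ r * _]mulrCA ler_wpM2l// sqr_ge0.
rewrite ler_norml; have := sqr_ge0 (c * e - G w); have := sqr_ge0 (c * e + G w).
have := sqr_ge0 (c * e); have := sqr_ge0 (G w).
by move=> *; apply/andP; split; nra.
Qed.

(** In the variable [x / eps] the average is the convolution of [h] with a
    bounded integrable function [G], to which [convolution_inversion]
    applies. *)
Lemma k_eps_conv_Cr r (g : 'rV[R]_n -> R) (M : R) : Hr r h ->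
  measurable_fun setT g -> (forall z, Om z -> `|g z| <= M) ->
  Cr r Om (fun x => \int[mu]_(z in Om) (k_eps h eps x z * g z)).
Proof.
move=> hr mg gM.
have epsN0 : eps != 0 by rewrite gt_eqF.
pose gO := g \_ Om.
have mgO : measurable_fun setT gO.
  by apply/(measurable_restrictT _ mOm); exact: measurable_funTS.
have gOM z : `|gO z| <= `|M|.
  rewrite /gO patchE; case: ifPn => [/set_mem Oz|_]; last by rewrite normr0.
  exact: le_trans (gM z Oz) (ler_norm _).
have gOi : mu.-integrable setT (EFin \o gO).
  rewrite -restrict_EFin; apply: (integrable_mkcond (mu := mu) (EFin \o g) mOm).1.
  have := integrable_cst_bounded mOm bOm M; apply: integrable_bounded_by => //.
  exact: measurable_funTS.
pose G z := gO (eps *: z).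
have Gi : mu.-integrable setT (EFin \o G).
  have := integrable_affine_rV 0 epsN0 gOi.
  by apply: eq_integrable => // z _ /=; rewrite addr0.
have mG : measurable_fun setT G.
  exact: measurable_integrable Gi.
have GM z : `|G z| <= `|M| by exact: gOM.
pose v s := \int[mu]_z (G z * h (z - s)).
have uE x : \int[mu]_(z in Om) (k_eps h eps x z * g z) = v (eps^-1 *: x).
  pose f z := h (eps^-1 *: (z - x)) * gO z.
  have fi : mu.-integrable setT (EFin \o f).
    have := integrableZl_EFin (h 0) measurableT (integrable_norm gOi).
    apply: integrable_bounded_by => //.
      apply: measurable_funM => //.
      have := measurableT_comp mh (measurable_affine_rV eps^-1 (- (eps^-1 *: x))).
      by apply: eq_measurable_fun => z _ /=; rewrite scalerBr.
    by move=> z _; rewrite /f normrM ler_wpM2r// ger0_norm.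
  transitivity (\int[mu]_z (eps ^- n * f z)).
    rewrite Rintegral_mkcond; apply: eq_Rintegral => z _.
    rewrite /f /gO !patchE; case: ifPn => _; last by rewrite !mulr0.
    by rewrite mulrA.
  have := Rintegral_affine_rV 0 epsN0 fi; rewrite gtr0_norm// => fE.
  rewrite RintegralZl// -fE; apply: eq_Rintegral => z _.
  by rewrite /f /G addr0 mulrC scalerBr scalerA mulVf// scale1r.
have v_cont : continuous v.
  have vE : v = fun s => \int[mu]_(z in setT) (k_eps h 1 s z * G z).
    apply/funext => s; apply: eq_Rintegral => z _.
    by rewrite /k_eps /h_eps expr1n !invr1 mul1r scale1r mulrC.
  rewrite vE => s.
  exact: (k_eps_conv_continuous h_L1 h_ge0 h_norm1 h_decr measurableT ltr01 mG
    (fun z _ => GM z)).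
pose V := h 0 * \int[mu]_z `|G z|.
have vV s : `|v s| <= V.
  have GNi := integrable_norm Gi.
  have Ghi : mu.-integrable setT (EFin \o (fun z => G z * h (z - s))).
    have := integrableZl_EFin (h 0) measurableT GNi.
    apply: integrable_bounded_by => //.
      apply: measurable_funM => //.
      have := measurableT_comp mh (measurable_affine_rV 1 (- s)).
      by apply: eq_measurable_fun => z _ /=; rewrite scale1r.
    by move=> z _; rewrite normrM mulrC ler_wpM2r// ger0_norm.
  apply: le_trans (le_normr_Rintegral measurableT Ghi) _.
  rewrite /V -RintegralZl//; apply: le_Rintegral => //.
  - exact: (integrable_norm Ghi).
  - exact: (integrableZl_EFin (h 0) measurableT GNi).
  - by move=> z _; rewrite normrM mulrC ler_wpM2r// ger0_norm.
have mCG := measurable_cosT mG; have mSG := measurable_sinT mG.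
have E2 := transform_L2 Gi GM.
have mE2 : measurable_fun setT (fun w => cosT G w ^+ 2 + sinT G w ^+ 2).
  by apply: measurable_funD; exact: measurable_funX.
have CG2 : (\int[mu]_w (cosT G w ^+ 2)%:E < +oo)%E.
  apply: le_lt_trans E2; apply: ge0_le_integral_EFin => //.
  - exact: measurable_funX.
  - by move=> w _; exact: sqr_ge0.
  - by move=> w _; rewrite lerDl sqr_ge0.
have SG2 : (\int[mu]_w (sinT G w ^+ 2)%:E < +oo)%E.
  apply: le_lt_trans E2; apply: ge0_le_integral_EFin => //.
  - exact: measurable_funX.
  - by move=> w _; exact: sqr_ge0.
  - by move=> w _; rewrite lerDr sqr_ge0.
have mA := product_has_moment hr mCG CG2; have mB := product_has_moment hr mSG SG2.
have moment0_i (A : 'rV[R]_n -> R) : has_moment r A ->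
    mu.-integrable setT (EFin \o A).
  move=> /(has_moment_le (leq0n r)); apply: eq_integrable => // w _ /=.
  by rewrite expr0 mulr1.
have inv := convolution_inversion hi (radial_even h_decr) Gi GM v_cont vV
  (moment0_i _ mA) (moment0_i _ mB).
have k0 := kappa_gt0 R n.
apply: (@eq_Cr _ _ _ oOm _ (fun x => (kappa R n)^-1 *
    trig_integral eps^-1 (fun w => cosT h w * cosT G w)
      (fun w => cosT h w * sinT G w) x)).
  move=> x _; rewrite uE -[RHS]mul1r -(mulVf (x := kappa R n)) ?gt_eqF// -mulrA.
  congr (_ * _); rewrite inv; apply: eq_Rintegral => w _.
  by rewrite edotZr.
by apply: CrM => //; [exact: Cr_cst|exact: Cr_trig_integral].
Qed.

Variable c : R.
Hypothesis c_gt0 : 0 < c.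
Hypothesis k_gec : forall x, Om x ->
  (c%:E <= \int[mu]_(y in Om) (k_eps h eps x y)%:E)%E.

Lemma d_eps_convE :
  d_eps Om h eps = fun x => \int[mu]_(z in Om) (k_eps h eps x z * 1).
Proof.
by apply/funext => x; apply: eq_Rintegral => z _; rewrite mulr1.
Qed.

Lemma d_eps_ge x : Om x -> c <= d_eps Om h eps x.
Proof.
move=> Ox; rewrite -lee_fin RintegralE//; first exact: k_gec.
by have [/(_ x Ox)[]] := Ptilde_kernel_well_defined mOm h_L1 h_ge0 h_norm1
  h_decr eps_gt0 c_gt0 k_gec.
Qed.

Lemma d_eps_neq0 x : Om x -> d_eps Om h eps x != 0.
Proof. by move=> /d_eps_ge dc; rewrite gt_eqF// (lt_le_trans c_gt0). Qed.

Lemma Ptilde_Cb (p : \bar R) (f : 'rV[R]_n -> R) : (1 <= p)%E ->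
  LpOn Om p f -> Cb Om (Ptilde Om h eps f).
Proof.
move=> p1 fp; have fi := LpOn_integrable mOm bOm p1 fp.
have [g [G [mg gG PE]]] := Ptilde_quotient mOm h_L1 h_ge0 h_norm1 h_decr
  eps_gt0 c_gt0 k_gec fi.
pose N x := \int[mu]_(z in Om) (k_eps h eps x z * g z).
have cN : {within Om, continuous N}.
  apply: continuous_subspaceT => x.
  exact: (k_eps_conv_continuous h_L1 h_ge0 h_norm1 h_decr mOm eps_gt0 mg gG).
have cD : {within Om, continuous (d_eps Om h eps)}.
  rewrite d_eps_convE; apply: continuous_subspaceT => x.
  apply: (k_eps_conv_continuous h_L1 h_ge0 h_norm1 h_decr mOm eps_gt0
    (G := 1) (g := cst 1)) => //.
  by move=> z _; rewrite normr1.
split.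
  apply: (@eq_within_continuous _ _ _ (fun x => (d_eps Om h eps x)^-1 * N x)).
    by move=> x Ox; rewrite PE.
  apply: within_continuousM => //; apply: within_continuousV => //.
  exact: d_eps_neq0.
exists (eps ^- n * h 0 / c ^+ 3 * \int[mu]_(y in Om) `|f y|) => x Ox.
exact: (Ptilde_le mOm h_L1 h_ge0 h_norm1 h_decr eps_gt0 c_gt0 k_gec p1 fp fi Ox).
Qed.

Lemma Ptilde_Cr (r : nat) (p : \bar R) (f : 'rV[R]_n -> R) : (1 <= p)%E ->
  LpOn Om p f -> Hr r h -> Cr r Om (Ptilde Om h eps f).
Proof.
move=> p1 fp hr; have fi := LpOn_integrable mOm bOm p1 fp.
have [g [G [mg gG PE]]] := Ptilde_quotient mOm h_L1 h_ge0 h_norm1 h_decr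
  eps_gt0 c_gt0 k_gec fi.
apply: (@eq_Cr _ _ _ oOm _ (fun x => (d_eps Om h eps x)^-1 *
    \int[mu]_(z in Om) (k_eps h eps x z * g z))).
  by move=> x Ox; rewrite PE.
apply: CrM => //; last exact: k_eps_conv_Cr mg gG.
apply: CrV => //.
  by move=> x Ox; exact: d_eps_neq0.
rewrite d_eps_convE.
apply: (k_eps_conv_Cr (g := cst 1) (M := 1)) => //.
by move=> z _; rewrite normr1.
Qed.

End regularity.

(** * Conclusion *)

Theorem theorem5p1 (R : realType) (n : nat) (Om : set 'rV[R]_n)
    (h : 'rV[R]_n -> R)
    (Om_open : open Om) (Om_thick : thick Om)
    (h_L1 : h \in Lfun (leb R n) 1%E)
    (h_ge0 : forall x, 0 <= h x)
    (h_orth : forall (O : 'M[R]_n) x, O *m O^T = 1%:M -> h (x *m O^T) = h x)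
    (h_norm1 : 'N[leb R n]_1[EFin \o h]%E = 1%E)
    (h_decr : forall x y, enorm x <= enorm y -> h y <= h x) :
  exists2 eps0 : R, 0 < eps0 &
    (forall p : \bar R, (1 <= p)%E ->
       exists M : R, forall eps, 0 < eps < eps0 ->
         [/\ Ptilde_well_defined Om h eps p,
             Lp_operator Om p (Ptilde Om h eps) &
             forall f, LpOn Om p f ->
               (LpnormOn Om p (Ptilde Om h eps f) <= M%:E * LpnormOn Om p f)%E])
    /\
    (bounded_set Om ->
     (exists C delta : R, [/\ 0 < C, 0 < delta &
        forall x, `|h x| <= C * (1 + enorm x) `^ (- (n%:R + delta))]) ->
     [/\ forall (p : \bar R) f, (1 < p < +oo)%E -> LpOn Om p f ->
           LpnormOn Om p (Ptilde Om h eps f \- f) @[eps --> 0^'+] --> 0%E,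
         forall p q : \bar R, (1 < p)%E -> (p^-1 + q^-1 = 1)%E ->
           h \in Lfun (leb R n) q ->
           forall f eps, LpOn Om p f -> 0 < eps < eps0 ->
             Cb Om (Ptilde Om h eps f) &
         forall r : nat, Hr r h ->
           forall f eps, LpOn Om 2%:E f -> 0 < eps < eps0 ->
             Cr r Om (Ptilde Om h eps f)]).
Proof.
have [mOm [c0 [e0 [c0_gt0 e0_gt0 thickP]]]] := Om_thick.
have [a [rho [a_gt0 rho_gt0 h_ge]]] := radial_lower_bound h_L1 h_ge0 h_norm1 h_decr.
pose V := leb R n (eball 0 1).
have V_fin : V \is a fin_num by rewrite /V ge0_fin_numE ?measure_ge0// leb_eball_lty.
have V_gt0 : 0 < fine V by rewrite -lte_fin fineK// /V leb_eball_gt0.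
pose c := a * c0 * rho ^+ n * fine V.
have c_gt0 : 0 < c by rewrite !mulr_gt0// exprn_gt0.
(* Thickness is used on balls of radius [eps * rho], which must be below [e0]. *)
pose eps0 := e0 / rho.
have eps0_gt0 : 0 < eps0 by rewrite divr_gt0.
have k_gec eps x : 0 < eps < eps0 -> Om x ->
    (c%:E <= \int[leb R n]_(y in Om) (k_eps h eps x y)%:E)%E.
  move=> /andP[eps_gt0 eps_lt] Ox; rewrite /c EFinM fineK//.
  apply: (k_eps_ge h_L1 h_ge0 eps_gt0 mOm c0_gt0 a_gt0 rho_gt0 _
    thickP h_ge Ox).
  by rewrite -ltr_pdivlMr.
exists eps0 => //; split=> [p p1|bOm _].
  exists 1 => eps epsI; have /andP[eps_gt0 _] := epsI.
  have k_geceps x := @k_gec eps x epsI.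
  split.
  - exact: (Ptilde_is_well_defined mOm h_L1 h_ge0 h_norm1 h_decr eps_gt0 c_gt0).
  - exact: (Ptilde_Lp_operator mOm h_L1 h_ge0 h_norm1 h_decr eps_gt0 c_gt0).
  - move=> f fp; rewrite mul1e.
    exact: (Ptilde_contraction mOm h_L1 h_ge0 h_norm1 h_decr eps_gt0 c_gt0).
split.
- move=> [p| |] f /andP[p1 poo] fp //; rewrite ?ltxx// in poo.
  rewrite lte_fin in p1.
  exact: (Ptilde_cvg mOm bOm h_L1 h_ge0 h_norm1 h_decr eps0_gt0 c_gt0 k_gec
    (ltW p1) fp).
- move=> p q p1 _ _ f eps fp epsI; have /andP[eps_gt0 _] := epsI.
  exact: (Ptilde_Cb h_L1 h_ge0 h_norm1 h_decr mOm Om_open bOm eps_gt0 c_gt0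
    (fun x => @k_gec eps x epsI) (ltW p1) fp).
- move=> r hr f eps fp epsI; have /andP[eps_gt0 _] := epsI.
  apply: (Ptilde_Cr h_L1 h_ge0 h_norm1 h_decr mOm Om_open bOm eps_gt0 c_gt0
    (fun x => @k_gec eps x epsI) _ fp hr).
  by rewrite lee_fin ler1n.
Qed.
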